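(* Under the standing assumptions on $X,\kappa,A,\omega$ stated in the context, assume moreover that $A$ is Borel. Then there is one and the same measure $\omega^{*A}$ (called the outer balayage of $\omega$ onto $A$) that is uniquely characterized by any one of the following (i)--(vi). (i) $\omega^{*A}$ is the only measure in $\mathcal E^+(A)$ having the property $U^{\omega^{*A}}=U^\omega$ q.e. on $A$, or equivalently the property $\int U^{\omega^{*A}}\,d\mu=\int U^\omega\,d\mu$ for all $\mu\in\mathcal E^+(A)$. (ii) $\omega^{*A}$ is the only measure in $\mathcal E^+(A)$ satisfying $\int U^{\omega^{*A}}\,d\sigma=\int U^\omega\,d\sigma^{*A}$ for all $\sigma\in\mathcal E^+$, where $\sigma^{*A}$ denotes the only measure in $\mathcal E^+(A)$ with $U^{\sigma^{*A}}=U^\sigma$ q.e. on $A$. (iii) $\omega^{*A}$ is uniquely determined within $\mathcal E^+(A)$ by any one of the limit relations $$\omega^{*K}\to\omega^{*A}\ \text{ strongly in }\mathcal E^+\text{ as }K\uparrow A,$$ $$\omega^{*K}\to\omega^{*A}\ \text{ vaguely in }\mathfrak M^+\text{ as }K\uparrow A,$$ $$U^{\omega^{*K}}\uparrow U^{\omega^{*A}}\ \text{ pointwise on }X\text{ as }K\uparrow A,$$ where $\omega^{*K}$ denotes the only measure in $\mathcal E^+(K)$ with $U^{\omega^{*K}}=U^\omega$ q.e. on $K$ (such $\omega^{*K}$ does exist). (iv) $\omega^{*A}$ is the unique solution to the problem of minimizing $I_f(\mu)$ over $\mu\in\mathcal E^+_f(A)$; that is, $\omega^{*A}\in\mathcal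 E^+_f(A)$ and $I_f(\omega^{*A})=\min_{\mu\in\mathcal E^+_f(A)}I_f(\mu)=\widehat w_f(A)\in(-\infty,0]$. (v) $\omega^{*A}$ is the only measure in $\Gamma^*_{A,\omega}\cap\mathcal E^+$ having the property $U^{\omega^{*A}}=\min_{\nu\in\Gamma^*_{A,\omega}}U^\nu$ on $X$. (vi) $\omega^{*A}$ is the only measure in $\Gamma^*_{A,\omega}\cap\mathcal E^+$ having the property $I(\omega^{*A})=\min_{\nu\in\Gamma^*_{A,\omega}}I(\nu)$. Here $\Gamma^*_{A,\omega}:=\{\nu\in\mathfrak M^+:U^\nu\ge U^\omega\text{ q.e. on }A\}$. Actually, $\omega^{*A}=\omega^A$, where $\omega^A$ is the inner balayage of $\omega$ onto $A$, i.e. the unique measure in $\mathcal E^+(A)$ with $U^{\omega^A}=U^\omega$ n.e. on $A$.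
   Context: Setting. $X$ is a second-countable locally compact Hausdorff space. $\mathfrak M$ is the linear space of real-valued (signed) Radon measures on $X$ with the vague topology (pointwise convergence on continuous compactly supported functions $X\to\mathbb R$); $\mathfrak M^+$ is the cone of positive measures in $\mathfrak M$. A kernel $\kappa:X\times X\to[0,\infty]$, i.e. a symmetric lower semicontinuous function, is given. For $\mu,\nu\in\mathfrak M$, $I(\mu,\nu):=\int\kappa\,d(\mu\otimes\nu)$, $U^\mu(x):=\int\kappa(x,y)\,d\mu(y)$, $I(\mu):=I(\mu,\mu)$, whenever well defined as a finite number or $\pm\infty$. Assumptions on $\kappa$. (Energy principle) $I(\mu)\ge0$ for all signed $\mu\in\mathfrak M$ (for which $I(\mu)$ is well defined), with equality only for $\mu=0$; then the measures of finite energy form a pre-Hilbert space $\mathcal E$ with inner product $\langle\mu,\nu\rangle=I(\mu,\nu)$ and norm $\|\mu\|=\sqrt{I(\mu)}$, whose topology is called strong. (Consistency) $\mathcal E^+:=\mathcal E\cap\mathfrak M^+$ is strongly complete, and the strong topology on $\mathcal E^+$ is finer than the vague one. (Domination principle) If $\mu\in\mathcal E^+$, $\nu\in\mathfrak M^+$ and $U^\mu\le U^\nu$ $\mu$-a.e., then $U^\mu\le U^\nu$ on $X$. (Ugaheri's maximum principle) There is a constant $M=M_{X,\kappa}\in[1,\infty)$ such that for each $\mu\in\mathcal E^+$ with $U^\mu\le c_\mu$ $\mu$-a.e., $c_\mu\in(0,\infty)$, one has $U^\mu\le Mc_\mu$ on $X$. Sets and capacity. For $E\subset X$, $\mathfrak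 M^+(E)$ is the set of $\mu\in\mathfrak M^+$ concentrated on $E$ (i.e. $X\setminus E$ is $\mu$-negligible), and $\mathcal E^+(E):=\mathcal E\cap\mathfrak M^+(E)$. For compact $K$, $c(K):=1/\inf\{I(\mu):\mu\in\mathcal E^+(K),\ \mu(X)=1\}$ ($\inf\varnothing=\infty$, $1/\infty=0$); the inner capacity is $c_*(E):=\sup\{c(K):K\subset E\text{ compact}\}$ and the outer capacity is $c^*(E):=\inf\{c_*(D):D\supset E\text{ open}\}$. An assertion holds nearly everywhere (n.e.), resp. quasi-everywhere (q.e.), on $E$ if the set $N\subset E$ where it fails has $c_*(N)=0$, resp. $c^*(N)=0$. $A\subset X$ is a fixed set with $c_*(A)>0$ such that $\mathcal E^+(A)$ is strongly closed. $\mathfrak C_A$ is the upward directed (by inclusion) set of compact $K\subset A$, where only $K$ with $c(K)>0$ are considered; ''as $K\uparrow A$'' refers to convergence of nets indexed by $\mathfrak C_A$. The measure $\omega$. $\omega\in\mathfrak M^+$, $\omega\ne0$, and either $\omega\in\mathcal E^+$, or all of the following hold: (a) $\omega(X)<\infty$; (b) for every compact $K\subset A$, $U^\omega|_K$ is upper semicontinuous (hence continuous, with finite values); (c) $U^\omega$ is bounded on $A$. Notation. $f:=-U^\omega$. $\mathcal E^+_f(A)$ is the set of $\mu\in\mathcal E^+(A)$ for which $f$ is $\mu$-integrable; $I_f(\mu):=\|\mu\|^2-2\int U^\omega\,d\mu$ for $\mu\in\mathcal E_f^+(A)$; $\widehat w_f(A):=\inf_{\mu\in\mathcal E^+_f(A)}I_f(\mu)\in[-\infty,0]$.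 *)

(* Defs.v *)
From HB Require Import structures.
From mathcomp Require Import all_boot all_order all_algebra.
From mathcomp Require Import all_classical all_reals all_analysis.

Set Implicit Arguments.
Unset Strict Implicit.
Unset Printing Implicit Defensive.

Import Order.TTheory GRing.Theory Num.Theory.
Import numFieldNormedType.Exports.

Local Open Scope classical_set_scope.
Local Open Scope ring_scope.
Local Open Scope ereal_scope.

(* X with its Borel sigma-algebra; as a type it is X itself. *)
Notation borel X := (g_sigma_algebraType (@open X)).

Notation meas X R := {measure set (borel X) -> \bar R}.

Section measures.
Context {R : realType} {X : ptopologicalType}.
Implicit Types mu nu : meas X R.

(* Library measures are functions on all sets, whose values on non-measurable
   sets carry no information: measures are compared on Borel sets only. *)
Definition meas_eq mu nu := forall B : set (borel X), measurable B -> mu B = nu B.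

Definition zero_meas : meas X R := mzero.

Definition the_only (P : set (meas X R)) mu := forall nu, P nu <-> meas_eq nu mu.

(* The cone of positive Radon measures. *)
Definition radon : set (meas X R) := [set mu |
  (forall K : set X, compact K -> mu K < +oo) /\
  (forall B : set (borel X), measurable B ->
     mu B = ereal_sup [set mu K | K in [set K : set X | compact K /\ K `<=` B]])].

(* A real-valued Radon measure is represented by its Jordan decomposition
   (positive part, negative part): a pair of mutually singular positive Radon
   measures. Both parts may have infinite total mass, so that the charges of
   the library, which are finite, do not apply. *)
Definition signed_radon : set (meas X R * meas X R) := [set mu |
  [/\ radon mu.1, radon mu.2 &
    exists P : set (borel X), [/\ measurable P, mu.1 (~` P) = 0 & mu.2 P = 0]]].

Definition pos_signed mu : meas X R * meas X R := (mu, zero_meas).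

(* X \ E is only required to be negligible, so E need not be Borel. *)
Definition concentrated (E : set X) mu := mu.-negligible (~` E).

Definition vague_cvg {T : Type} (F : set_system T) (u : T -> meas X R) mu :=
  forall phi : X -> R, continuous phi -> compact (closure [set x | phi x != 0%R]) ->
    (\int[u i]_x phi x)%R @[i --> F] --> (\int[mu]_x phi x)%R.

End measures.

Section potential_theory.
Context {R : realType} {X : ptopologicalType} (kappa : X * X -> \bar R).
Implicit Types (mu nu omega sigma : meas X R) (E K A : set X).

Definition is_kernel :=
  [/\ forall z, 0 <= kappa z,
      forall x y, kappa (x, y) = kappa (y, x) &
      lower_semicontinuous kappa].

Definition potential mu (x : X) : \bar R := \int[mu]_y kappa (x, y).

Definition mutual_energy mu nu : \bar R := \int[mu \x nu]_z kappa z.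

Definition energy mu := mutual_energy mu mu.

(* The positive and negative parts of the signed product measure. *)
Definition energy_pos (mu nu : meas X R * meas X R) :=
  mutual_energy mu.1 nu.1 + mutual_energy mu.2 nu.2.

Definition energy_neg (mu nu : meas X R * meas X R) :=
  mutual_energy mu.1 nu.2 + mutual_energy mu.2 nu.1.

Definition energy_defined (mu nu : meas X R * meas X R) :=
  energy_pos mu nu +? - energy_neg mu nu.

Definition signed_energy (mu nu : meas X R * meas X R) :=
  energy_pos mu nu - energy_neg mu nu.

Definition energy_principle := forall mu : meas X R * meas X R,
  signed_radon mu -> energy_defined mu mu ->
  0 <= signed_energy mu mu /\
  (signed_energy mu mu = 0 ->
     meas_eq mu.1 zero_meas /\ meas_eq mu.2 zero_meas).

Definition finite_energy : set (meas X R * meas X R) := [set mu |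
  [/\ signed_radon mu, energy_defined mu mu &
      signed_energy mu mu \is a fin_num]].

Definition Eplus : set (meas X R) := [set mu | radon mu /\ energy mu < +oo].

Definition Eplus_on E : set (meas X R) := [set mu | Eplus mu /\ concentrated E mu].

(* The norm of mu - nu for the inner product signed_energy, expanded by
   bilinearity; all terms are finite when mu and nu have finite energy. *)
Definition strong_dist (mu nu : meas X R * meas X R) : R :=
  Num.sqrt (fine (signed_energy mu mu - 2%:E * signed_energy mu nu
                  + signed_energy nu nu)).

Definition strong_cvg {T : Type} (F : set_system T)
    (u : T -> meas X R * meas X R) (mu : meas X R * meas X R) :=
  strong_dist (u i) mu @[i --> F] --> (0 : R)%R.

Definition strong_cauchy (u : nat -> meas X R * meas X R) :=
  forall e : R, (0 < e)%R -> exists N, forall m n, (N <= m)%N -> (N <= n)%N ->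
    (strong_dist (u m) (u n) < e)%R.

Definition strongly_complete (F : set (meas X R)) :=
  forall u : nat -> meas X R, (forall n, F (u n)) ->
    strong_cauchy (pos_signed \o u) ->
    exists2 mu, F mu & strong_cvg \oo (pos_signed \o u) (pos_signed mu).

(* Closedness in the metrizable space of all signed measures of finite energy. *)
Definition strongly_closed (F : set (meas X R)) :=
  forall (u : nat -> meas X R) (mu : meas X R * meas X R),
    (forall n, F (u n)) -> finite_energy mu ->
    strong_cvg \oo (pos_signed \o u) mu ->
    F mu.1 /\ meas_eq mu.2 zero_meas.

(* The comparison of the two topologies is expressed by convergent filters. *)
Definition strong_finer_than_vague :=
  forall (F : set_system (meas X R)) mu, Filter F -> F Eplus -> Eplus mu ->
    strong_cvg F pos_signed (pos_signed mu) -> vague_cvg F id mu.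

Definition consistent := strongly_complete Eplus /\ strong_finer_than_vague.

Definition domination_principle := forall mu nu, Eplus mu -> radon nu ->
  {ae mu, forall x, potential mu x <= potential nu x} ->
  forall x, potential mu x <= potential nu x.

Definition ugaheri_principle := exists2 M : R, (1 <= M)%R &
  forall mu (c : R), Eplus mu -> (0 < c)%R ->
    {ae mu, forall x, potential mu x <= c%:E} ->
    forall x, potential mu x <= (M * c)%:E.

(* Used for compact K only; here (+oo)^-1 = 0 and 0^-1 = +oo. *)
Definition capacity K : \bar R :=
  (ereal_inf [set energy mu | mu in
     [set mu | Eplus_on K mu /\ mu setT = 1]])^-1.

Definition inner_capacity E : \bar R :=
  ereal_sup [set capacity K | K in [set K | compact K /\ K `<=` E]].

Definition outer_capacity E : \bar R :=
  ereal_inf [set inner_capacity D | D in [set D | open D /\ E `<=` D]].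

Definition nearly_everywhere E (P : X -> Prop) :=
  inner_capacity [set x | E x /\ ~ P x] = 0.

Definition quasi_everywhere E (P : X -> Prop) :=
  outer_capacity [set x | E x /\ ~ P x] = 0.

Definition compacts_in A : set (set X) := [set K |
  [/\ compact K, K `<=` A & 0 < capacity K]].

(* The filter of tails of the directed set [compacts_in A]. *)
Definition exhaust A : set_system (set X) :=
  filter_from (compacts_in A) (fun K0 => [set K | compacts_in A K /\ K0 `<=` K]).

(* On [subspace K], continuity notions are relative to K at the points of K and
   void elsewhere. *)
Definition admissible A omega :=
  Eplus omega \/
  [/\ omega setT < +oo,
      forall K, compact K -> K `<=` A ->
        lower_semicontinuous (fun x : subspace K => - potential omega x) &
      exists C : R, forall x, A x -> potential omega x <= C%:E].

Definition outer_balayage omega A : set (meas X R) := [set mu |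
  Eplus_on A mu /\
  quasi_everywhere A (fun x => potential mu x = potential omega x)].

Definition inner_balayage omega A : set (meas X R) := [set mu |
  Eplus_on A mu /\
  nearly_everywhere A (fun x => potential mu x = potential omega x)].

Definition Eplus_f omega A : set (meas X R) := [set mu |
  Eplus_on A mu /\ mu.-integrable setT (fun x => - potential omega x)].

Definition gauss omega mu : \bar R :=
  energy mu - 2%:E * \int[mu]_x potential omega x.

Definition gauss_inf omega A : \bar R :=
  ereal_inf [set gauss omega mu | mu in Eplus_f omega A].

Definition Gamma omega A : set (meas X R) := [set nu |
  radon nu /\
  quasi_everywhere A (fun x => potential omega x <= potential nu x)].

End potential_theory.

(* Main.v *)
Require Import Defs.
From HB Require Import structures.
From mathcomp Require Import all_boot all_order all_algebra.
From mathcomp Require Import all_classical all_reals all_analysis.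
From mathcomp Require Import measurable_realfun ring lra finmap.
Import Order.TTheory GRing.Theory Num.Theory.
Import numFieldNormedType.Exports.

(** The energy principle makes the measures of finite energy a pre-Hilbert space,
    and the balayage of omega onto A is the orthogonal projection of omega onto
    the convex cone of the measures of finite energy carried by A (if omega has
    infinite energy, only the linear form I(omega, .) is projected). The notion
    [swept kappa omega A mu] is the working form of this projection: mu is
    carried by A, its potential lies below that of omega on X, and both
    potentials have the same integral with respect to every measure of finite
    energy carried by A. Two swept measures are at distance zero, so uniqueness
    in every part of the theorem reduces to being swept, or to the same
    computation of a distance.

    Existence is proved first for a compact set K. The Gauss functional
    I(mu) - 2 I(omega, mu) is bounded below on measures carried by K, by
    Cauchy-Schwarz or, if the potential of omega is bounded on K, because
    consistency bounds mu(K) by a multiple of the norm of mu; the parallelogram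
    law makes its minimizing sequences Cauchy ([gauss_minimizer]). The first variation says that the potential of the
    minimizer is at least that of omega in mean, with equality against the
    minimizer itself; the domination principle then gives the reverse
    inequality on all of X ([compact_swept]). For general A, the energies of
    the measures swept onto compact subsets of A are bounded, by the energy of
    omega or by Ugaheri's principle, and the squared distance of two nested
    ones is the difference of their energies. Hence they converge strongly, and
    strong closedness puts the limit on A ([swept_exists]).

    The passage from nearly everywhere to quasi-everywhere rests on the fact
    that a Borel set N of inner capacity zero has outer capacity zero
    ([inner_null_outer_null]). For sigma of finite energy, the energy of sigma
    swept onto K is a strongly subadditive function of the compact set K which
    is continuous from above, so its outer extension satisfies Choquet's
    conditions, and Borel sets are capacitable ([capacitability]). Since every
    compact subset of N receives the zero measure, N lies in open sets of
    arbitrarily small swept energy. The kernel is positive on the diagonal, so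
    every point at which finite energy measures live has a neighbourhood on
    which some potential of finite energy is bounded below, and there a small
    swept energy forces a bound mu(D) <= e |mu| for all mu of finite energy.
    Such bounds add up over a countable base and dominate the capacity.

    Once the balayage w is known, the Gauss functional at mu is
    |mu - w|^2 - |w|^2, minimality of the potential is the domination principle,
    minimality of the energy follows by integrating potentials twice, and the
    limit relations along compact sets follow from the strong convergence, from
    the uniqueness of vague limits of Radon measures and from the lower
    semicontinuity of the kernel. *)

Set Implicit Arguments.
Unset Strict Implicit.
Unset Printing Implicit Defensive.

Local Open Scope classical_set_scope.
Local Open Scope ring_scope.
Local Open Scope ereal_scope.

(** * Locally compact spaces with a countable base *)

Section locally_compact_topology.
Context {X : ptopologicalType}.
Context (hausX : hausdorff_space X) (lcX : locally_compact [set: X]).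
Implicit Types (K D L : set X) (x : X).

Lemma point_compact_nbhd x D : open D -> D x ->
  exists L, [/\ compact L, nbhs x L & L `<=` D].
Proof.
move=> oD Dx.
have [C] := lcX (I : [set: X] x); rewrite withinET => Cx [cC clC].
have [B Bx BD] := compact_regular hausX cC Cx (open_nbhs_nbhs (conj oD Dx)).
exists (closure (B `&` C)); split.
- apply: (subclosed_compact (@closed_closure _ _) cC).
  by apply: subset_trans (closureS (@subIsetr _ B C)) _; rewrite -(closure_id C).1.
- by apply: filterS (@subset_closure _ _) _; apply: filterI.
- by apply: subset_trans BD; apply: closureS; apply: subIsetl.
Qed.

Lemma compact_nbhd K D : compact K -> open D -> K `<=` D ->
  exists L, [/\ compact L, K `<=` L° & L `<=` D].
Proof.
move=> cK oD KD.
have /choice[L PL] : forall x, exists L, D x -> [/\ compact L, nbhs x L & L `<=` D].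
  by move=> x; have [Dx|nDx] := pselect (D x);
     [have [L ?] := point_compact_nbhd oD Dx; exists L|exists set0].
have : cover_compact K by rewrite -compact_cover.
move=> /(_ X K (fun x => (L x)°)).
case.
- by move=> i Ki; exact: open_interior.
- move=> x Kx; exists x => //; have [_ + _] := PL x (KD _ Kx).
  by [].
move=> F FK cov; exists (\bigcup_(i in [set` F]) L i); split.
- have -> : \bigcup_(i in [set` F]) L i = \big[setU/set0]_(i <- F) L i.
    by rewrite bigcup_fset.
  rewrite big_seq; apply: bigsetU_compact => i iF.
  by have [] := PL i (KD _ (set_mem (FK _ iF))).
- move=> x /cov[i iF] /= Lix; apply: filterS Lix => y Ly; by exists i.
- move=> x [i iF Lix]; have [_ _] := PL i (KD _ (set_mem (FK _ iF))).
  exact.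
Qed.

(** The part of [K] outside [D2] is a compact subset of [D1]; a compact
    neighbourhood of it inside [D1] cuts [K] into the two pieces. *)
Lemma compact_split K (D1 D2 : set X) :
  compact K -> open D1 -> open D2 -> K `<=` D1 `|` D2 ->
  exists K1 K2, [/\ compact K1, compact K2, K1 `<=` D1, K2 `<=` D2 & K = K1 `|` K2].
Proof.
move=> cK o1 o2 K12; have clK := compact_closed hausX cK.
have c1 : compact (K `\` D2).
  by rewrite setDE; apply: compact_closedI => //; apply: open_closedC.
have [L [cL KL LD]] : exists L, [/\ compact L, K `\` D2 `<=` L° & L `<=` D1].
  by apply: compact_nbhd => // x [Kx nD2]; have [//|] := K12 _ Kx.
exists (K `&` L), (K `\` L°); split.
- by apply: compact_closedI => //; apply: compact_closed.
- by rewrite setDE; apply: compact_closedI => //; apply: open_closedC; apply: open_interior.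
- by move=> x [_ /LD].
- move=> x [Kx nLx]; apply: contrapT => nD2; exact/nLx/KL.
- apply/seteqP; split=> [x Kx|x [[]|[]]//].
  have [Lx|nLx] := pselect (L x); [by left|right; split=> // /interior_subset//].
Qed.

(** Complete regularity provides one bump at each point of [K]. A finite sum of
    bumps is at least 1/2 on [K], and truncating its double at 1 makes it
    constant there. *)
Lemma compact_urysohn (R : realType) K D : compact K -> open D -> K `<=` D ->
  exists phi : X -> R, [/\ continuous phi,
    compact (closure [set x | phi x != 0%R]),
    forall x, (0 <= phi x <= 1)%R,
    forall x, K x -> phi x = 1%R &
    forall x, ~ D x -> phi x = 0%R].
Proof.
move=> cK oD KD; have [L [cL KL LD]] := compact_nbhd cK oD KD.
have sep x : exists f : X -> R, K x -> [/\ continuous f, (forall y, 0 <= f y <= 1)%R,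
    f x = 1%R & forall y, ~ L° y -> f y = 0%R].
  have [Kx|nKx] := pselect (K x); last by exists (cst 0%R).
  have := @locally_compact_completely_regular X R lcX hausX x (~` L°).
  case/(_ (open_closedC (@open_interior _ _)) (fun h => h (KL _ Kx)))/(@uniform_separatorP _ R).
  move=> f [cf rf f0 f1]; exists (fun y => 1 - f y)%R => _; split.
  - move=> y; apply: cvgB; [exact: cvg_cst|exact: cf].
  - move=> y; have : range f (f y) by exists y.
    by move=> /rf; rewrite /= in_itv /=; lra.
  - by rewrite (f0 (f x)) ?subr0//; exists x.
  - by move=> y nLy; rewrite (f1 (f y)) ?subrr//; exists y.
have /choice[f Pf] := sep.
have : cover_compact K by rewrite -compact_cover.
move=> /(_ X K (fun x => if `[<K x>] then f x @^-1` `](1/2)%R, +oo[%classic else setT)).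
case.
- move=> i Ki; case: asboolP => // _; have [cf _ _ _] := Pf i Ki.
  by apply: open_comp; [move=> x _; apply: cf|apply: interval_open].
- move=> x Kx; exists x => //; case: asboolP => // _; have [_ _ fx _] := Pf x Kx.
  by rewrite /= fx in_itv /= andbT; lra.
move=> F FK cov.
pose S y := (\sum_(i <- F) f i y)%R.
have iF i : i \in F -> K i by move=> /FK /set_mem.
have cS : continuous S.
  have : forall i, i \in (F : seq X) -> continuous (f i) by move=> i /iF/(Pf i)[].
  rewrite /S; elim: (F : seq X) => [|i s IH] cs.
    by under eq_fun do rewrite big_nil; exact: cst_continuous.
  under eq_fun do rewrite big_cons.
  move=> y; apply: (@continuousD _ _ _ (f i)); first by apply: cs; rewrite mem_head.
  by apply: IH => j js; apply: cs; rewrite in_cons js orbT.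
have S0 y : (0 <= S y)%R.
  by rewrite /S big_seq; apply: sumr_ge0 => i /iF /(Pf i)[_ /(_ y)/andP[]].
have SK y : K y -> (1/2 <= S y)%R.
  move=> /cov[i iFi]; have Ki := iF _ iFi; case: asboolP => // _.
  rewrite /= in_itv /= andbT => fiy.
  rewrite /S (big_rem i) //=; apply: le_trans (ltW fiy) _.
  rewrite lerDl big_seq; apply: sumr_ge0 => j jF.
  by have /(Pf j)[_ /(_ y)/andP[]] := iF _ (mem_rem jF).
have SL y : ~ L° y -> S y = 0%R.
  by move=> nLy; rewrite /S big_seq big1// => i /iF /(Pf i)[_ _ _]; apply.
exists (fun y => Num.min 1 (2 * S y))%R; split.
- move=> y; apply: (@continuous_min _ _ (cst 1%R) (fun y => 2 * S y)%R).
    exact: cvg_cst.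
  by apply: cvgM; [exact: cvg_cst|exact: cS].
- have clL := compact_closed hausX cL.
  apply: (subclosed_compact (@closed_closure _ _) cL).
  rewrite [X in _ `<=` X](closure_id L).1//; apply: closureS => y /= h.
  apply: contrapT => nLy; move/eqP: h; apply; rewrite SL ?mulr0 ?minEle.
    by rewrite ifF//; apply/negbTE; rewrite -ltNge; lra.
  by move=> /interior_subset.
- by move=> y; rewrite ge_min lexx le_min ler01 /= mulr_ge0.
- move=> y /SK h; rewrite minEle ifT//; lra.
- move=> y nD; rewrite SL ?mulr0 ?minEle.
    by rewrite ifF//; apply/negbTE; rewrite -ltNge; lra.
  by move=> /interior_subset /LD.
Qed.

Context (scX : @second_countable X).

Lemma second_countable_seq : exists b : nat -> set X,
  (forall n, open (b n)) /\
  forall x D, nbhs x D -> exists n, b n x /\ b n `<=` D.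
Proof.
case: scX => B cB [Bo Bn].
move/pfcard_geP: cB => [B0|[b]].
  have [U [BU _] _] := Bn point setT filterT.
  by exfalso; move: BU; rewrite B0.
exists b; split=> [n|x D /(Bn x)[U [BU Ux] UD]].
  by apply: Bo; apply: (@funS _ _ _ _ b).
by have [n _ bn] := @surj _ _ _ _ b _ BU; exists n; rewrite bn.
Qed.

(** The basic open sets whose closure is compact and lies in [D] cover [D];
    finite unions of these closures increase. *)
Lemma open_sigma_compact D : open D ->
  exists F : nat -> set X, [/\ forall n, compact (F n),
    forall m n, (m <= n)%N -> F m `<=` F n & \bigcup_n F n = D].
Proof.
move=> oD; have [b [bo bn]] := second_countable_seq.
pose G n := if `[< compact (closure (b n)) /\ closure (b n) `<=` D >]
            then closure (b n) else set0.
have GK n : compact (G n).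
  by rewrite /G; case: asboolP => [[]//|_]; exact: compact0.
exists (fun n => \big[setU/set0]_(i < n.+1) G i); split=> [n|m n mn|].
- exact: bigsetU_compact.
- exact: (@subset_bigsetU _ G).
apply/seteqP; split=> [x [n _]|x Dx].
  rewrite -bigcup_mkord => -[i _]; rewrite /G; case: asboolP => //.
  by move=> [_ +]; exact.
have [L [cL Lx LD]] := point_compact_nbhd oD Dx.
have [n [bx bL]] := bn _ _ Lx.
have clL := compact_closed hausX cL.
have bL' : closure (b n) `<=` L by rewrite (closure_id L).1//; exact: closureS.
exists n => //; rewrite -bigcup_mkord; exists n => //=; rewrite /G; case: asboolP.
  by move=> _; apply: subset_closure.
case; split; last exact: subset_trans LD.
exact: (subclosed_compact (@closed_closure _ _) cL).
Qed.

End locally_compact_topology.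

(** * Analytic sets and capacitability *)

Section capacitability.
Context {R : realType} {X : ptopologicalType}.
Context (hausX : hausdorff_space X) (lcX : locally_compact [set: X]).
Context (scX : @second_countable X).
Implicit Types (E K D : set X) (f g h : nat -> nat).

(** A Suslin scheme: [F n f] is the closed set attached to the first [n] terms
    of [f], which is what the second condition says. *)
Definition suslin (F : nat -> (nat -> nat) -> set X) :=
  (forall n f, closed (F n f)) /\
  (forall n f g, (forall i, (i < n)%N -> f i = g i) -> F n f = F n g).

Definition analytic E := exists2 F, suslin F &
  E = [set x | exists f, forall n, F n f x].

Lemma closed_analytic E : closed E -> analytic E.
Proof.
move=> cE; exists (fun _ _ => E) => //.
by apply/seteqP; split=> [x Ex|x [f /(_ 0%N)]//]; exists id.
Qed.

Lemma analytic_bigcup (E : nat -> set X) :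
  (forall k, analytic (E k)) -> analytic (\bigcup_k E k).
Proof.
move=> /(_ _)/exists2P/cid-/all_sig[F PF].
exists (fun n f => if n is m.+1 then F (f 0%N) m (fun i => f i.+1) else setT).
  split=> [[|n] f|[|n] f g fg]//=.
    by have [[+ _] _] := PF (f 0%N); apply.
  rewrite (fg 0%N)//; have [[_ h] _] := PF (g 0%N).
  by apply: h => i ni; rewrite fg.
apply/seteqP; split=> [x [k _]|x [f fx]].
  have [_ ->] := PF k; move=> [f fx].
  by exists (fun n => if n is m.+1 then f m else k) => -[|n] //=; apply: fx.
exists (f 0%N) => //; have [_ ->] := PF (f 0%N).
by exists (fun i => f i.+1) => n; exact: fx n.+1.
Qed.

(** A pairing function interleaves the sequences of all the schemes into one
    sequence; the [n]-th set of the new scheme imposes the constraints that are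
    determined by [n] terms of it. *)
Lemma analytic_bigcap (E : nat -> set X) :
  (forall k, analytic (E k)) -> analytic (\bigcap_k E k).
Proof.
move=> /(_ _)/exists2P/cid-/all_sig[F PF].
pose p (k i : nat) := choice.pickle (k, i).
exists (fun n f => [set x | forall k j, (forall i, (i < j)%N -> (p k i < n)%N) ->
                       F k j (fun i => f (p k i)) x]).
  split=> [n f|n f g fg].
    have -> : [set x | forall k j, (forall i, (i < j)%N -> (p k i < n)%N) ->
        F k j (fun i => f (p k i)) x] =
      \bigcap_(kj in [set kj : nat * nat |
         forall i, (i < kj.2)%N -> (p kj.1 i < n)%N])
         F kj.1 kj.2 (fun i => f (p kj.1 i)).
      apply/seteqP; split=> [x h [k j] kj|x h k j kj]; first exact: h.
      exact: (h (k, j)).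
    by apply: closed_bigI => -[k j] _; have [[+ _] _] := PF k; apply.
  have e k j : (forall i, (i < j)%N -> (p k i < n)%N) ->
      F k j (fun i => f (p k i)) = F k j (fun i => g (p k i)).
    by move=> kj; have [[_ h] _] := PF k; apply: h => i ij; rewrite fg//; exact: kj.
  by apply/seteqP; split=> x h k j kj; [rewrite -e//|rewrite e//]; exact: h.
apply/seteqP; split=> [x h|x [f fx] k _].
  have /choice[f Pf] : forall k, exists f, forall n, F k n f x.
    by move=> k; have := h k Logic.I; have [_ ->] := PF k.
  exists (fun m => if choice.unpickle m is Some (k, i) then f k i else 0%N).
  move=> n k j kj /=.
  have [[_ +] _] := PF k; move=> /(_ j _ (f k)) ->; first exact: Pf.
  by move=> i ij; rewrite /p choice.pickleK.
have [_ ->] := PF k; exists (fun i => f (p k i)) => n.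
apply: (fx (\max_(i < n) (p k i).+1)%N) => i ni.
exact: (@leq_bigmax _ (fun i : 'I_n => (p k i).+1) (Ordinal ni)).
Qed.

(** The sets that are analytic together with their complement form a
    sigma-algebra. It contains the open sets, which are countable unions of
    compact sets. *)
Lemma measurable_analytic (E : set (borel X)) : measurable E -> analytic E.
Proof.
pose S := [set E : set X | analytic E /\ analytic (~` E)].
suff : @measurable _ (borel X) `<=` S by move=> h /h [].
apply: smallest_sub; [split => /=|].
- split; first by apply: closed_analytic; exact: closed0.
  by rewrite setC0; apply: closed_analytic; exact: closedT.
- by move=> A [A1 A2]; rewrite /S /= setTD setCK.
- move=> F PF; split; first by apply: analytic_bigcup => k; have [] := PF k.
  by rewrite setC_bigcup; apply: analytic_bigcap => k; have [] := PF k.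
move=> D oD; split; last by apply: closed_analytic; exact: open_closedC.
have [F [cF _ <-]] := open_sigma_compact hausX lcX scX oD.
by apply: analytic_bigcup => k; apply: closed_analytic; exact: compact_closed.
Qed.

Lemma ultra_bounded (T : Type) (U : set_system T) (UF : UltraFilter U)
    (v : T -> nat) (b : nat) :
  U [set t | (v t <= b)%N] -> exists a, (a <= b)%N /\ U [set t | v t = a].
Proof.
elim: b => [|b IH] Ub.
  by exists 0%N; split=> //; apply: filterS Ub => t /=; rewrite leqn0 => /eqP.
have [vb|vb] := in_ultra_setVsetC [set t | v t = b.+1] UF; first by exists b.+1.
have [|a [ab Ua]] := IH; last by exists a; split=> //; exact: leqW.
apply: filterS2 Ub vb => t /=; rewrite leq_eqVlt => /orP[/eqP->//|]; exact.
Qed.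

Lemma ultra_fmap (T T' : Type) (U : set_system T) (x : T -> T') :
  UltraFilter U -> UltraFilter (x @ U).
Proof.
move=> UF; split=> [|G GF sG]; first exact: fmap_proper_filter.
apply/seteqP; split=> [A GA|]; last exact: sG.
have [//|UA] := in_ultra_setVsetC (x @^-1` A) UF.
have /(filterI GA) : G (~` A) by apply: sG.
by rewrite setICr => /filter_not_empty.
Qed.

(** Compactness of the box of all [g <= h]: along an ultrafilter every
    coordinate of [f t] is constant, and the closed sets of the scheme pass to
    the limit point. *)
Lemma suslin_limit F h (T : Type) (U : set_system T) (UF : UltraFilter U)
    (x : T -> X) (f : T -> nat -> nat) x0 : suslin F ->
  U [set t | forall i, (f t i <= h i)%N] -> x t @[t --> U] --> x0 ->
  (forall n, U [set t | F n (f t) (x t)]) ->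
  exists g, (forall i, (g i <= h i)%N) /\ forall n, F n g x0.
Proof.
move=> [cF mF] Uh xx0 UFx.
have /choice[g Pg] : forall i, exists a, (a <= h i)%N /\ U [set t | f t i = a].
  by move=> i; apply: (ultra_bounded UF); apply: filterS Uh => t; exact.
exists g; split=> [i|n]; first by have [] := Pg i.
apply: (closed_cvg (F n g)) xx0 => //.
have Ug : U [set t | forall i, (i < n)%N -> f t i = g i].
  elim: n => [|n IH]; first by apply: filterS filterT.
  have [_ Un] := Pg n; apply: filterS2 IH Un => t /= h1 h2 i.
  by rewrite ltnS leq_eqVlt => /orP[/eqP->//|]; exact: h1.
by apply: filterS2 Ug (UFx n) => t /= fg; rewrite (mF n _ _ fg).
Qed.

(** Choquet's theorem. As [C] goes up along increasing unions, the coordinates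
    of the sequences [f] can be bounded one after the other by numbers [h i]
    without losing [t < C]. The points of [E] reached under all these bounds
    form a compact set [K]. An open [D] that contains [K] contains the set
    [Km m] of the points on which only the first [m] constraints of the scheme
    are imposed, for some [m]: otherwise points of [Km m] outside [D] would
    accumulate at a point of [K]. The bound [t < C D] follows, since the set
    obtained after [m] steps is part of [Km m]. *)
Lemma capacitability (C : set X -> \bar R) E t :
  (forall E1 E2, E1 `<=` E2 -> C E1 <= C E2) ->
  (forall F : nat -> set X, (forall m n, (m <= n)%N -> F m `<=` F n) ->
     t < C (\bigcup_n F n) -> exists n, t < C (F n)) ->
  measurable (E : set (borel X)) -> t < C E ->
  exists K, [/\ compact K, K `<=` E & forall D, open D -> K `<=` D -> t < C D].
Proof.
move=> Cmono Cup mE tE.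
have [H [cH incH HT]] := open_sigma_compact hausX lcX scX (@openT X).
have [N tEN] : exists N, t < C (E `&` H N).
  apply: Cup => [m n mn|]; first by apply: setIS; exact: incH.
  by rewrite -setI_bigcupr HT setIT.
have [F [cF mF] EF] := measurable_analytic mE.
pose EE (l : seq nat) := [set x | H N x /\
  exists f, (forall i, (i < size l)%N -> (f i <= nth 0%N l i)%N) /\ forall n, F n f x].
have /choice[step Pstep] : forall l, exists a, t < C (EE l) -> t < C (EE (rcons l a)).
  move=> l; have [tl|] := pselect (t < C (EE l)); last by exists 0%N.
  have [||a Pa] := Cup (fun a => EE (rcons l a)); last by exists a.
  - move=> m n mn x [Hx [f [fl fx]]]; split=> //; exists f; split=> // i il.
    apply: leq_trans (fl i _) _; first by move: il; rewrite !size_rcons.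
    by rewrite !nth_rcons; case: ltnP => //; case: eqP.
  - apply: lt_le_trans tl _; apply: Cmono => x [Hx [f [fl fx]]].
    exists (f (size l)) => //; split=> //; exists f; split=> // i.
    rewrite size_rcons ltnS leq_eqVlt nth_rcons => /orP[/eqP->|il].
      by rewrite ltnn eqxx.
    by rewrite il; exact: fl.
pose l m := iter m (fun s => rcons s (step s)) [::].
have sl m : size (l m) = m by elim: m => //= m IH; rewrite size_rcons IH.
have tl m : t < C (EE (l m)).
  elim: m => [|m IH]; last exact: Pstep.
  apply: lt_le_trans tEN _; apply: Cmono => x [+ Hx]; rewrite EF => -[f fx].
  by split=> //; exists f.
pose h i := step (l i).
have nthl m i : (i < m)%N -> nth 0%N (l m) i = h i.
  elim: m => // m IH; rewrite ltnS leq_eqVlt /= nth_rcons sl => /orP[/eqP->|im].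
    by rewrite ltnn eqxx.
  by rewrite im IH.
pose K := [set x | H N x /\ exists f, (forall i, (f i <= h i)%N) /\ forall n, F n f x].
exists K; split.
- rewrite compact_ultra => U UF UK.
  have /choice[f Pf] : forall x, exists f, K x ->
      (forall i, (f i <= h i)%N) /\ forall n, F n f x.
    by move=> x; have [[_ [f fx]]|?] := pselect (K x); [exists f|exists id].
  have := cH N; rewrite compact_ultra => /(_ U UF).
  have UH : U (H N) by apply: filterS UK => x [].
  move=> /(_ UH)[x0 [Hx0 Ux0]]; exists x0; split=> //; split=> //.
  apply: (@suslin_limit F h X U UF id f x0) => //.
    by apply: filterS UK => x /Pf[].
  by move=> n; apply: filterS UK => x /Pf[_ /(_ n)].
- by move=> x [_ [f [_ fx]]]; rewrite EF; exists f.
move=> D oD KD.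
pose Km m := [set x | H N x /\ exists f, (forall i, (f i <= h i)%N) /\
  forall n, (n <= m)%N -> F n f x].
suff [m KmD] : exists m, Km m `<=` D.
  apply: lt_le_trans (tl m) _; apply: Cmono; apply: subset_trans KmD.
  move=> x [Hx [f [fl fx]]]; split=> //.
  (* The sets of index at most [m] do not see the terms of rank at least [m],
     which are reset to 0 to comply with the bound [h]. *)
  exists (fun i => if (i < m)%N then f i else 0%N); split=> [i|n nm].
    by case: ltnP => // im; rewrite -(nthl _ _ im); apply: fl; rewrite sl.
  rewrite (mF n _ f) => // i ni; rewrite ifT//; exact: leq_trans nm.
apply: contrapT => /forallNP nKm.
have /choice[x Px] : forall m, exists x, Km m x /\ ~ D x.
  by move=> m; have /existsNP[x /not_implyP] := nKm m; exists x.
have /choice[f Pf] : forall m, exists f, (forall i, (f i <= h i)%N) /\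
  forall n, (n <= m)%N -> F n f (x m).
  by move=> m; have [[_]] := Px m.
have [U [UF oU]] := ultraFilterLemma (eventually_filter).
have UH : (x @ U) (H N) by apply: (@filterS _ U _ setT) filterT => m _; have [[]] := Px m.
have := cH N; rewrite compact_ultra => /(_ (x @ U) (ultra_fmap x UF) UH)[x0 [Hx0 xx0]].
have [||] := @suslin_limit F h nat U UF x f x0 (conj cF mF) _ xx0.
- by apply: (@filterS _ U _ setT) filterT => m _; have [] := Pf m.
- move=> n; apply: oU; exists n => // m /= nm; have [_] := Pf m; exact.
move=> g gx; have /KD Dx0 : K x0 by split=> //; exists g.
have : (~` D) x0; last by [].
apply: (closed_cvg (~` D)) xx0; first exact: open_closedC.
by apply: (@filterS _ U _ setT) filterT => m _; have [] := Px m.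
Qed.

End capacitability.

(** * Radon measures *)

Section measure_operations.
Context {R : realType} {X : ptopologicalType}.
Implicit Types (mu nu : meas X R) (D B : set (borel X)).

Definition addm mu nu : meas X R := measure_add mu nu.

Definition scalem (r : {nonneg R}) mu : meas X R := mscale r mu.

Definition restrm mu D (mD : measurable D) : meas X R := mrestr mu mD.

Definition diracm (x : X) : meas X R := \d_(x : borel X).

Lemma diracmE (x : X) B : diracm x B = (x \in B)%:R%:E.
Proof. exact: diracE. Qed.

Lemma addmE mu nu B : addm mu nu B = mu B + nu B.
Proof. exact: measure_addE. Qed.

Lemma scalemE r mu B : scalem r mu B = r%:num%:E * mu B.
Proof. by []. Qed.

Lemma restrmE mu D (mD : measurable D) B : restrm mu mD B = mu (B `&` D).
Proof. by []. Qed.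

Lemma integral_addm mu nu (f : borel X -> \bar R) : (forall x, 0 <= f x) ->
  measurable_fun [set: borel X] f ->
  \int[addm mu nu]_x f x = \int[mu]_x f x + \int[nu]_x f x.
Proof. by move=> f0 mf; exact: ge0_integral_measure_add. Qed.

Lemma integral_scalem r mu (f : borel X -> \bar R) : (forall x, 0 <= f x) ->
  measurable_fun [set: borel X] f ->
  \int[scalem r mu]_x f x = r%:num%:E * \int[mu]_x f x.
Proof. by move=> f0 mf; exact: ge0_integral_mscale. Qed.

Lemma integral_meas_eq mu nu (f : borel X -> \bar R) : meas_eq mu nu ->
  \int[mu]_x f x = \int[nu]_x f x.
Proof. by move=> e; apply: eq_measure_integral => A mA _; exact: e. Qed.

Lemma le_meas_integral mu nu (f : borel X -> \bar R) : (forall x, 0 <= f x) ->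
  measurable_fun [set: borel X] f ->
  (forall B, measurable B -> mu B <= nu B) ->
  \int[mu]_x f x <= \int[nu]_x f x.
Proof. by move=> f0 mf le; apply: (@ge0_le_measure_integral). Qed.

End measure_operations.

Section radon_measures.
Context {R : realType} {X : ptopologicalType}.
Context (hausX : hausdorff_space X) (lcX : locally_compact [set: X]).
Context (scX : @second_countable X).
Implicit Types (mu nu rho : meas X R) (B K D : set (borel X)).

Lemma open_borel (D : set X) : open D -> measurable (D : set (borel X)).
Proof. by move=> oD; exact: sub_sigma_algebra. Qed.

Lemma closed_borel (D : set X) : closed D -> measurable (D : set (borel X)).
Proof.
move=> cD; rewrite -[D]setCK; apply: measurableC; apply: open_borel.
exact: closed_openC.
Qed.

Lemma compact_borel (K : set X) : compact K -> measurable (K : set (borel X)).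
Proof. by move=> /(compact_closed hausX); exact: closed_borel. Qed.

Lemma measureS mu B1 B2 : measurable B1 -> measurable B2 -> B1 `<=` B2 -> mu B1 <= mu B2.
Proof. by move=> m1 m2; apply: le_measure; apply: mem_set. Qed.

Lemma measure_bigcup_gt mu (F : nat -> set (borel X)) t :
  (forall n, measurable (F n)) -> (forall m n, (m <= n)%N -> F m `<=` F n) ->
  t < mu (\bigcup_n F n) -> exists n, t < mu (F n).
Proof.
move=> mF incF; apply: contraPP => /forallNP nF; apply/negP; rewrite -leNgt.
have ndF : nondecreasing_seq F.
  by move=> m n mn; apply/subsetPset; exact: incF.
have h := @nondecreasing_cvg_mu _ _ _ mu F mF (bigcup_measurable (fun n _ => mF n)) ndF.
rewrite -(cvg_lim _ h)//; apply: lime_le; first by apply/cvg_ex; exists (mu (\bigcup_n F n)).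
by apply: nearW => n /=; rewrite leNgt; apply/negP.
Qed.

Lemma radonP mu : radon mu <->
  (forall K, compact (K : set X) -> mu K < +oo) /\
  forall B t, measurable B -> t < mu B ->
    exists K, [/\ compact (K : set X), K `<=` B & t < mu K].
Proof.
split=> -[fK h]; split=> // B.
  move=> t mB; rewrite h// => /ereal_sup_gt[_ [K [cK KB] <-] tK].
  by exists K.
move=> mB; apply/eqP; rewrite eq_le; apply/andP; split; last first.
  apply: ge_ereal_sup => _ [K [cK KB] <-].
  by apply: measureS => //; exact: compact_borel.
rewrite leNgt; apply/negP => /(h _ _ mB)[K [cK KB]].
by apply/negP; rewrite -leNgt; apply: ereal_sup_ubound; exists K.
Qed.

Lemma radon_fin_num mu K : radon mu -> compact (K : set X) -> mu K \is a fin_num.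
Proof. by move=> /radonP[h _] /h ?; rewrite ge0_fin_numE. Qed.

Lemma radon_meas_eq mu nu : meas_eq mu nu -> radon mu -> radon nu.
Proof.
move=> e /radonP[fK h]; apply/radonP; split=> [K cK|B t mB].
  by rewrite -e; [exact: fK|exact: compact_borel].
rewrite -e// => /(h _ _ mB)[K [cK KB tK]]; exists K; split=> //.
by rewrite -e//; exact: compact_borel.
Qed.

Lemma compact_exhaustion : exists H : nat -> set X, [/\ forall n, compact (H n),
    forall m n, (m <= n)%N -> H m `<=` H n & \bigcup_n H n = setT].
Proof. exact: (open_sigma_compact hausX lcX scX openT). Qed.

(** Inner regularity passes to a smaller measure on sets of finite measure: if
    [mu] of the remainder of [B] outside [K] is small, so is [rho] of it. An
    exhaustion by compact sets reduces to that case. *)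
Lemma radon_le mu rho : radon mu ->
  (forall B, measurable B -> rho B <= mu B) -> radon rho.
Proof.
move=> rmu le; have [fK h] := (radonP mu).1 rmu.
apply/radonP; split=> [K cK|B t mB].
  by apply: le_lt_trans (le _ _) (fK _ cK); exact: compact_borel.
have [H [cH incH HT]] := compact_exhaustion.
rewrite -{1}(setIT B) -HT setI_bigcupr => /measure_bigcup_gt[n|m n mn|n tn].
- by apply: measurableI => //; exact: compact_borel.
- by apply: setIS; exact: incH.
have mC : measurable (B `&` H n) by apply: measurableI => //; exact: compact_borel.
have fC : mu (B `&` H n) < +oo.
  apply: le_lt_trans (fK _ (cH n)); apply: measureS => //; exact: compact_borel.
have fC' : rho (B `&` H n) \is a fin_num.
  by rewrite ge0_fin_numE//; exact: le_lt_trans (le _ mC) fC.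
have [t0|t0] := ltP t 0; first by exists set0; split=> //; [exact: compact0|rewrite measure0].
have ft : t \is a fin_num by rewrite ge0_fin_numE//; apply: lt_trans tn _; rewrite -ge0_fin_numE.
have e0 : 0 < rho (B `&` H n) - t by rewrite sube_gt0.
have [|K [cK KB muK]] := h _ (mu (B `&` H n) - (rho (B `&` H n) - t)) mC.
  by rewrite lteBlDr ?fin_numB ?fC' ?ft// lteDl// ge0_fin_numE.
have mK := compact_borel cK.
exists K; split=> //; first by move=> x /KB[].
have Cdec (m : meas X R) : m (B `&` H n) = m K + m ((B `&` H n) `\` K).
  by rewrite -measureU ?setDUK//; [exact: measurableD|exact: setDIK].
have mD : measurable ((B `&` H n) `\` K) by exact: measurableD.
have := le _ mD; have := muK; rewrite !Cdec.
have fs (m : meas X R) : m (B `&` H n) \is a fin_num ->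
    m K \is a fin_num /\ m ((B `&` H n) `\` K) \is a fin_num.
  by rewrite Cdec fin_numD => /andP[].
have [] := fs mu; first by rewrite ge0_fin_numE.
have [] := fs rho fC'.
move: (mu K) (mu (_ `\` _)) (rho K) (rho (_ `\` _)) t ft {tn e0 muK t0}.
move=> [a| |] [b| |] [c| |] [d| |] [s| |]//= _ _ _ _ _.
rewrite !lte_fin lee_fin; lra.
Qed.

Lemma radonD mu nu : radon mu -> radon nu -> radon (addm mu nu).
Proof.
move=> rmu rnu; have [fmu hmu] := (radonP mu).1 rmu; have [fnu hnu] := (radonP nu).1 rnu.
apply/radonP; split=> [K cK|B t mB].
  by rewrite addmE lte_add_pinfty// ?fmu ?fnu.
rewrite addmE => tB.
have le K1 K2 : compact (K1 : set X) -> compact (K2 : set X) ->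
    mu K1 + nu K2 <= addm mu nu (K1 `|` K2).
  move=> c1 c2; rewrite addmE; have m12 := compact_borel (compactU c1 c2).
  by apply: leeD; apply: measureS => //; exact: compact_borel.
suff [K1 [K2 [c1 c2 K1B K2B t12]]] : exists K1 K2 : set X,
    [/\ compact K1, compact K2, K1 `<=` B, K2 `<=` B & t < mu K1 + nu K2].
  exists (K1 `|` K2); split; [exact: compactU|by rewrite subUset|].
  exact: lt_le_trans t12 (le _ _ c1 c2).
have [t0|t0] := ltP t 0.
  exists set0, set0; split=> //; try exact: compact0.
  by rewrite !measure0 adde0.
have ft : t \is a fin_num by rewrite ge0_fin_numE//; apply: lt_le_trans tB (leey _).
have [muB|muB] := eqVneq (mu B) +oo.
  have [|K1 [c1 K1B tK1]] := hmu B t mB; first by rewrite muB; apply: lt_le_trans tB (leey _).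
  exists K1, set0; split=> //; first exact: compact0.
  by rewrite measure0 adde0.
have [nuB|nuB] := eqVneq (nu B) +oo.
  have [|K2 [c2 K2B tK2]] := hnu B t mB; first by rewrite nuB; apply: lt_le_trans tB (leey _).
  exists set0, K2; split=> //; first exact: compact0.
  by rewrite measure0 add0e.
have fm : mu B \is a fin_num by rewrite ge0_fin_numE// ltey.
have fn : nu B \is a fin_num by rewrite ge0_fin_numE// ltey.
pose e := ((fine (mu B) + fine (nu B) - fine t) / 2)%R.
have e0 : (0 < e)%R.
  rewrite /e; move: tB; rewrite -(fineK fm) -(fineK fn) -(fineK ft) -EFinD lte_fin/=; lra.
have [|K1 [c1 K1B tK1]] := hmu B (mu B - e%:E) mB.
  by rewrite lteBlDr// lteDl// ?lte_fin.
have [|K2 [c2 K2B tK2]] := hnu B (nu B - e%:E) mB.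
  by rewrite lteBlDr// lteDl// ?lte_fin.
exists K1, K2; split=> //.
have := lteD tK1 tK2; apply: le_lt_trans.
rewrite -(fineK fm) -(fineK fn) -(fineK ft) -!EFinB -EFinD lee_fin/= /e; lra.
Qed.

Lemma radonZ (r : {nonneg R}) mu : radon mu -> radon (scalem r mu).
Proof.
move=> rmu; have [fmu hmu] := (radonP mu).1 rmu.
apply/radonP; split=> [K cK|B t mB].
  by rewrite scalemE lte_mul_pinfty ?fmu.
rewrite scalemE => tB.
have [r0|r0] := eqVneq (r%:num)%R 0%R.
  exists set0; split=> //; first exact: compact0.
  by rewrite measure0; move: tB; rewrite r0 mul0e.
have {}r0 : (0 < r%:num)%R by rewrite lt_neqAle eq_sym r0/=.
have [|K [cK KB tK]] := hmu B ((r%:num^-1)%:E * t) mB.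
  by rewrite lte_pdivrMl.
by exists K; split=> //; rewrite scalemE -lte_pdivrMl.
Qed.

Lemma radon0 : radon (zero_meas : meas X R).
Proof.
apply/radonP; split=> [K _|B t mB tB]; first by rewrite /zero_meas/= /mzero ltry.
by exists set0; split=> //; exact: compact0.
Qed.

Lemma radon_dirac (x : X) : radon (diracm x : meas X R).
Proof.
apply/radonP; split=> [K _|B t mB]; first by rewrite diracmE ltry.
rewrite diracmE; case: (boolP (_ \in _)) => [xB tB|_ t0].
  exists [set (x : X)]; split; first exact: compact_set1.
    by move=> _ ->; exact: set_mem xB.
  by rewrite diracmE mem_set.
exists set0; split=> //; [exact: compact0|by rewrite diracmE in_set0].
Qed.

Lemma radon_sigma_finite mu : radon mu -> sigma_finite setT mu.
Proof.
move=> /radonP[fK _]; have [H [cH _ HT]] := compact_exhaustion.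
by exists H => // n; split; [exact: compact_borel|exact: fK].
Qed.

End radon_measures.

(** * Potentials and Tonelli's theorem *)

Section radon_tonelli.
Context {R : realType} {X : ptopologicalType}.
Context (hausX : hausdorff_space X) (lcX : locally_compact [set: X]).
Context (scX : @second_countable X).

(** A copy of [mu] that carries the proof of its being Radon, so that the
    sigma-finite structure on which the Tonelli theorems depend can be attached
    to it. *)
Definition sigma_finite_of (mu : meas X R) (rmu : radon mu) : set (borel X) -> \bar R := mu.

Section instances.
Context (mu : meas X R) (rmu : radon mu).
HB.instance Definition _ := Measure.on (sigma_finite_of rmu).
HB.instance Definition _ := @Measure_isSigmaFinite.Build _ _ _ (sigma_finite_of rmu)
  (radon_sigma_finite hausX lcX scX rmu).
End instances.

(** The superlevel sets are open, and second countability writes an open set of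
    the product as a countable union of open rectangles. *)
Lemma lsc_measurable_prod (f : X * X -> \bar R) : lower_semicontinuous f ->
  measurable_fun [set: borel X * borel X] f.
Proof.
move/lower_semicontinuousP => of_.
apply: (measurability (@ErealGenOInfty.G R)).
  exact: ErealGenOInfty.measurableE.
move=> _ [_ [x ->] <-]; rewrite setTI preimage_itvoy.
have [b [bo bn]] := second_countable_seq scX.
pose G i j := if `[< b i `*` b j `<=` [set z | x%:E < f z] >] then b i `*` b j else set0.
have -> : [set z | x%:E < f z] = \bigcup_i \bigcup_j G i j.
  apply/seteqP; split=> [[z1 z2] /= xz|z [i _ [j _]]]; last first.
    by rewrite /G; case: asboolP => // h; exact: h.
  have : nbhs (z1, z2) [set z | x%:E < f z] by apply: open_nbhs_nbhs; split; first exact: of_.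
  move=> [[P Q] [/bn[i [bi iP]] /bn[j [bj jQ]]] PQ].
  exists i => //; exists j => //; rewrite /G; case: asboolP => // -[]; move=> [w1 w2] [] /= /iP p /jQ q.
  exact: (PQ (w1, w2)).
apply: bigcup_measurable => i _; apply: bigcup_measurable => j _; rewrite /G.
by case: asboolP => // _; apply: measurableX; exact: open_borel.
Qed.

Context (kappa : X * X -> \bar R) (kerk : is_kernel kappa).
Implicit Types mu nu rho : meas X R.

Lemma kernel_ge0 z : 0 <= kappa z.
Proof. by case: kerk. Qed.

Lemma kernel_sym x y : kappa (x, y) = kappa (y, x).
Proof. by case: kerk. Qed.

Lemma kernel_measurable : measurable_fun [set: borel X * borel X] kappa.
Proof. by case: kerk => _ _; exact: lsc_measurable_prod. Qed.

Lemma kernel_section_measurable x : measurable_fun [set: borel X] (fun y : borel X => kappa (x, y)).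
Proof.
have h := @measurable_fun_pair2 _ _ _ (borel X) (borel X) _ kappa x. exact: (h kernel_measurable).
Qed.

Lemma potentialE mu x : potential kappa mu x = \int[mu]_y kappa (x, y).
Proof. by []. Qed.

Lemma potential_ge0 mu x : 0 <= potential kappa mu x.
Proof. by apply: integral_ge0 => y _; exact: kernel_ge0. Qed.

Lemma potential_measurable mu : radon mu ->
  measurable_fun [set: borel X] (potential kappa mu : borel X -> \bar R).
Proof.
move=> rmu.
exact: (@measurable_fun_fubini_tonelli_F _ _ _ _ _ (sigma_finite_of rmu) _
  kernel_measurable kernel_ge0).
Qed.

Lemma mutual_energyE mu nu : radon mu -> radon nu ->
  mutual_energy kappa mu nu = \int[mu]_x potential kappa nu x.
Proof.
move=> rmu rnu.
exact: (@fubini_tonelli1 _ _ _ _ _ (sigma_finite_of rmu) (sigma_finite_of rnu) _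
  kernel_measurable kernel_ge0).
Qed.

Lemma mutual_energyC mu nu : radon mu -> radon nu ->
  mutual_energy kappa mu nu = mutual_energy kappa nu mu.
Proof.
move=> rmu rnu; rewrite [RHS]mutual_energyE//.
rewrite /mutual_energy (@fubini_tonelli2 _ _ _ _ _ (sigma_finite_of rmu) (sigma_finite_of rnu) _
  kernel_measurable kernel_ge0).
by apply: eq_integral => y _; apply: eq_integral => x _; rewrite kernel_sym.
Qed.

Lemma mutual_energy_ge0 mu nu : radon mu -> radon nu ->
  0 <= mutual_energy kappa mu nu.
Proof.
move=> rmu rnu; rewrite mutual_energyE//; apply: integral_ge0 => x _.
exact: potential_ge0.
Qed.

End radon_tonelli.

(** * Jordan decomposition of a difference of sigma-finite measures *)

Section jordan.
Context d (T : measurableType d) (R : realType).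
Implicit Types (mu nu : {measure set T -> \bar R}) (B D P : set T).

Let measureS mu B1 B2 : measurable B1 -> measurable B2 -> B1 `<=` B2 -> mu B1 <= mu B2.
Proof. by move=> m1 m2; apply: le_measure; apply: mem_set. Qed.

(** On [D] both measures are finite, so that their difference is a charge and
    has a Hahn decomposition. Sums replace differences in the statement, which
    lets countably many such pieces be added up. *)
Lemma finite_jordan mu nu D : measurable D -> mu D < +oo -> nu D < +oo ->
  exists P (rp rn : {measure set T -> \bar R}), [/\ measurable P, P `<=` D,
    forall B, measurable B -> mu (B `&` D) + rn B = nu (B `&` D) + rp B &
    forall B, measurable B -> [/\ rp B <= mu (B `&` D), rn B <= nu (B `&` D),
      B `&` P = set0 -> rp B = 0 & B `<=` P -> rn B = 0]].
Proof.
move=> mD muD nuD.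
pose m := mfrestr mD muD; pose n := mfrestr mD nuD.
have mn B : m B = mu (B `&` D) by [].
have nn B : n B = nu (B `&` D) by [].
pose c := cadd (charge_of_finite_measure m) (copp (charge_of_finite_measure n)).
have [P [N PN]] := Hahn_decomposition c.
have [[mP posP] [mN negN] PUN PIN] := PN.
have fm B : measurable B -> m B \is a fin_num by move=> mB; rewrite fin_num_measure.
have fn B : measurable B -> n B \is a fin_num by move=> mB; rewrite fin_num_measure.
have [rp [rn [posE negE decE]]] : exists rp rn : {measure set T -> \bar R},
  [/\ forall B, measurable B -> rp B = m (B `&` P) - n (B `&` P),
      forall B, measurable B -> rn B = n (B `&` N) - m (B `&` N) &
      forall B, measurable B -> [/\ m B - n B = rp B - rn B,
        rp B \is a fin_num & rn B \is a fin_num]].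
  exists (jordan_pos PN), (jordan_neg PN); split=> B mB.
  - by rewrite [LHS]jordan_posE cjordan_posE /crestr0 mem_set.
  - rewrite [LHS]jordan_negE cjordan_negE /crestr0 mem_set//.
    rewrite -[crestr _ _ _]/(m (B `&` N) - n (B `&` N)).
    have := fn _ (measurableI _ _ mB mN); have := fm _ (measurableI _ _ mB mN).
    case: (m _) => [a| |]//; case: (n _) => [b| |]// _ _.
    by rewrite -!EFinB -EFinN opprB.
  - split; [|by rewrite fin_num_measure..].
    have cE x : cscale (-1) (jordan_neg PN) x = - jordan_neg PN x by exact: mulN1e.
    by have := jordan_decomp PN mB; rewrite /cadd /= cE.
have mI B : measurable B -> measurable (B `&` P) /\ measurable (B `&` N).
  by move=> mB; split; exact: measurableI.
exists (P `&` D), rp, rn; split.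
- exact: measurableI.
- exact: subIsetr.
- move=> B mB; rewrite -mn -nn; have [] := decE B mB.
  move: (fm _ mB) (fn _ mB); move: (rp B) (rn B) (m B) (n B).
  move=> [a| |] [b| |] [e| |] [f| |]//= _ _ [h] _ _.
  by congr (_%:E); move: h; lra.
move=> B mB; have [mBP mBN] := mI _ mB; rewrite posE// negE//; split.
- apply: (@le_trans _ _ (m (B `&` P))).
    by rewrite leeBlDr ?fn// leeDl.
  by rewrite mn; apply: measureS; [exact: measurableI|exact: measurableI|
    apply: setSI; exact: subIsetl].
- apply: (@le_trans _ _ (n (B `&` N))).
    by rewrite leeBlDr ?fm// leeDl.
  by rewrite nn; apply: measureS; [exact: measurableI|exact: measurableI|
    apply: setSI; exact: subIsetl].
- by move=> BP; rewrite mn nn -setIA BP !measure0 subee.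
- move=> BP; have -> : B `&` N = set0.
    apply/seteqP; split=> // x [/BP[Px _] Nx].
    by have : (P `&` N) x; [split|rewrite PIN].
  by rewrite mn nn set0I !measure0 subee.
Qed.

(** The decompositions over the pieces of a partition into sets of finite
    measure are glued together. *)
Lemma sigma_finite_jordan mu nu (H : nat -> set T) :
  (forall n, measurable (H n)) -> \bigcup_n H n = setT ->
  (forall n, mu (H n) < +oo /\ nu (H n) < +oo) ->
  exists P (rp rn : {measure set T -> \bar R}), [/\ measurable P,
    forall B, measurable B -> mu B + rn B = nu B + rp B,
    forall B, measurable B -> rp B <= mu B,
    forall B, measurable B -> rn B <= nu B &
    rp (~` P) = 0 /\ rn P = 0].
Proof.
move=> mH HT fH; pose D := seqDU H.
have mD n : measurable (D n) by apply: seqDU_measurable.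
have tD : trivIset setT D by exact: trivIset_seqDU.
have DT : \bigcup_n D n = setT by rewrite -seqDU_bigcup_eq.
have fD n : mu (D n) < +oo /\ nu (D n) < +oo.
  have [h1 h2] := fH n.
  split; [apply: le_lt_trans h1|apply: le_lt_trans h2];
    by apply: measureS => //; exact: subset_seqDU.
have /choice[J PJ] n : exists J : set T * {measure set T -> \bar R} * {measure set T -> \bar R},
  [/\ measurable J.1.1, J.1.1 `<=` D n,
    forall B, measurable B -> mu (B `&` D n) + J.2 B = nu (B `&` D n) + J.1.2 B &
    forall B, measurable B -> [/\ J.1.2 B <= mu (B `&` D n), J.2 B <= nu (B `&` D n),
      B `&` J.1.1 = set0 -> J.1.2 B = 0 & B `<=` J.1.1 -> J.2 B = 0]].
  have [P [rp [rn h]]] := finite_jordan (mD n) (fD n).1 (fD n).2.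
  by exists (P, rp, rn).
pose P := \bigcup_n (J n).1.1.
have mP : measurable P by apply: bigcup_measurable => n _; have [] := PJ n.
have [rp [rn [rpE rnE]]] : exists rp rn : {measure set T -> \bar R},
    (forall B, rp B = \sum_(0 <= k <oo) (J k).1.2 B) /\
    (forall B, rn B = \sum_(0 <= k <oo) (J k).2 B).
  by exists (mseries (fun n => (J n).1.2) 0), (mseries (fun n => (J n).2) 0).
have sumE (m : {measure set T -> \bar R}) B : measurable B ->
    m B = \sum_(0 <= k <oo) m (B `&` D k).
  move=> mB; rewrite -{1}(setIT B) -DT setI_bigcupr measure_bigcup//.
  - by apply: eq_eseriesl => k; rewrite in_setT.
  - by move=> k _; exact: measurableI.
  - exact: trivIset_setIl.
exists P, rp, rn; split=> //.
- move=> B mB; rewrite rpE rnE (sumE mu)// (sumE nu)//.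
  rewrite -!nneseriesD//; apply: eq_eseriesr => k _.
  by have [_ _ + _] := PJ k; apply.
- move=> B mB; rewrite rpE (sumE mu)//; apply: lee_nneseries => // k _.
  by have [_ _ _ /(_ B mB)[]] := PJ k.
- move=> B mB; rewrite rnE (sumE nu)//; apply: lee_nneseries => // k _.
  by have [_ _ _ /(_ B mB)[]] := PJ k.
split.
- rewrite rpE; apply: eseries0 => k _ _.
  have [_ _ _ /(_ (~` P) (measurableC mP))[_ _ + _]] := PJ k; apply.
  by apply/seteqP; split=> // x [nP Jx]; apply: nP; exists k.
rewrite rnE; apply: eseries0 => k _ _.
have [mJ JD _ h] := PJ k.
have PDk : P `&` D k = (J k).1.1.
  apply/seteqP; split=> [x [[i _ Jx] Dx]|x Jx]; last by split; [exists k|exact: JD].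
  suff <- : i = k by [].
  by apply: (tD i k) => //; exists x; split=> //; have [_ + _ _] := PJ i; apply.
have mPD : measurable (P `\` D k) by exact: measurableD.
have -> : P = (J k).1.1 `|` (P `\` D k) by rewrite -PDk setUIDK.
have z1 : (J k).2 (J k).1.1 = 0 by have [_ _ _] := h _ mJ; apply.
have z2 : (J k).2 (P `\` D k) = 0.
  have [_ + _ _] := h _ mPD; rewrite setDE -setIA setICl setI0 measure0 => le0.
  by apply/eqP; rewrite eq_le le0 measure_ge0.
transitivity ((J k).2 (J k).1.1 + (J k).2 (P `\` D k)); last by rewrite z1 z2 adde0.
by apply: measureU => //; rewrite -PDk setDE setIACA setICr setI0.
Qed.

End jordan.

(** * The geometry of measures of finite energy *)

Section energy_space.
Context {R : realType} {X : ptopologicalType}.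
Context (hausX : hausdorff_space X) (lcX : locally_compact [set: X]).
Context (scX : @second_countable X).
Context (kappa : X * X -> \bar R) (kerk : is_kernel kappa).
Implicit Types (mu nu rho : meas X R) (B D P : set (borel X)).

Local Notation U := (potential kappa).
Local Notation I2 := (mutual_energy kappa).
Local Notation Ep := (Eplus kappa).

Let U0 mu x : 0 <= U mu x. Proof. exact: potential_ge0. Qed.
Let mU mu : radon mu -> measurable_fun [set: borel X] (U mu : borel X -> \bar R).
Proof. by move=> rmu; exact: (potential_measurable hausX lcX scX kerk rmu). Qed.
Let I2E mu nu : radon mu -> radon nu -> I2 mu nu = \int[mu]_x U nu x.
Proof. exact: (mutual_energyE hausX lcX scX kerk). Qed.
Let I2C mu nu : radon mu -> radon nu -> I2 mu nu = I2 nu mu.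
Proof. exact: (mutual_energyC hausX lcX scX kerk). Qed.
Let I20 mu nu : radon mu -> radon nu -> 0 <= I2 mu nu.
Proof. exact: (mutual_energy_ge0 hausX lcX scX kerk). Qed.

Lemma potential_addm mu nu x : U (addm mu nu) x = U mu x + U nu x.
Proof.
apply: integral_addm => [y|]; first exact: kernel_ge0.
exact: (kernel_section_measurable scX kerk).
Qed.

Lemma potential_meas_eq mu nu : meas_eq mu nu -> U mu = U nu.
Proof. by move=> e; apply/funext => x; exact: integral_meas_eq. Qed.

Local Opaque potential mutual_energy.

Lemma mutual_energyDl mu nu rho : radon mu -> radon nu -> radon rho ->
  I2 (addm mu nu) rho = I2 mu rho + I2 nu rho.
Proof.
move=> rmu rnu rrho; rewrite !I2E//; last exact: radonD.
by apply: integral_addm; [exact: U0|exact: mU].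
Qed.

Lemma mutual_energyZl r mu rho : radon mu -> radon rho ->
  I2 (scalem r mu) rho = r%:num%:E * I2 mu rho.
Proof.
move=> rmu rrho; rewrite !I2E//; last exact: radonZ.
by apply: integral_scalem; [exact: U0|exact: mU].
Qed.

Lemma mutual_energyDr mu nu rho : radon mu -> radon nu -> radon rho ->
  I2 rho (addm mu nu) = I2 rho mu + I2 rho nu.
Proof.
move=> rmu rnu rrho; rewrite I2C//; last exact: radonD.
by rewrite mutual_energyDl// I2C// (I2C rnu).
Qed.

Lemma mutual_energyZr r mu rho : radon mu -> radon rho ->
  I2 rho (scalem r mu) = r%:num%:E * I2 rho mu.
Proof.
move=> rmu rrho; rewrite I2C//; last exact: radonZ.
by rewrite mutual_energyZl// I2C.
Qed.

Lemma mutual_energy_lel mu nu rho : radon mu -> radon nu -> radon rho ->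
  (forall B, measurable B -> mu B <= nu B) -> I2 mu rho <= I2 nu rho.
Proof.
move=> rmu rnu rrho le; rewrite !I2E//.
by apply: le_meas_integral => //; exact: mU.
Qed.

Lemma mutual_energy_le mu nu mu' nu' : radon mu -> radon nu -> radon mu' -> radon nu' ->
  (forall B, measurable B -> mu B <= mu' B) ->
  (forall B, measurable B -> nu B <= nu' B) -> I2 mu nu <= I2 mu' nu'.
Proof.
move=> rmu rnu rmu' rnu' le le'.
apply: (@le_trans _ _ (I2 mu' nu)); first exact: mutual_energy_lel.
by rewrite I2C// (I2C rmu')//; exact: mutual_energy_lel.
Qed.

Lemma mutual_energy0 mu : radon mu -> I2 mu zero_meas = 0.
Proof.
move=> rmu; rewrite I2C//; last exact: radon0.
rewrite I2E //; last exact: radon0.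
exact: integral_measure_zero.
Qed.

Lemma mutual_energy_meas_eq mu nu mu' nu' : radon mu -> radon nu ->
  meas_eq mu mu' -> meas_eq nu nu' -> I2 mu nu = I2 mu' nu'.
Proof.
move=> rmu rnu e e'; have rmu' := radon_meas_eq hausX e rmu.
have rnu' := radon_meas_eq hausX e' rnu.
by rewrite !I2E// (potential_meas_eq e'); exact: integral_meas_eq.
Qed.

Lemma restrm_le mu D (mD : measurable D) B : measurable B -> restrm mu mD B <= mu B.
Proof. by move=> mB; rewrite restrmE; apply: measureS => //; exact: measurableI. Qed.

Lemma restrm_split mu P (mP : measurable P) (mPc : measurable (~` P)) :
  meas_eq mu (addm (restrm mu mP) (restrm mu mPc)).
Proof.
move=> B mB; rewrite addmE !restrmE -measureU; last 3 first.
- exact: measurableI.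
- exact: measurableI.
- by rewrite setIACA setICr setI0.
by rewrite -setIUr setUCr setIT.
Qed.

Lemma Eplus_radon mu : Ep mu -> radon mu. Proof. by case. Qed.

Lemma Eplus_le mu nu : Ep mu -> (forall B, measurable B -> nu B <= mu B) -> Ep nu.
Proof.
move=> [rmu Emu] le; have rnu := radon_le hausX lcX scX rmu le.
by split=> //; apply: le_lt_trans Emu; exact: mutual_energy_le.
Qed.

Lemma Eplus_restr mu D (mD : measurable D) : Ep mu -> Ep (restrm mu mD).
Proof. by move=> /Eplus_le; apply => B mB; exact: restrm_le. Qed.

Lemma Eplus_meas_eq mu nu : meas_eq mu nu -> Ep mu -> Ep nu.
Proof. by move=> e /Eplus_le; apply => B mB; rewrite e. Qed.

Lemma Eplus0 : Ep (zero_meas : meas X R).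
Proof.
by split; [exact: radon0|rewrite /energy mutual_energy0 ?ltry//; exact: radon0].
Qed.

Lemma EplusZ r mu : Ep mu -> Ep (scalem r mu).
Proof.
move=> [rmu Emu]; have rZ := radonZ hausX r rmu; split=> //.
rewrite /energy mutual_energyZl// mutual_energyZr//.
by rewrite !lte_mul_pinfty// mule_ge0// I20.
Qed.

Lemma radon_jordan mu nu : radon mu -> radon nu ->
  exists P (rp rn : meas X R), [/\ measurable P,
    forall B, measurable B -> mu B + rn B = nu B + rp B,
    forall B, measurable B -> rp B <= mu B,
    forall B, measurable B -> rn B <= nu B &
    rp (~` P) = 0 /\ rn P = 0].
Proof.
move=> rmu rnu; have [H [cH _ HT]] := compact_exhaustion hausX lcX scX.
apply: (@sigma_finite_jordan _ (borel X) R mu nu H) => // n.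
  exact: compact_borel.
by have [h _] := (radonP hausX mu).1 rmu; have [h' _] := (radonP hausX nu).1 rnu; split; auto.
Qed.

Context (energyk : energy_principle kappa).

(** The pair [(mu, nu)] is the Jordan decomposition of a signed measure with a
    finite positive part of energy, so its energy is defined, and the energy
    principle prevents the mixed term from being infinite. *)
Lemma singular_energy mu nu P : Ep mu -> Ep nu -> measurable P ->
  mu (~` P) = 0 -> nu P = 0 ->
  [/\ I2 mu nu < +oo, 0 <= I2 mu mu + I2 nu nu - (I2 mu nu + I2 nu mu) &
    I2 mu mu + I2 nu nu - (I2 mu nu + I2 nu mu) = 0 ->
    meas_eq mu zero_meas /\ meas_eq nu zero_meas].
Proof.
move=> [rmu Emu] [rnu Enu] mP muP nuP.
have rad : signed_radon (mu, nu) by split=> //; exists P.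
have fin : I2 mu mu + I2 nu nu \is a fin_num.
  by rewrite fin_numD !ge0_fin_numE ?I20// Emu Enu.
have def : energy_defined kappa (mu, nu) (mu, nu).
  exact: fin_num_adde_defr.
have [pos strict] := energyk rad def; split=> //.
have := pos; rewrite /signed_energy /energy_pos /energy_neg /= (I2C rnu)//.
rewrite sube_ge0 ?fin ?orbT// => le; have : I2 mu nu + I2 mu nu < +oo.
  by apply: le_lt_trans le _; rewrite -ge0_fin_numE// adde_ge0// I20.
by apply: le_lt_trans; rewrite leeDl// I20.
Qed.

(** On a Hahn set of [mu - nu], and on its complement, one of the two measures
    dominates the other, which bounds the mixed energy of the two restrictions
    by a self-energy. The remaining two terms involve mutually singular
    restrictions. *)
Lemma mutual_energy_lty mu nu : Ep mu -> Ep nu -> I2 mu nu < +oo.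
Proof.
move=> emu enu; have rmu := Eplus_radon emu; have rnu := Eplus_radon enu.
have [P [rp [rn [mP e _ _ [rpP rnP]]]]] := radon_jordan rmu rnu.
have mPc := measurableC mP.
have leP B : measurable B -> restrm nu mP B <= restrm mu mP B.
  move=> mB; have mBP := measurableI _ _ mB mP; rewrite !restrmE.
  have := e _ mBP; rewrite (subset_measure0 mBP mP (@subIsetr _ B P) rnP).
  by rewrite adde0 => ->; rewrite leeDl.
have lePc B : measurable B -> restrm mu mPc B <= restrm nu mPc B.
  move=> mB; have mBP := measurableI _ _ mB mPc; rewrite !restrmE.
  have := e _ mBP; rewrite (subset_measure0 mBP mPc (@subIsetr _ B (~` P)) rpP).
  by rewrite adde0 => <-; rewrite leeDl.
have E1 := Eplus_restr mP emu; have E2 := Eplus_restr mPc emu.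
have E3 := Eplus_restr mP enu; have E4 := Eplus_restr mPc enu.
have [R1 R2 R3 R4] := And4 (Eplus_radon E1) (Eplus_radon E2) (Eplus_radon E3) (Eplus_radon E4).
rewrite (mutual_energy_meas_eq rmu rnu (restrm_split mu mP mPc) (restrm_split nu mP mPc)).
have R34 := radonD hausX R3 R4.
rewrite mutual_energyDl// !mutual_energyDr//.
have nP (m : meas X R) : restrm m mP (~` P) = 0 by rewrite restrmE setICl measure0.
have nPc (m : meas X R) : restrm m mPc P = 0 by rewrite restrmE setICr measure0.
have [S1 _ _] := singular_energy E1 E4 mP (nP _) (nPc _).
have [S2 _ _] := singular_energy E3 E2 mP (nP _) (nPc _).
have S3 : I2 (restrm mu mP) (restrm nu mP) < +oo.
  by apply: le_lt_trans E1.2; apply: mutual_energy_le.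
have S4 : I2 (restrm mu mPc) (restrm nu mPc) < +oo.
  by apply: le_lt_trans E4.2; apply: mutual_energy_le.
rewrite (I2C R2 R3).
exact: (lte_add_pinfty (lte_add_pinfty S3 S1) (lte_add_pinfty S2 S4)).
Qed.

Lemma EplusD mu nu : Ep mu -> Ep nu -> Ep (addm mu nu).
Proof.
move=> emu enu; have [rmu _] := emu; have [rnu _] := enu.
have r := radonD hausX rmu rnu; split=> //.
rewrite /energy mutual_energyDl// !mutual_energyDr//.
by do 2! apply: lte_add_pinfty; apply: mutual_energy_lty.
Qed.

Definition ip mu nu : R := fine (I2 mu nu).

Lemma ip_congr mu nu mu' nu' : I2 mu nu = I2 mu' nu' -> ip mu nu = ip mu' nu'.
Proof. by rewrite /ip => ->. Qed.

Lemma ipE_lty mu nu : radon mu -> radon nu -> I2 mu nu < +oo -> I2 mu nu = (ip mu nu)%:E.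
Proof. by move=> rmu rnu lty; rewrite fineK// ge0_fin_numE// I20. Qed.

Lemma ipE mu nu : Ep mu -> Ep nu -> I2 mu nu = (ip mu nu)%:E.
Proof.
move=> emu enu; rewrite fineK// ge0_fin_numE ?mutual_energy_lty//.
by apply: I20; exact: Eplus_radon.
Qed.

Lemma ip_ge0 mu nu : radon mu -> radon nu -> (0 <= ip mu nu)%R.
Proof. by move=> rmu rnu; rewrite fine_ge0// I20. Qed.

Lemma ipC mu nu : radon mu -> radon nu -> ip mu nu = ip nu mu.
Proof. by move=> rmu rnu; rewrite /ip I2C. Qed.

Lemma ipDl mu nu rho : Ep mu -> Ep nu -> Ep rho ->
  ip (addm mu nu) rho = (ip mu rho + ip nu rho)%R.
Proof.
move=> emu enu erho; have [[r1 _] [r2 _] [r3 _]] := And3 emu enu erho.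
by rewrite /ip mutual_energyDl// ipE// (ipE enu).
Qed.

Lemma ipZl r mu rho : Ep mu -> Ep rho -> ip (scalem r mu) rho = (r%:num * ip mu rho)%R.
Proof.
move=> emu erho; have [[r1 _] [r2 _]] := conj emu erho.
by rewrite /ip mutual_energyZl// ipE.
Qed.

Lemma ipDr mu nu rho : Ep mu -> Ep nu -> Ep rho ->
  ip rho (addm mu nu) = (ip rho mu + ip rho nu)%R.
Proof.
move=> emu enu erho; have [[r1 _] [r2 _] [r3 _]] := And3 emu enu erho.
by rewrite /ip mutual_energyDr// ipE// (ipE _ enu).
Qed.

Lemma ipZr r mu rho : Ep mu -> Ep rho -> ip rho (scalem r mu) = (r%:num * ip rho mu)%R.
Proof.
move=> emu erho; have [[r1 _] [r2 _]] := conj emu erho.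
by rewrite /ip mutual_energyZr// ipE.
Qed.

Lemma ip_meas_eq mu nu mu' nu' : radon mu -> radon nu ->
  meas_eq mu mu' -> meas_eq nu nu' -> ip mu nu = ip mu' nu'.
Proof. by move=> *; rewrite /ip (@mutual_energy_meas_eq mu nu mu' nu'). Qed.

Lemma ip_zero mu : radon mu -> ip mu zero_meas = 0%R.
Proof. by move=> rmu; rewrite /ip mutual_energy0. Qed.

Local Opaque ip.

(** The squared norm of [mu - nu]. *)
Definition dist2 mu nu : R := (ip mu mu - 2 * ip mu nu + ip nu nu)%R.

Lemma dist2C mu nu : radon mu -> radon nu -> dist2 mu nu = dist2 nu mu.
Proof. by move=> *; rewrite /dist2 (@ipC nu mu)//; move: (ip mu mu) (ip mu nu) (ip nu nu) => *; ring. Qed.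

(** Writing [mu - nu = rp - rn] with mutually singular [rp] and [rn] brings the
    distance of two arbitrary positive measures under the energy principle. *)
Lemma dist2_jordan mu nu : Ep mu -> Ep nu -> exists rp rn : meas X R,
  [/\ forall B, measurable B -> mu B + rn B = nu B + rp B,
    (0 <= dist2 mu nu)%R &
    dist2 mu nu = 0%R -> meas_eq rp zero_meas /\ meas_eq rn zero_meas].
Proof.
move=> emu enu; have rmu := Eplus_radon emu; have rnu := Eplus_radon enu.
have [P [rp [rn [mP e lep len [rpP rnP]]]]] := radon_jordan rmu rnu.
exists rp, rn.
have ep := Eplus_le emu lep; have en := Eplus_le enu len.
have [[r1 _] [r2 _]] := conj ep en.
suff d2 : (ip rp rp + ip rn rn - (ip rp rn + ip rn rp) = dist2 mu nu)%R.
  have E : I2 rp rp + I2 rn rn - (I2 rp rn + I2 rn rp) = (dist2 mu nu)%:E.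
    rewrite (ipE ep ep) (ipE en en) (ipE ep en) (ipE en ep).
    exact: (congr1 EFin d2).
  have [_ pos strict] := singular_energy ep en mP rpP rnP.
  split=> //; first by rewrite -lee_fin -E.
  by move=> d0; apply: strict; rewrite E d0.
have e' : meas_eq (addm mu rn) (addm nu rp) by move=> B mB; rewrite !addmE e.
have h rho : Ep rho -> (ip mu rho + ip rn rho = ip nu rho + ip rp rho)%R.
  move=> erho; rewrite -!ipDl//; apply: ip_meas_eq => //.
  - exact: radonD.
  - exact: Eplus_radon.
move: (h _ emu) (h _ enu) (h _ ep) (h _ en).
rewrite /dist2 (ipC rnu rmu) (ipC r2 rmu) (ipC r1 rmu) (ipC r2 rnu).
rewrite (ipC r1 rnu) (ipC r2 r1).
move: (ip mu mu) (ip mu nu) (ip nu nu) (ip mu rp) (ip mu rn) (ip nu rp) (ip nu rn).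
move: (ip rp rp) (ip rp rn) (ip rn rn) => *; lra.
Qed.

Lemma dist2_ge0 mu nu : Ep mu -> Ep nu -> (0 <= dist2 mu nu)%R.
Proof. by move=> emu enu; have [? [? []]] := dist2_jordan emu enu. Qed.

Lemma dist2_eq0 mu nu : Ep mu -> Ep nu -> dist2 mu nu = 0%R -> meas_eq mu nu.
Proof.
move=> emu enu; have [rp [rn [e _ /[apply] -[p0 n0]]]] := dist2_jordan emu enu.
by move=> B mB; have := e B mB; rewrite p0// n0// /zero_meas /= /mzero !adde0.
Qed.

Lemma dist2xx mu : dist2 mu mu = 0%R.
Proof. by rewrite /dist2; ring. Qed.

Lemma quadratic_ge0 (a b c : R) : (0 <= a)%R ->
  (forall t, 0 <= a * t ^+ 2 + 2 * b * t + c)%R -> (b ^+ 2 <= a * c)%R.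
Proof.
rewrite le_eqVlt => /orP[/eqP<-|a0] h.
  have [->|b0] := eqVneq b 0%R; first by rewrite expr0n/= mul0r.
  have := h (- (c + 1) / (2 * b))%R.
  have -> : (0 * (- (c + 1) / (2 * b)) ^+ 2 + 2 * b * (- (c + 1) / (2 * b)) + c = - 1)%R.
    by field.
  lra.
have := h (- b / a)%R.
have -> : (a * (- b / a) ^+ 2 + 2 * b * (- b / a) + c = (a * c - b ^+ 2) / a)%R.
  by field; rewrite gt_eqF.
by rewrite pmulr_lge0 ?invr_gt0// subr_ge0.
Qed.

(** The discriminant of the squared norm of [t (mu - nu) + rho] as a quadratic
    polynomial in [t]. For [t >= 0] it is the squared distance of [t mu + rho]
    to [t nu], and for [t < 0] the roles of [mu] and [nu] are exchanged, so that
    only positive measures occur. *)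
Lemma cauchy_schwarz mu nu rho : Ep mu -> Ep nu -> Ep rho ->
  ((ip mu rho - ip nu rho) ^+ 2 <= dist2 mu nu * ip rho rho)%R.
Proof.
move=> emu enu erho; have [[r1 _] [r2 _] [r3 _]] := And3 emu enu erho.
apply: quadratic_ge0; first exact: dist2_ge0.
move=> t.
have key a b (s : {nonneg R}) : Ep a -> Ep b ->
   (0 <= dist2 a b * s%:num ^+ 2 + 2 * (ip a rho - ip b rho) * s%:num + ip rho rho)%R.
  move=> ea eb; have [ra rb] := conj (Eplus_radon ea) (Eplus_radon eb).
  have eZa := EplusZ s ea; have eZb := EplusZ s eb.
  have := dist2_ge0 (EplusD eZa erho) eZb.
  have eD := EplusD eZa erho.
  rewrite /dist2 !ipDl// !ipDr// !ipZl// !ipZr// (ipC r3 ra) (ipC r3 rb).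
  move: (ip a a) (ip a b) (ip b b) (ip a rho) (ip b rho) (ip rho rho) => a1 a2 a3 a4 a5 a6.
  by congr (_ <= _)%R; ring.
have [t0|t0] := leP 0%R t; first exact: (key mu nu (NngNum t0)).
have t0' : (0 <= - t)%R by lra.
have := key nu mu (NngNum t0') enu emu; rewrite /= (dist2C r2 r1).
move: (dist2 mu nu) (ip mu rho) (ip nu rho) (ip rho rho) => a1 a2 a3 a4.
by congr (_ <= _)%R; ring.
Qed.

Lemma cauchy_schwarz0 mu rho : Ep mu -> Ep rho ->
  (ip mu rho ^+ 2 <= ip mu mu * ip rho rho)%R.
Proof.
move=> emu erho; have e0 := Eplus0; have [r0 _] := e0.
have [[r1 _] [r2 _]] := conj emu erho.
have z a : radon a -> (ip a zero_meas = 0)%R by exact: ip_zero.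
have := cauchy_schwarz emu e0 erho.
by rewrite /dist2 (@ipC zero_meas rho)// !z// subr0 mulr0 subr0 addr0.
Qed.

Lemma strong_dist_pos mu nu : Ep mu -> Ep nu ->
  strong_dist kappa (pos_signed mu) (pos_signed nu) = Num.sqrt (dist2 mu nu).
Proof.
move=> emu enu; have [[r1 _] [r2 _]] := conj emu enu; have [r0 _] := Eplus0.
rewrite /strong_dist; congr Num.sqrt.
have E a b : Ep a -> Ep b -> signed_energy kappa (pos_signed a) (pos_signed b) = (ip a b)%:E.
  move=> ea eb; have [[ra _] [rb _]] := conj ea eb.
  rewrite /signed_energy /energy_pos /energy_neg /= ipE// !mutual_energy0//.
  by rewrite I2C// mutual_energy0// !adde0 sube0.
by rewrite !E.
Qed.

Lemma strong_cvgP (T : Type) (F : set_system T) {FF : Filter F} (u : T -> meas X R) mu :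
  (\forall i \near F, Ep (u i)) -> Ep mu ->
  strong_cvg kappa F (fun i => pos_signed (u i)) (pos_signed mu) <->
  dist2 (u i) mu @[i --> F] --> (0 : R)%R.
Proof.
move=> eu emu.
have near_eq : \forall i \near F, strong_dist kappa (pos_signed (u i)) (pos_signed mu) =
    Num.sqrt (dist2 (u i) mu).
  by apply: filterS eu => i ei; exact: strong_dist_pos.
split=> h.
  have : (strong_dist kappa (pos_signed (u i)) (pos_signed mu)
       * strong_dist kappa (pos_signed (u i)) (pos_signed mu))%R @[i --> F] --> (0 * 0 : R)%R.
    exact: cvgM.
  rewrite mulr0; apply: cvg_trans; apply: near_eq_cvg.
  by apply: filterS2 near_eq eu => i -> ei; rewrite -expr2 sqr_sqrtr// dist2_ge0.
have : Num.sqrt (dist2 (u i) mu) @[i --> F] --> (Num.sqrt 0 : R)%R.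
  by apply: (continuous_cvg _ _ h); exact: sqrt_continuous.
rewrite sqrtr0; apply: cvg_trans; apply: near_eq_cvg.
by apply: filterS near_eq => i ->.
Qed.

Lemma strong_cvg_ip (T : Type) (F : set_system T) {FF : Filter F} (u : T -> meas X R) mu rho :
  (\forall i \near F, Ep (u i)) -> Ep mu -> Ep rho ->
  dist2 (u i) mu @[i --> F] --> (0 : R)%R -> ip (u i) rho @[i --> F] --> ip mu rho.
Proof.
move=> eu emu erho h.
apply/cvgrPdist_le => e e0.
have c0 : (0 < e ^+ 2 / (ip rho rho + 1))%R.
  by rewrite divr_gt0 ?exprn_gt0// ltr_wpDl// ip_ge0//; exact: Eplus_radon.
move/cvgrPdist_le : h => /(_ _ c0) h.
apply: filterS2 h eu => i; rewrite sub0r normrN => le ei.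
have q0 : (0 <= ip rho rho)%R by rewrite ip_ge0//; exact: Eplus_radon.
rewrite -(@ler_pXn2r _ 2)// ?nnegrE ?(ltW e0)// real_normK ?num_real//.
have := cauchy_schwarz ei emu erho.
rewrite -(opprB (ip mu rho)) sqrrN => /le_trans; apply.
apply: (@le_trans _ _ (e ^+ 2 / (ip rho rho + 1) * ip rho rho)%R).
  by apply: ler_wpM2r => //; apply: le_trans (ler_norm _) le.
rewrite mulrAC ler_pdivrMr ?ltr_wpDl// ler_wpM2l ?sqr_ge0//.
by rewrite lerDl.
Qed.

Lemma strong_cvg_norm (T : Type) (F : set_system T) {FF : Filter F} (u : T -> meas X R) mu :
  (\forall i \near F, Ep (u i)) -> Ep mu ->
  dist2 (u i) mu @[i --> F] --> (0 : R)%R -> ip (u i) (u i) @[i --> F] --> ip mu mu.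
Proof.
move=> eu emu h; have hip := strong_cvg_ip eu emu emu h.
have -> : (fun i => ip (u i) (u i)) =
    (fun i => dist2 (u i) mu + 2 * ip (u i) mu - ip mu mu)%R.
  by apply/funext => i; rewrite /dist2; ring.
rewrite [X in _ --> X](_ : _ = (0 + 2 * ip mu mu - ip mu mu)%R); last by ring.
apply: cvgB; last exact: cvg_cst.
apply: cvgD; first exact: h.
apply: cvgMl_tmp; exact: hip.
Qed.

(** Both hypotheses together annihilate [dist2 mu nu]. Swept measures are unique
    because each can be tested against itself and against its competitor. *)
Lemma ip_ext mu nu : Ep mu -> Ep nu ->
  ip mu mu = ip nu mu -> ip mu nu = ip nu nu -> meas_eq mu nu.
Proof.
move=> emu enu h1 h2; apply: dist2_eq0 => //.
have [[r1 _] [r2 _]] := conj emu enu.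
by rewrite /dist2; move: h1 h2; rewrite (@ipC nu mu)//; lra.
Qed.

End energy_space.

(** * Vague convergence and lower semicontinuous functions *)

Section vague_descent.
Context {R : realType} {X : ptopologicalType}.
Context (hausX : hausdorff_space X) (lcX : locally_compact [set: X]).
Context (scX : @second_countable X).
Implicit Types (mu nu : meas X R) (B : set (borel X)) (phi : X -> R).

Definition compact_support phi := compact (closure [set x | phi x != 0%R]).

Lemma compact_support0 : compact_support (fun=> 0%R).
Proof.
rewrite /compact_support (_ : [set _ | _] = set0) ?closure0; first exact: compact0.
by apply/seteqP; split=> // x /=; rewrite eqxx.
Qed.

Lemma lsc_measurable (g : X -> \bar R) : lower_semicontinuous g ->
  measurable_fun [set: borel X] (g : borel X -> \bar R).
Proof.
move/lower_semicontinuousP => og.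
apply: (measurability (@ErealGenOInfty.G R)).
  exact: ErealGenOInfty.measurableE.
move=> _ [_ [x ->] <-]; rewrite setTI preimage_itvoy.
by apply: open_borel; exact: og.
Qed.

Lemma continuous_lsc phi : continuous phi -> lower_semicontinuous (EFin \o phi).
Proof.
move=> cphi; apply/lower_semicontinuousP => a.
have -> : [set x | a%:E < (EFin \o phi) x] = phi @^-1` `]a, +oo[%classic.
  by apply/seteqP; split=> x /=; rewrite lte_fin in_itv /= andbT.
by apply: open_comp; [move=> x _; exact: cphi|exact: interval_open].
Qed.

Lemma continuous_measurable phi : continuous phi ->
  measurable_fun [set: borel X] (EFin \o phi : borel X -> \bar R).
Proof. by move=> /continuous_lsc /lsc_measurable. Qed.

Lemma compact_support_bounded phi : continuous phi -> compact_support phi ->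
  exists C : R, forall x, (`|phi x| <= C)%R.
Proof.
move=> cphi sphi.
have /compact_bounded[C [Creal HC]] : compact (phi @` closure [set x | phi x != 0%R]).
  by apply: continuous_compact => //; exact: continuous_subspaceT.
exists (Num.max 0 (C + 1))%R => x.
have [phix0|phix] := eqVneq (phi x) 0%R.
  by rewrite phix0 normr0 le_max lexx.
rewrite le_max; apply/orP; right; apply: (HC (C + 1)%R); first by rewrite ltrDl.
by exists x => //; exact: subset_closure.
Qed.

Lemma compact_support_integral mu phi : radon mu -> continuous phi -> compact_support phi ->
  (forall x, 0 <= phi x)%R -> \int[mu]_x (phi x)%:E = ((\int[mu]_x phi x)%R)%:E.
Proof.
move=> rmu cphi sphi phi0; rewrite /Rintegral fineK// ge0_fin_numE; last first.
  by apply: integral_ge0 => x _; rewrite lee_fin.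
have [C HC] := compact_support_bounded cphi sphi.
pose S := closure [set x | phi x != 0%R].
have mS : measurable (S : set (borel X)) by exact: compact_borel.
apply: (@le_lt_trans _ _ (\int[mu]_(x in S) (cst C%:E) x)); last first.
  rewrite integral_cst//; have [fK _] := (radonP hausX mu).1 rmu.
  by rewrite lte_mul_pinfty ?fK// lee_fin; apply: le_trans (HC point).
rewrite [leRHS]integral_mkcond; apply: ge0_le_integral => //.
- by move=> x _; rewrite lee_fin.
- exact: continuous_measurable.
- by apply/(measurable_restrictT _ _).1 => //; exact: measurable_cst.
move=> x _; rewrite patchE; case: ifPn => xS.
  by rewrite lee_fin; apply: le_trans (HC x); exact: ler_norm.
rewrite lee_fin; have [->//|px] := eqVneq (phi x) 0%R.
by move/negP: xS; case; apply/mem_set/subset_closure.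
Qed.

(** Countably many functions are enough: for basic open sets with the closure of
    [b i] inside [b j] and a rational [q] below [g] on [b j], take [q] times a
    bump that is 1 on [b i] and vanishes outside [b j]. Running maxima make the
    family increasing. *)
Lemma lsc_approx (g : X -> \bar R) : (forall x, 0 <= g x) -> lower_semicontinuous g ->
  exists M : nat -> X -> R, [/\ forall n, continuous (M n) /\ compact_support (M n),
    forall n x, (0 <= M n x)%R, forall n x, (M n x)%:E <= g x,
    forall n x, (M n x <= M n.+1 x)%R &
    forall x a, a%:E < g x -> exists n, (a < M n x)%R].
Proof.
move=> g0 lg; have og := (lower_semicontinuousP g).1 lg.
have [b [bo bn]] := second_countable_seq scX.
pose good (p : nat * nat * rat) (f : X -> R) :=
  [/\ continuous f, compact_support f, forall x, (0 <= f x)%R, forall x, (f x)%:E <= g x &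
   compact (closure (b p.1.1)) -> closure (b p.1.1) `<=` b p.1.2 -> (0 <= p.2)%R ->
   b p.1.2 `<=` [set x | (ratr p.2)%:E < g x] ->
   forall x, b p.1.1 x -> f x = ratr p.2].
have /choice[f Pf] : forall p, exists f, good p f.
  move=> [[i j] q].
  have [[cbi bij q0 bjg]|h] := pselect [/\ compact (closure (b i)),
     closure (b i) `<=` b j, (0 <= q)%R & b j `<=` [set x | (ratr q)%:E < g x]]; last first.
    exists (fun=> 0%R); split=> //.
    - exact: cst_continuous.
    - exact: compact_support0.
    - by move=> h1 h2 h3 h4; exfalso; apply: h.
  have [phi [cphi sphi phi01 phi1 phi0]] := compact_urysohn hausX lcX R cbi (bo j) bij.
  have rq0 : (0 <= ratr q :> R)%R by rewrite ler0q.
  exists (fun x => ratr q * phi x)%R; split=> //=.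
  - by move=> x; apply: cvgM; [exact: cvg_cst|exact: cphi].
  - apply: (subclosed_compact (@closed_closure _ _) sphi); apply: closureS => x /=.
    by apply: contraNN => /eqP->; rewrite mulr0.
  - by move=> x; rewrite mulr_ge0//; have /andP[] := phi01 x.
  - move=> x; have [/bjg/ltW/= qg|nbx] := pselect (b j x); last by rewrite phi0// mulr0.
    apply: le_trans qg; rewrite lee_fin ler_piMr//; by have /andP[] := phi01 x.
  - by move=> _ _ _ _ x bx; rewrite phi1 ?mulr1//; exact: subset_closure.
pose h n := if choice.unpickle n is Some p then f p else (fun=> 0%R).
have Ph n : [/\ continuous (h n), compact_support (h n), forall x, (0 <= h n x)%R
    & forall x, (h n x)%:E <= g x].
  rewrite /h; case: choice.unpickle => [p|]; first by have [] := Pf p.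
  by split=> //; [exact: cst_continuous|exact: compact_support0].
pose M := fix M n := if n is m.+1 then (fun x => Num.max (M m x) (h m x))%R else (fun=> 0%R).
have PM n : [/\ continuous (M n), compact_support (M n), forall x, (0 <= M n x)%R
    & forall x, (M n x)%:E <= g x].
  elim: n => [|n [c1 c2 c3 c4]] /=.
    by split=> //; [exact: cst_continuous|exact: compact_support0].
  have [h1 h2 h3 h4] := Ph n; split.
  - by move=> x; apply: continuous_max; [exact: c1|exact: h1].
  - apply: (subclosed_compact (@closed_closure _ _) (compactU c2 h2)).
    rewrite -closureU; apply: closureS => x /= mx.
    have [M0|] := eqVneq (M n x) 0%R; last by left.
    by right; apply: contraNN mx => /eqP->; rewrite M0 maxxx.
  - by move=> x; rewrite le_max c3.
  - by move=> x; rewrite maxEle; case: ifP.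
exists M; split=> [n|n|n|n x|x a agx].
- by have [] := PM n.
- by have [] := PM n.
- by have [] := PM n.
- by rewrite /= le_max lexx.
have [a0|a0] := ltP a 0%R; first by exists 0%N.
have [q aq qg] : exists2 q : rat, (a < ratr q)%R & (ratr q)%:E < g x.
  move: agx; case: (g x) => [r| |]//.
    rewrite lte_fin => /(rat_in_itvoo)[q]; rewrite in_itv/= => /andP[aq qr].
    by exists q.
  have : (a < a + 1)%R by rewrite ltrDl.
  move=> /(rat_in_itvoo)[q]; rewrite in_itv/= => /andP[aq qr] _.
  by exists q => //; rewrite ltry.
have q0 : (0 <= q)%R.
  by rewrite -(ler0q R); apply: ltW; apply: le_lt_trans aq.
have [j [bjx bjg]] : exists j, b j x /\ b j `<=` [set x | (ratr q)%:E < g x].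
  by apply: bn; apply: open_nbhs_nbhs; split=> //; exact: og.
have [L [cL Lx Lb]] := point_compact_nbhd hausX lcX (bo j) bjx.
have [i [bix bL]] := bn _ _ Lx.
have bL' : closure (b i) `<=` L.
  by rewrite (closure_id L).1; [exact: closureS|exact: compact_closed].
exists (choice.pickle (i, j, q)).+1 => /=; rewrite lt_max /h choice.pickleK.
have [_ _ _ _ ->//] := Pf (i, j, q); first by rewrite aq orbT.
- exact: (subclosed_compact (@closed_closure _ _) cL).
- exact: subset_trans Lb.
Qed.

Lemma lsc_integral_gt mu (g : X -> \bar R) t : radon mu ->
  (forall x, 0 <= g x) -> lower_semicontinuous g ->
  t < \int[mu]_x g x -> exists phi, [/\ continuous phi, compact_support phi,
    forall x, (0 <= phi x)%R, forall x, (phi x)%:E <= g x & t < \int[mu]_x (phi x)%:E].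
Proof.
move=> rmu g0 lg tg; have [M [Mc M0 Mg Mn MS]] := lsc_approx g0 lg.
have ndM x : nondecreasing_seq (fun n => (M n x)%:E).
  by apply/nondecreasing_seqP => n; rewrite lee_fin.
have limM x : limn (fun n => (M n x)%:E) = g x.
  apply/eqP; rewrite eq_le; apply/andP; split.
    by apply: lime_le; [exact: ereal_nondecreasing_is_cvgn|exact: nearW].
  rewrite leNgt; apply/negP => lt.
  have [a la ag] : exists2 a : R, limn (fun n => (M n x)%:E) <= a%:E & a%:E < g x.
    have lim0 : 0 <= limn (fun n => (M n x)%:E).
      by apply: lime_ge; [exact: ereal_nondecreasing_is_cvgn|apply: nearW => n; rewrite lee_fin].
    move: lt lim0; case: (limn _) => [r| |]//.
      by move=> rg _; exists r.
    by rewrite ltNge leey.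
  have [n an] := MS _ _ ag.
  have : (M n x)%:E <= a%:E.
    apply: le_trans la.
    rewrite (cvg_lim _ (ereal_nondecreasing_cvgn (ndM x)))//.
    by apply: ereal_sup_ubound; exists n.
  by rewrite lee_fin leNgt an.
have := @monotone_convergence _ (borel X) R mu setT measurableT (fun n x => (M n x)%:E).
move=> /(_ (fun n => continuous_measurable (Mc n).1) _ (fun x _ => ndM x)) mc.
have {}mc : \int[mu]_x g x = limn (fun n => \int[mu]_x (M n x)%:E).
  rewrite -mc; first by apply: eq_integral => x _; rewrite limM.
  by move=> n x _; rewrite lee_fin.
have [n tn] : exists n, t < \int[mu]_x (M n x)%:E.
  apply: contrapT => /forallNP nt; move: tg; rewrite mc; apply/negP; rewrite -leNgt.
  apply: lime_le; last by apply: nearW => n; rewrite leNgt; apply/negP; exact: nt.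
  apply: ereal_nondecreasing_is_cvgn; apply/nondecreasing_seqP => n.
  apply: ge0_le_integral => //.
  - by move=> x _; rewrite lee_fin.
  - exact: (continuous_measurable (Mc n).1).
  - exact: (continuous_measurable (Mc n.+1).1).
  - by move=> x _; rewrite lee_fin.
by exists (M n); have [] := Mc n.
Qed.

(** If the integral of [g] exceeds [t], so does that of a continuous minorant
    with compact support, to which vague convergence applies. *)
Lemma vague_descent (T : Type) (F : set_system T) {FF : Filter F} (u : T -> meas X R) mu
    (g : X -> \bar R) (t : R) :
  (\forall i \near F, radon (u i)) -> radon mu -> vague_cvg F u mu ->
  (forall x, 0 <= g x) -> lower_semicontinuous g ->
  t%:E < \int[mu]_x g x -> \forall i \near F, t%:E < \int[u i]_x g x.
Proof.
move=> ru rmu vu g0 lg /(lsc_integral_gt rmu g0 lg)[phi [cphi sphi phi0 phig]].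
rewrite compact_support_integral// lte_fin => tphi.
have /cvgrPdist_lt h := vu _ cphi sphi.
have := h (((\int[mu]_x phi x) - t)%R); rewrite subr_gt0 => /(_ tphi).
apply: filterS2 ru => i ri hi.
have tphi' : (t < \int[u i]_x phi x)%R.
  have := le_lt_trans (ler_norm _) hi; move: (\int[u i]_x phi x)%R (\int[mu]_x phi x)%R => a b.
  lra.
apply: (@lt_le_trans _ _ (\int[u i]_x (phi x)%:E)).
  by rewrite compact_support_integral// lte_fin.
apply: ge0_le_integral => //.
- by move=> x _; rewrite lee_fin.
- exact: continuous_measurable.
- exact: lsc_measurable.
Qed.

Lemma open_indic_lsc (D : set X) : open D ->
  lower_semicontinuous (fun x => (\1_D x)%:E : \bar R).
Proof.
move=> oD; apply/lower_semicontinuousP => a.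
have [a1|a1] := leP 1%R a.
  rewrite (_ : [set _ | _] = set0); first exact: open0.
  apply/seteqP; split=> // x /=; rewrite lte_fin indicE.
  by case: (x \in D) => /=; lra.
have [a0|a0] := ltP a 0%R.
  rewrite (_ : [set _ | _] = setT); first exact: openT.
  apply/seteqP; split=> // x _ /=; rewrite lte_fin indicE.
  by case: (x \in D) => /=; lra.
rewrite (_ : [set _ | _] = D)//; apply/seteqP; split=> x /=; rewrite lte_fin indicE.
  by case: (boolP (x \in D)) => [/set_mem//|_] /=; lra.
by move=> Dx; rewrite mem_set.
Qed.

Lemma vague_descent_open (T : Type) (F : set_system T) {FF : Filter F} (u : T -> meas X R) mu
    (D : set X) (t : R) :
  (\forall i \near F, radon (u i)) -> radon mu -> vague_cvg F u mu -> open D ->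
  t%:E < mu D -> \forall i \near F, t%:E < u i D.
Proof.
move=> ru rmu vu oD tD; have mD := open_borel oD.
have e (m : meas X R) : m D = \int[m]_x (\1_D x)%:E.
  by rewrite (@integral_indic _ (borel X))// setIT.
have := @vague_descent T F FF u mu (fun x => (\1_D x)%:E) t ru rmu vu.
rewrite -e => /(_ _ (open_indic_lsc oD) tD).
by move=> h; under eq_near do rewrite e; apply: h => x; rewrite lee_fin.
Qed.

(** Constant sequences converge vaguely, so vague descent on indicators compares
    the two measures on open sets. A compact set is a difference of open sets of
    finite measure, and compact sets determine a Radon measure. *)
Lemma radon_eq mu nu : radon mu -> radon nu ->
  (forall phi, continuous phi -> compact_support phi ->
    (\int[mu]_x phi x)%R = (\int[nu]_x phi x)%R) -> meas_eq mu nu.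
Proof.
move=> rmu rnu e.
have le (m n : meas X R) (D : set X) : radon m -> radon n ->
    (forall phi, continuous phi -> compact_support phi ->
      (\int[m]_x phi x)%R = (\int[n]_x phi x)%R) -> open D -> m D <= n D.
  move=> rm rn emn oD.
  have tD (t : R) : t%:E < m D -> t%:E < n D.
    move=> tm.
    have := @vague_descent_open nat \oo _ (fun=> n) m D t.
    case=> //; first exact: nearW.
      by move=> phi c1 c2; rewrite emn//; exact: cvg_cst.
    by move=> N _ /(_ N) /=; exact.
  rewrite leNgt; apply/negP => nm.
  have : n D \is a fin_num by rewrite ge0_fin_numE//; exact: lt_le_trans nm (leey _).
  move=> fn; have /tD : (fine (n D))%:E < m D by rewrite fineK.
  by rewrite fineK// ltxx.
have eo D : open D -> mu D = nu D.
  move=> oD; apply/eqP; rewrite eq_le !le//.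
  by move=> phi c1 c2; rewrite e.
have eK (K : set X) : compact K -> mu K = nu K.
  move=> cK; have [L [cL KL _]] := compact_nbhd hausX lcX cK openT (@subsetT _ K).
  have oL := @open_interior _ L; have oLK : open (L° `\` K).
    by rewrite setDE; apply: openI => //; apply: closed_openC; exact: compact_closed.
  have mK := compact_borel hausX cK; have mL := open_borel oL.
  have dec (m : meas X R) : m L° = m K + m (L° `\` K).
    have mLK := measurableD mL mK.
    by rewrite -(measureU m mK mLK) ?setDUK ?setDIK.
  have fin (m : meas X R) : radon m -> m K + m (L° `\` K) \is a fin_num.
    move=> /(radonP hausX)[fK _]; rewrite -dec ge0_fin_numE//.
    apply: le_lt_trans (fK _ cL); apply: measureS => //; first exact: compact_borel.
    exact: interior_subset.
  have := eo _ oL; rewrite !dec; move: (eo _ oLK) (fin mu rmu) => ->.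
  rewrite fin_numD => /andP[f1 f2].
  by move=> h; rewrite -(addeK (mu K) f2) h addeK.
move=> B mB; rewrite (rmu.2 B mB) (rnu.2 B mB); congr ereal_sup.
apply/seteqP; split=> _ [K [cK KB] <-]; exists K => //; first by rewrite eK.
by rewrite eK.
Qed.

Lemma vague_unique (T : Type) (F : set_system T) {FF : ProperFilter F}
    (u : T -> meas X R) mu nu : radon mu -> radon nu ->
  vague_cvg F u mu -> vague_cvg F u nu -> meas_eq mu nu.
Proof.
move=> rmu rnu v1 v2; apply: radon_eq => // phi c1 c2.
exact: (cvg_unique (@Rhausdorff R) (v1 _ c1 c2) (v2 _ c1 c2)).
Qed.

End vague_descent.

(** * Capacity and exceptional sets *)

Section exceptional_sets.
Context {R : realType} {X : ptopologicalType}.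
Context (hausX : hausdorff_space X) (lcX : locally_compact [set: X]).
Context (scX : @second_countable X).
Context (kappa : X * X -> \bar R) (kerk : is_kernel kappa).
Context (energyk : energy_principle kappa).
Implicit Types (mu nu rho : meas X R) (B N : set (borel X)) (K D E A : set X).

Local Notation Ep := (Eplus kappa).
Local Notation ipk := (ip kappa).
Local Notation norm mu := (Num.sqrt (ipk mu mu)).
Local Opaque potential mutual_energy ip.

Lemma not_leE A (f g : X -> \bar R) :
  [set x | A x /\ ~ (f x <= g x)] = A `&` [set x | g x < f x].
Proof.
apply/seteqP; split=> x [Ax gf]; split=> //=; first by rewrite ltNge; apply/negP.
by apply/negP; rewrite -ltNge.
Qed.

Lemma measurable_not_le A (f g : X -> \bar R) : measurable (A : set (borel X)) ->
  measurable_fun [set: borel X] (f : borel X -> \bar R) ->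
  measurable_fun [set: borel X] (g : borel X -> \bar R) ->
  measurable ([set x | A x /\ ~ (f x <= g x)] : set (borel X)).
Proof.
move=> mA mf mg; rewrite not_leE; apply: measurableI => //.
by rewrite -[X in measurable X]setTI; exact: (emeasurable_fun_lt measurableT mg mf).
Qed.

Lemma measurable_neq A (f g : X -> \bar R) : measurable (A : set (borel X)) ->
  measurable_fun [set: borel X] (f : borel X -> \bar R) ->
  measurable_fun [set: borel X] (g : borel X -> \bar R) ->
  measurable ([set x | A x /\ ~ (f x = g x)] : set (borel X)).
Proof.
move=> mA mf mg.
have -> : [set x | A x /\ ~ (f x = g x)] =
    [set x | A x /\ ~ (f x <= g x)] `|` [set x | A x /\ ~ (g x <= f x)].
  apply/seteqP; split=> x /=; last by move=> [][Ax]; rewrite /not => n; split=> // e;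
    apply: n; rewrite e.
  move=> [Ax n]; have [fg|] := pselect (f x <= g x); last by left.
  by right; split=> // gf; apply: n; apply/eqP; rewrite eq_le fg.
by apply: measurableU; exact: measurable_not_le.
Qed.

Lemma concentratedP B mu : measurable B -> concentrated B mu <-> mu (~` B) = 0.
Proof. by move=> mB; apply: negligibleP; exact: measurableC. Qed.

Lemma concentrated_restr mu D (mD : measurable (D : set (borel X))) :
  concentrated D (restrm mu mD).
Proof. by apply/concentratedP => //; rewrite restrmE setICl measure0. Qed.

Lemma concentratedS E A mu : E `<=` A -> concentrated E mu -> concentrated A mu.
Proof. by move=> EA; apply: negligibleS; exact: subsetC. Qed.

Lemma concentrated_setT mu B : measurable B -> concentrated B mu -> mu setT = mu B.
Proof.
move=> mB /(concentratedP _ mB) c; have mBc := measurableC mB.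
transitivity (mu B + mu (~` B)); last by rewrite c adde0.
by rewrite -(setUv B); apply: measureU => //; rewrite setICr.
Qed.

Lemma energyE mu : Ep mu -> energy kappa mu = (ipk mu mu)%:E.
Proof. by move=> emu; exact: (ipE hausX lcX scX kerk energyk). Qed.

Lemma ip_self_ge0 mu : Ep mu -> (0 <= ipk mu mu)%R.
Proof. by move=> [rmu _]; exact: (ip_ge0 hausX lcX scX kerk rmu rmu). Qed.

Lemma restr_ip_le mu D (mD : measurable (D : set (borel X))) : Ep mu ->
  (ipk (restrm mu mD) (restrm mu mD) <= ipk mu mu)%R.
Proof.
move=> emu; have er := Eplus_restr hausX lcX scX kerk mD emu.
rewrite -lee_fin -!energyE//; have [[r1 _] [r2 _]] := conj emu er.
by apply: (mutual_energy_le hausX lcX scX kerk) => // B mB; exact: restrm_le.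
Qed.

Lemma capacity_ge0 K : 0 <= capacity kappa K.
Proof.
rewrite /capacity inve_ge0; apply: le_ereal_inf_tmp => _ [mu [[[rmu _] _] _] <-].
exact: (mutual_energy_ge0 hausX lcX scX kerk).
Qed.

Lemma capacity_gt0P K : 0 < capacity kappa K <->
  exists mu, Eplus_on kappa K mu /\ mu setT = 1.
Proof.
split=> [c0|[mu [emu mu1]]].
  apply: contrapT => /forallNP nmu; move: c0; rewrite /capacity.
  rewrite (_ : [set _ | _ in _] = set0) ?ereal_inf0 ?invey ?ltxx//.
  by apply/seteqP; split=> // y [mu hmu _]; exact: (nmu mu).
rewrite lt_neqAle capacity_ge0 andbT eq_sym /capacity inve_eq0.
have [[_ Emu] _] := emu; rewrite -ltey; apply: le_lt_trans Emu.
by apply: ereal_inf_lbound; exists mu.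
Qed.

Lemma mass_normalize mu K : Ep mu -> compact K -> mu K != 0 ->
  exists nu, Eplus_on kappa K nu /\ nu setT = 1.
Proof.
move=> emu cK muK0; have mK := compact_borel hausX cK; have [rmu _] := emu.
have fK := radon_fin_num hausX rmu cK.
have muK : (0 < fine (mu K))%R.
  by rewrite fine_gt0// lt_neqAle eq_sym muK0 measure_ge0 -ge0_fin_numE.
have r0 : (0 <= (fine (mu K))^-1)%R by rewrite invr_ge0 ltW.
exists (scalem (NngNum r0) (restrm mu mK)); split; first split.
- exact/EplusZ/Eplus_restr.
- apply/concentratedP => //; rewrite scalemE (concentratedP _ mK).1 ?mule0//.
  exact: concentrated_restr.
- rewrite scalemE restrmE setTI /= -{2}(fineK fK) -EFinM mulVf//.
  by rewrite gt_eqF.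
Qed.

Lemma inner_capacity_ge0 E : 0 <= inner_capacity kappa E.
Proof.
apply: (@le_trans _ _ (capacity kappa set0)); first exact: capacity_ge0.
by apply: ereal_sup_ubound; exists set0 => //; split; [exact: compact0|].
Qed.

Lemma inner_capacityS E A : E `<=` A -> inner_capacity kappa E <= inner_capacity kappa A.
Proof.
move=> EA; apply: ge_ereal_sup => _ [K [cK KE] <-].
by apply: ereal_sup_ubound; exists K => //; split=> //; exact: subset_trans EA.
Qed.

(** A compact set charged by a measure of finite energy carries, after
    restriction and normalization, a measure of mass 1 and finite energy. *)
Lemma inner_capacity0P N : measurable N ->
  inner_capacity kappa N = 0 <-> forall mu, Ep mu -> mu N = 0.
Proof.
move=> mN; split=> [c0 mu emu|h].
  apply/eqP; rewrite eq_le measure_ge0 andbT leNgt; apply/negP.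
  have [rmu _] := emu; move=> /(((radonP hausX mu).1 rmu).2 _ _ mN)[K [cK KN muK]].
  have muK0 : mu K != 0 by move: muK; rewrite lt_neqAle eq_sym => /andP[].
  have [nu hnu] := mass_normalize emu cK muK0.
  have : 0 < capacity kappa K by apply/capacity_gt0P; exists nu.
  apply/negP; rewrite -leNgt -c0; by apply: ereal_sup_ubound; exists K.
apply/eqP; rewrite eq_le inner_capacity_ge0 andbT.
apply: ge_ereal_sup => _ [K [cK KN] <-]; rewrite leNgt; apply/negP.
move=> /capacity_gt0P[mu [[emu cmu] mu1]].
have mK := compact_borel hausX cK.
move: mu1; rewrite (concentrated_setT mK cmu) => mu1.
have := measureS mu mK mN KN; rewrite h// mu1.
by rewrite lee_fin ler10.
Qed.

(** A measure of mass 1 carried by a compact subset of [N] has norm at least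
    [1 / s]. *)
Lemma inner_capacity_le N s : measurable N -> (0 < s)%R ->
  (forall mu, Ep mu -> mu N <= (s * norm mu)%:E) ->
  inner_capacity kappa N <= (s ^+ 2)%:E.
Proof.
move=> mN s0 h; apply: ge_ereal_sup => _ [K [cK KN] <-].
have mK := compact_borel hausX cK; have s20 : (0 < s ^+ 2)%R by rewrite exprn_gt0.
rewrite /capacity inve_ple; last 2 first.
- rewrite inE; apply: le_ereal_inf_tmp => _ [mu [[[rmu _] _] _] <-].
  exact: (mutual_energy_ge0 hausX lcX scX kerk).
- by rewrite inE/= lee_fin ltW.
rewrite inver gt_eqF//; apply: le_ereal_inf_tmp => _ [mu [[emu cmu] mu1] <-].
move: mu1; rewrite (concentrated_setT mK cmu) => mu1.
have := le_trans (measureS mu mK mN KN) (h _ emu).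
rewrite mu1 energyE// !lee_fin -ler_pdivrMl// mulr1 => le.
rewrite -(sqr_sqrtr (ip_self_ge0 emu)) -exprVn.
by rewrite ler_pXn2r ?nnegrE ?sqrtr_ge0// invr_ge0 ltW.
Qed.

Lemma outer_capacity_ge0 E : 0 <= outer_capacity kappa E.
Proof. by apply: le_ereal_inf_tmp => _ [D _ <-]; exact: inner_capacity_ge0. Qed.

(** The bound [mu D <= e * norm mu] is countably subadditive in [D] because
    measures are; it is therefore more convenient to add up than capacities. *)
Lemma outer_null E : (forall e : R, (0 < e)%R -> exists D, [/\ open D, E `<=` D &
    forall mu, Ep mu -> mu D <= (e * norm mu)%:E]) -> outer_capacity kappa E = 0.
Proof.
move=> h; apply/eqP; rewrite eq_le outer_capacity_ge0 andbT.
apply/lee_addgt0Pr => e e0; rewrite add0e.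
have se0 : (0 < Num.sqrt e)%R by rewrite sqrtr_gt0.
have [D [oD ED hD]] := h _ se0.
apply: (@le_trans _ _ (inner_capacity kappa D)).
  by apply: ereal_inf_lbound; exists D.
by rewrite -(sqr_sqrtr (ltW e0)); apply: inner_capacity_le => //; exact: open_borel.
Qed.

Lemma inner_outer_null E : outer_capacity kappa E = 0 -> inner_capacity kappa E = 0.
Proof.
move=> o0; apply/eqP; rewrite eq_le inner_capacity_ge0 andbT -o0.
apply: le_ereal_inf_tmp => _ [D [oD ED] <-]; exact: inner_capacityS.
Qed.

Lemma quasi_nearly_everywhere E P :
  quasi_everywhere kappa E P -> nearly_everywhere kappa E P.
Proof. exact: inner_outer_null. Qed.

Lemma nearly_everywhere_ae A P mu : nearly_everywhere kappa A P ->
  measurable ([set x | A x /\ ~ P x] : set (borel X)) -> Eplus_on kappa A mu ->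
  mu.-negligible [set x | ~ P x].
Proof.
move=> ne mN [emu cmu].
have zN : mu.-negligible [set x | A x /\ ~ P x].
  by apply/negligibleP => //; exact: (inner_capacity0P mN).1.
apply: negligibleS (negligibleU cmu zN) => x /= nP.
by have [Ax|nAx] := pselect (A x); [right|left].
Qed.

Lemma integral_concentrated mu B (k : X -> \bar R) : measurable B ->
  (forall x, 0 <= k x) -> measurable_fun [set: borel X] (k : borel X -> \bar R) ->
  concentrated B mu -> \int[mu]_x k x = \int[mu]_(x in B) k x.
Proof.
move=> mB k0 mk /(concentratedP _ mB) z.
rewrite (ge0_negligible_integral (measurableC mB) measurableT mk (fun x _ => k0 x) z).
by rewrite setTD setCK.
Qed.

Lemma integral_restrm mu D (mD : measurable (D : set (borel X))) (k : X -> \bar R) :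
  (forall x, 0 <= k x) -> measurable_fun [set: borel X] (k : borel X -> \bar R) ->
  \int[restrm mu mD]_x k x = \int[mu]_(x in D) k x.
Proof.
move=> k0 mk; rewrite (integral_concentrated mD k0 mk (concentrated_restr mu mD)).
apply: eq_measure_integral => B mB BD.
by rewrite restrmE (setIidl BD).
Qed.

Lemma integral_lt_null mu N (f g : X -> \bar R) : measurable N ->
  (forall x, 0 <= f x) -> (forall x, 0 <= g x) ->
  measurable_fun [set: borel X] (f : borel X -> \bar R) ->
  measurable_fun [set: borel X] (g : borel X -> \bar R) ->
  (forall x, N x -> g x < f x) ->
  \int[mu]_(x in N) g x < +oo -> \int[mu]_(x in N) f x <= \int[mu]_(x in N) g x ->
  mu N = 0.
Proof.
move=> mN f0 g0 mf mg gf gfin fg.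
have mfN := measurable_funTS mf : measurable_fun (N : set (borel X)) f.
have mgN := measurable_funTS mg : measurable_fun (N : set (borel X)) g.
have gfn x : N x -> g x \is a fin_num.
  by move=> /gf gfx; rewrite ge0_fin_numE//; exact: lt_le_trans gfx (leey _).
have mfg : measurable_fun (N : set (borel X)) (fun x => f x - g x).
  exact: emeasurable_funB.
have fg0 x : N x -> 0 <= f x - g x by move=> Nx; rewrite sube_ge0 ?gfn// ltW// gf.
have dec : \int[mu]_(x in N) f x = \int[mu]_(x in N) g x + \int[mu]_(x in N) (f x - g x).
  rewrite -(@ge0_integralD _ (borel X))//.
  by apply: eq_integral => x /set_mem Nx; rewrite addeC subeK// gfn.
have z : \int[mu]_(x in N) (f x - g x) = 0.
  apply/eqP; rewrite eq_le integral_ge0 ?andbT//.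
  move: fg; rewrite dec.
  have : \int[mu]_(x in N) g x \is a fin_num.
    by rewrite ge0_fin_numE//; apply: integral_ge0.
  by move=> gfn'; rewrite -leeBrDl// subee.
have := (ae_eq_integral_abs mu mN mfg).1.
rewrite (_ : \int[mu]_(x in N) `|f x - g x| = 0); last first.
  by rewrite -z; apply: eq_integral => x /set_mem Nx; rewrite gee0_abs// fg0.
move=> /(_ erefl)[M [mM muM NM]].
apply/eqP; rewrite eq_le measure_ge0 andbT -muM.
apply: measureS => // x Nx; apply: NM => /=; apply/not_implyP; split=> //.
by move=> e0; have := gf _ Nx; rewrite -sube_gt0 e0 ltxx.
Qed.

(** If some measure of finite energy charged the exceptional set, its
    restriction to a compact part of it would be a test measure against which
    [g < f] strictly. *)
Lemma nearly_everywhere_le (f g : X -> \bar R) A :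
  measurable (A : set (borel X)) -> (forall x, 0 <= f x) -> (forall x, 0 <= g x) ->
  measurable_fun [set: borel X] (f : borel X -> \bar R) ->
  measurable_fun [set: borel X] (g : borel X -> \bar R) ->
  (forall K nu, compact K -> K `<=` A -> Eplus_on kappa K nu ->
     \int[nu]_x g x < +oo /\ \int[nu]_x f x <= \int[nu]_x g x) ->
  nearly_everywhere kappa A (fun x => f x <= g x).
Proof.
move=> mA f0 g0 mf mg h.
have mN := measurable_not_le mA mf mg.
apply/(inner_capacity0P mN) => mu emu.
apply/eqP; rewrite eq_le measure_ge0 andbT leNgt; apply/negP.
have [rmu _] := emu; move=> /(((radonP hausX mu).1 rmu).2 _ _ mN)[K [cK KN muK]].
have mK := compact_borel hausX cK.
have [||gfin fg] := h K (restrm mu mK) cK.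
- by move=> x /KN[].
- by split; [exact: Eplus_restr|exact: concentrated_restr].
move: gfin fg; rewrite !integral_restrm// => gfin fg.
move: muK; rewrite (@integral_lt_null mu K f g)// ?ltxx//.
by move=> x /KN; rewrite not_leE => -[].
Qed.

End exceptional_sets.

(** * Consequences of consistency *)

Section consistency.
Context {R : realType} {X : ptopologicalType}.
Context (hausX : hausdorff_space X) (lcX : locally_compact [set: X]).
Context (scX : @second_countable X).
Context (kappa : X * X -> \bar R) (kerk : is_kernel kappa).
Context (energyk : energy_principle kappa) (consk : consistent kappa).
Implicit Types (mu nu rho : meas X R) (B : set (borel X)) (K D E A : set X).

Local Notation Ep := (Eplus kappa).
Local Notation ipk := (ip kappa).
Local Notation d2 := (dist2 kappa).
Local Notation norm mu := (Num.sqrt (ipk mu mu)).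
Local Opaque potential mutual_energy ip.

Lemma strong_complete (u : nat -> meas X R) : (forall n, Ep (u n)) ->
  (forall e : R, (0 < e)%R -> exists N, forall m n, (N <= m)%N -> (N <= n)%N ->
     (d2 (u m) (u n) < e)%R) ->
  exists2 mu, Ep mu & d2 (u n) mu @[n --> \oo] --> (0 : R)%R.
Proof.
move=> eu cu; have [|mu emu] := consk.1 u eu.
  move=> e e0; have [|N hN] := cu (e ^+ 2)%R; first by rewrite exprn_gt0.
  exists N => m n Nm Nn; rewrite /= (strong_dist_pos hausX lcX scX kerk energyk)//.
  have e2 : Num.sqrt (e ^+ 2) = e by rewrite sqrtr_sqr ger0_norm// ltW.
  by rewrite -e2 ltr_sqrt ?exprn_gt0//; exact: hN.
exists mu => //; apply/(strong_cvgP hausX lcX scX kerk energyk) => //.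
exact: nearW.
Qed.

Lemma strong_vague (T : Type) (F : set_system T) {FF : Filter F} (u : T -> meas X R) mu :
  (\forall i \near F, Ep (u i)) -> Ep mu ->
  d2 (u i) mu @[i --> F] --> (0 : R)%R -> vague_cvg F u mu.
Proof.
move=> eu emu h; apply: (consk.2 (u @ F) mu) => //.
exact/(strong_cvgP hausX lcX scX kerk energyk).
Qed.

(** The limit is also a vague limit, and those cannot charge the open complement
    of [K]. *)
Lemma strong_limit_concentrated (u : nat -> meas X R) mu K : closed K ->
  (forall n, Eplus_on kappa K (u n)) -> Ep mu ->
  d2 (u n) mu @[n --> \oo] --> (0 : R)%R -> Eplus_on kappa K mu.
Proof.
move=> clK eu emu h; split=> //.
have mK := closed_borel clK; apply/concentratedP => //.
have vu : vague_cvg \oo u mu.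
  by apply: strong_vague => //; apply: nearW => n; have [] := eu n.
apply/eqP; rewrite eq_le measure_ge0 andbT leNgt; apply/negP => mu0.
have [N _ /(_ N (leqnn N))] : \forall n \near \oo, 0%:E < u n (~` K).
  apply: (vague_descent_open hausX lcX scX) vu _ mu0; last exact: closed_openC.
    by apply: nearW => n; have [[]] := eu n.
  by have [] := emu.
have [_ /(concentratedP _ mK) /= ->] := eu N.
by rewrite ltxx.
Qed.

(** Otherwise measures of mass 1 on [K] would tend to 0 strongly, hence vaguely,
    which a continuous function with compact support that is 1 on [K] rules out. *)
Lemma compact_mass_bound K : compact K ->
  exists2 b : R, (0 < b)%R & forall mu, Ep mu -> mu K <= (b * norm mu)%:E.
Proof.
move=> cK; apply: contrapT => nb; have mK := compact_borel hausX cK.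
have /choice[u Pu] : forall n : nat, exists u, [/\ Ep u, u K = 1 &
    (ipk u u <= n.+1%:R^-1)%R].
  move=> n; apply: contrapT => nu; apply: nb; exists n.+1%:R%R => // mu emu.
  rewrite leNgt; apply/negP => lt; apply: nu.
  have [rmu _] := emu; have fK := radon_fin_num hausX rmu cK.
  have lt' : (n.+1%:R * norm mu < fine (mu K))%R by rewrite -lte_fin fineK.
  have muK : (0 < fine (mu K))%R.
    by apply: le_lt_trans lt'; rewrite mulr_ge0 ?sqrtr_ge0.
  have r0 : (0 <= (fine (mu K))^-1)%R by rewrite invr_ge0 ltW.
  exists (scalem (NngNum r0) mu); split.
  - exact: EplusZ.
  - by rewrite scalemE /= -{2}(fineK fK) -EFinM mulVf// gt_eqF.
  rewrite (ipZl hausX lcX scX kerk energyk)//; last exact: EplusZ.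
  rewrite (ipZr hausX lcX scX kerk energyk)//=.
  have q0 : (0 <= ipk mu mu)%R by exact: (ip_self_ge0 hausX lcX scX kerk).
  rewrite -(sqr_sqrtr q0); set a := Num.sqrt _ in lt' *; set b := fine _ in lt' muK *.
  have a0 : (0 <= a)%R by exact: sqrtr_ge0.
  have ab : (a / b <= n.+1%:R^-1)%R.
    by rewrite ler_pdivrMr// ler_pdivlMl// ltW.
  have -> : (b^-1 * (b^-1 * a ^+ 2) = (a / b) * (a / b))%R by rewrite expr2; ring.
  apply: (@le_trans _ _ (n.+1%:R^-1 * n.+1%:R^-1)%R).
    by apply: ler_pM => //; rewrite divr_ge0// ltW.
  by rewrite ler_piMr// invf_le1// ler1n.
have e0 := Eplus0 hausX lcX scX kerk : Ep (zero_meas : meas X R).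
have r0 : radon (zero_meas : meas X R) by case: e0.
have d0 : d2 (u n) zero_meas @[n --> \oo] --> (0 : R)%R.
  have -> : (fun n => d2 (u n) zero_meas) = (fun n => ipk (u n) (u n)).
    apply/funext => n; have [eu _ _] := Pu n; have [ru _] := eu.
    by rewrite /dist2 !(ip_zero hausX lcX scX kerk)// mulr0 subr0 addr0.
  apply: (@squeeze_cvgr _ _ _ _ (fun=> 0%R) (fun n => n.+1%:R^-1)%R).
  - apply: nearW => n; have [eu _ ->] := Pu n; rewrite andbT.
    exact: (ip_self_ge0 hausX lcX scX kerk).
  - exact: cvg_cst.
  - exact: cvg_harmonic.
have vu : vague_cvg \oo u zero_meas.
  by apply: strong_vague => //; apply: nearW => n; have [] := Pu n.
have [phi [c1 c2 phi01 phi1 _]] := compact_urysohn hausX lcX R cK openT (@subsetT _ K).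
have := vu phi c1 c2.
have -> : (\int[zero_meas]_x phi x)%R = 0%R :> R.
  by rewrite /Rintegral integral_measure_zero.
move=> /cvgrPdist_lt/(_ 1%R ltr01)[N _ /(_ N (leqnn N))] /=.
rewrite sub0r normrN; apply/negP; rewrite -leNgt.
have [[ru _] uK _] := Pu N.
apply: le_trans (ler_norm _).
have phi0 x : (0 <= phi x)%R by have /andP[] := phi01 x.
rewrite -lee_fin -(compact_support_integral hausX)// -uK.
rewrite -[in leLHS](setIT K) -(integral_indic _ measurableT mK).
apply: ge0_le_integral => //.
- by apply/measurable_EFinP; exact: measurable_indic.
- exact: continuous_measurable.
move=> x _; rewrite lee_fin indicE; case: (boolP (x \in K)) => // /set_mem Kx.
by rewrite phi1.
Qed.

End consistency.

(** * Balayage onto a compact set *)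

Section compact_balayage.
Context {R : realType} {X : ptopologicalType}.
Context (hausX : hausdorff_space X) (lcX : locally_compact [set: X]).
Context (scX : @second_countable X).
Context (kappa : X * X -> \bar R) (kerk : is_kernel kappa).
Context (energyk : energy_principle kappa) (consk : consistent kappa).
Context (domk : domination_principle kappa).
Implicit Types (mu nu rho omega : meas X R) (B N : set (borel X)) (K D E A : set X).

Local Opaque potential mutual_energy ip.
Local Notation U := (potential kappa).
Local Notation I2 := (mutual_energy kappa).
Local Notation Ep := (Eplus kappa).
Local Notation ipk := (ip kappa).
Local Notation d2 := (dist2 kappa).
Local Notation norm mu := (Num.sqrt (ip kappa mu mu)).

Let U0 mu x : 0 <= U mu x. Proof. exact: potential_ge0. Qed.
Let mU mu : radon mu -> measurable_fun [set: borel X] (U mu : borel X -> \bar R).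
Proof. by move=> rmu; exact: (potential_measurable hausX lcX scX kerk rmu). Qed.
Let I2E mu nu : radon mu -> radon nu -> I2 mu nu = \int[nu]_x U mu x.
Proof.
move=> rmu rnu; rewrite (mutual_energyC hausX lcX scX kerk)//.
exact: (mutual_energyE hausX lcX scX kerk).
Qed.
Let ipkE mu nu : Ep mu -> Ep nu -> I2 mu nu = (ipk mu nu)%:E.
Proof. exact: (ipE hausX lcX scX kerk energyk). Qed.
Let ipkC mu nu : radon mu -> radon nu -> ipk mu nu = ipk nu mu.
Proof. exact: (ipC hausX lcX scX kerk). Qed.
Let q0 mu : Ep mu -> (0 <= ipk mu mu)%R.
Proof. exact: (ip_self_ge0 hausX lcX scX kerk). Qed.

(** Balayage with the equality of potentials tested in mean, a form that passes
    to strong limits, together with the domination by [omega] that the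
    domination principle yields. *)
Definition swept omega A mu := [/\ Eplus_on kappa A mu,
  forall x, U mu x <= U omega x &
  forall nu, Eplus_on kappa A nu -> I2 mu nu = I2 omega nu].

Lemma Eplus_onD A mu nu : Eplus_on kappa A mu -> Eplus_on kappa A nu ->
  Eplus_on kappa A (addm mu nu).
Proof.
move=> [emu [B [mB muB AB]]] [enu [B' [mB' nuB' AB']]]; split.
  exact: (EplusD hausX lcX scX kerk energyk).
have mI := measurableI _ _ mB mB'; exists (B `&` B'); split=> //.
- rewrite addmE (subset_measure0 mI mB (@subIsetl _ _ _) muB).
  by rewrite (subset_measure0 mI mB' (@subIsetr _ _ _) nuB') adde0.
- by move=> x nAx; split; [exact: AB|exact: AB'].
Qed.

Lemma Eplus_onZ r A mu : Eplus_on kappa A mu -> Eplus_on kappa A (scalem r mu).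
Proof.
move=> [emu [B [mB muB AB]]]; split; first exact: EplusZ.
by exists B; split=> //; rewrite scalemE muB mule0.
Qed.

Lemma Eplus_onS E A mu : E `<=` A -> Eplus_on kappa E mu -> Eplus_on kappa A mu.
Proof. by move=> EA [emu c]; split=> //; exact: concentratedS c. Qed.

Lemma Eplus_on_restr A mu D (mD : measurable (D : set (borel X))) :
  Eplus_on kappa A mu -> Eplus_on kappa A (restrm mu mD).
Proof.
move=> [emu [B [mB muB AB]]]; split; first exact: Eplus_restr.
exists B; split=> //; apply/eqP; rewrite eq_le measure_ge0 andbT -muB.
exact: restrm_le.
Qed.

Lemma dominate A mu nu : measurable (A : set (borel X)) -> Eplus_on kappa A mu ->
  radon nu -> nearly_everywhere kappa A (fun x => U mu x <= U nu x) ->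
  forall x, U mu x <= U nu x.
Proof.
move=> mA emu rnu ne; apply: domk => //; first by case: emu.
have [[rmu _] _] := emu.
apply: (nearly_everywhere_ae hausX lcX scX kerk ne) => //.
by apply: measurable_not_le => //; exact: mU.
Qed.

Lemma swept_ip omega A mu nu : radon omega -> swept omega A mu -> Eplus_on kappa A nu ->
  ipk omega nu = ipk mu nu.
Proof. by move=> rom [_ _ h] enu; apply: ip_congr; rewrite h. Qed.

(** The test identity on compact subsets gives equality of the potentials nearly
    everywhere on [A]. The domination principle extends one inequality to all of
    [X], and integrating the equality extends the test to every measure of
    finite energy on [A]. *)
Lemma swept_intro omega A mu : measurable (A : set (borel X)) -> radon omega ->
  Eplus_on kappa A mu ->
  (forall K nu, compact K -> K `<=` A -> Eplus_on kappa K nu -> I2 mu nu = I2 omega nu) ->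
  swept omega A mu /\ nearly_everywhere kappa A (fun x => U mu x = U omega x).
Proof.
move=> mA rom emu h; have [[rmu _] _] := emu.
have fin K nu : compact K -> K `<=` A -> Eplus_on kappa K nu ->
    I2 mu nu < +oo /\ I2 omega nu < +oo.
  move=> cK KA enu; rewrite -(h K)//; split;
    apply: (mutual_energy_lty hausX lcX scX kerk energyk); by [case: emu|case: enu].
have ne1 : nearly_everywhere kappa A (fun x => U mu x <= U omega x).
  apply: (nearly_everywhere_le hausX lcX scX kerk) => //; try exact: mU.
  move=> K nu cK KA enu; have [[rnu _] _] := enu.
  have [] := fin K nu cK KA enu; have := h K nu cK KA enu.
  by rewrite !I2E// => ->.
have ne2 : nearly_everywhere kappa A (fun x => U omega x <= U mu x).
  apply: (nearly_everywhere_le hausX lcX scX kerk) => //; try exact: mU.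
  move=> K nu cK KA enu; have [[rnu _] _] := enu.
  have [] := fin K nu cK KA enu; have := h K nu cK KA enu.
  by rewrite !I2E// => ->.
have le := dominate mA emu rom ne1.
have ne : nearly_everywhere kappa A (fun x => U mu x = U omega x).
  apply: etrans ne2; congr (inner_capacity kappa _); apply/seteqP; split=> x [Ax nx]; split=> // e; apply: nx.
    by apply/eqP; rewrite eq_le le e.
  by rewrite e.
split=> //; split=> // nu enu; have [[rnu _] _] := enu.
rewrite !I2E//.
apply: (@ge0_ae_eq_integral _ (borel X) R nu setT) => //; try exact: mU.
have mN := measurable_neq mA (mU rmu) (mU rom).
have := nearly_everywhere_ae hausX lcX scX kerk ne mN enu.
by apply: negligibleS => x /= /not_implyP[].
Qed.

(** Measures on [K] do not distinguish the two potentials, so that these agree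
    nearly everywhere on [K], and the domination principle applies to [mu],
    which lives on [K]. *)
Lemma swept_compactS omega K mu A nu : compact K -> K `<=` A -> radon omega ->
  swept omega K mu -> swept omega A nu -> forall x, U mu x <= U nu x.
Proof.
move=> cK KA rom smu snu; have mK := compact_borel hausX cK.
have [emu _ hmu] := smu; have [enu _ hnu] := snu.
have [[rmu _] _] := emu; have [[rnu _] _] := enu.
apply: (dominate mK) => //.
apply: (nearly_everywhere_le hausX lcX scX kerk) => //; try exact: mU.
move=> K' rho cK' K'K erho; have [[rrho _] _] := erho.
rewrite -!I2E// hmu ?hnu//; [|exact: (Eplus_onS (subset_trans K'K KA))|exact: (Eplus_onS K'K)].
split=> //; rewrite -hmu; last exact: (Eplus_onS K'K).
apply: (mutual_energy_lty hausX lcX scX kerk energyk); by [case: emu|case: erho].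
Qed.

Lemma swept_unique omega A mu nu : swept omega A mu -> swept omega A nu -> meas_eq mu nu.
Proof.
move=> [emu _ hmu] [enu _ hnu]; have [Emu _] := emu; have [Enu _] := enu.
by apply: (ip_ext hausX lcX scX kerk energyk) => //; apply: ip_congr; rewrite hmu ?hnu.
Qed.

(** Pythagoras' theorem: [mu] is also the projection of [nu] onto the measures
    carried by [K]. *)
Lemma swept_dist2 omega K mu A nu : K `<=` A -> radon omega ->
  swept omega K mu -> swept omega A nu -> d2 nu mu = (ipk nu nu - ipk mu mu)%R.
Proof.
move=> KA rom smu snu; have [emu _ _] := smu; have [enu _ _] := snu.
have e1 := swept_ip rom smu emu; have e2 := swept_ip rom snu (Eplus_onS KA emu).
rewrite /dist2 -e2 e1.
move: (ipk nu nu) (ipk mu mu) => a b; ring.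
Qed.

(** The projection theorem on the closed convex cone of measures carried by [K],
    for the linear form [ip omega]. This form need not come from an element of
    the space; it is only bounded and upper semicontinuous. The Gauss functional
    [G] is bounded below, its minimizing sequences are Cauchy, and the first
    variation at the minimizer gives the inequality in the direction of [nu]
    and, by scaling [mu], the last equality. *)
Lemma gauss_minimizer omega K : closed K -> radon omega ->
  (forall nu, Eplus_on kappa K nu -> I2 omega nu < +oo) ->
  (exists b, forall nu, Eplus_on kappa K nu -> (ipk omega nu <= b * norm nu)%R) ->
  (forall (u : nat -> meas X R) nu, (forall n, Eplus_on kappa K (u n)) ->
    Eplus_on kappa K nu -> d2 (u n) nu @[n --> \oo] --> (0 : R)%R ->
    forall e : R, (0 < e)%R -> \forall n \near \oo, (ipk omega (u n) <= ipk omega nu + e)%R) ->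
  exists mu, [/\ Eplus_on kappa K mu,
    forall nu, Eplus_on kappa K nu -> (ipk omega nu <= ipk mu nu)%R &
    ipk mu mu = ipk omega mu].
Proof.
move=> clK rom fin [b hb] usc.
pose G mu := (ipk mu mu - 2 * ipk omega mu)%R.
pose Q := Eplus_on kappa K.
have omE nu : Q nu -> I2 omega nu = (ipk omega nu)%:E.
  move=> qnu; have [[rnu _] _] := qnu.
  by apply: (ipE_lty hausX lcX scX kerk) => //; exact: fin.
have omD mu nu : Q mu -> Q nu -> ipk omega (addm mu nu) = (ipk omega mu + ipk omega nu)%R.
  move=> qmu qnu; have [[rmu _] _] := qmu; have [[rnu _] _] := qnu.
  apply: EFin_inj; rewrite EFinD -!omE ?(mutual_energyDr hausX lcX scX kerk)//.
  exact: Eplus_onD.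
have omZ r mu : Q mu -> ipk omega (scalem r mu) = (r%:num * ipk omega mu)%R.
  move=> qmu; have [[rmu _] _] := qmu.
  apply: EFin_inj; rewrite EFinM -!omE ?(mutual_energyZr hausX lcX scX kerk)//.
  exact: Eplus_onZ.
have Glb mu : Q mu -> (- b ^+ 2 <= G mu)%R.
  move=> qmu; have := hb _ qmu; rewrite /G; have [emu _] := qmu.
  rewrite -{2}(sqr_sqrtr (q0 emu)).
  move: (norm mu) (ipk omega mu) => a c h; have := sqr_ge0 (a - b)%R.
  rewrite sqrrB; move: h; nra.
have Q0 : Q zero_meas.
  split; first exact: Eplus0.
  by exists setT; split.
pose S := [set G mu | mu in Q].
have hS : has_inf S.
  split; first by exists (G zero_meas); exists zero_meas.
  by exists (- b ^+ 2)%R => _ [mu qmu <-]; exact: Glb.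
pose m := inf S.
have mG mu : Q mu -> (m <= G mu)%R.
  by move=> qmu; apply: ge_inf; [case: hS|exists mu].
have half0 : (0 <= (1/2 : R))%R by rewrite divr_ge0.
(* The parallelogram law, with the midpoint of [mu] and [nu] as a competitor. *)
have par mu nu : Q mu -> Q nu -> (d2 mu nu <= 2 * (G mu - m) + 2 * (G nu - m))%R.
  move=> qmu qnu; have [emu _] := qmu; have [enu _] := qnu.
  have [[rmu _] [rnu _]] := conj emu enu.
  have qD := Eplus_onD qmu qnu; have [eD _] := qD.
  have qZ := Eplus_onZ (NngNum half0) qD.
  have [eZ _] := qZ; have := mG _ qZ; rewrite /G omZ// omD//.
  rewrite (ipZl hausX lcX scX kerk energyk)//.
  rewrite (ipZr hausX lcX scX kerk energyk)//=.
  rewrite !(ipDl hausX lcX scX kerk energyk)// !(ipDr hausX lcX scX kerk energyk)//.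
  rewrite /dist2 (ipkC rnu rmu).
  move: (ipk mu mu) (ipk mu nu) (ipk nu nu) (ipk omega mu) (ipk omega nu) => a1 a2 a3 a4 a5.
  lra.
have /choice[u Pu] : forall n : nat, exists u, Q u /\ (G u < m + n.+1%:R^-1)%R.
  move=> n; have [|_ [u qu <-] lt] := @inf_adherent _ S n.+1%:R^-1%R _ hS; first by rewrite invr_gt0.
  by exists u.
have [||mu emu dmu] := strong_complete hausX lcX scX kerk energyk consk (u := u).
- by move=> n; have [[]] := Pu n.
- move=> e e0; have [N hN] : exists N : nat, (N.+1%:R^-1 < e / 4)%R.
    have [N _ /(_ N (leqnn N)) hN] : \forall N \near \oo, (N.+1%:R^-1 < e / 4)%R.
      exact: (near_infty_natSinv_lt (PosNum (divr_gt0 e0 _))).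
    by exists N.
  have inv n : (N <= n)%N -> (n.+1%:R^-1 <= N.+1%:R^-1 :> R)%R.
    by move=> Nn; rewrite lef_pV2 ?posrE// ler_nat ltnS.
  exists N => p q Np Nq; have [qp Gp] := Pu p; have [qq Gq] := Pu q.
  have := par _ _ qp qq; have := inv _ Np; have := inv _ Nq.
  move: (d2 _ _) (G (u p)) (G (u q)) hN Gp Gq.
  move: (N.+1%:R^-1)%R (p.+1%:R^-1)%R (q.+1%:R^-1)%R => *; lra.
have qu n : Q (u n) by have [] := Pu n.
have qmu : Q mu by exact: (strong_limit_concentrated hausX lcX scX kerk energyk consk clK qu).
have Gmu : (G mu <= m)%R.
  apply/ler_addgt0Pr => e e0.
  have e4 : (0 < e / 4)%R by rewrite divr_gt0.
  have eu : \forall n \near \oo, Ep (u n) by apply: nearW => n; have [] := qu n.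
  have /cvgrPdist_lt/(_ _ e4) h1 : ipk (u n) (u n) @[n --> \oo] --> ipk mu mu.
    exact: (strong_cvg_norm hausX lcX scX kerk energyk).
  have h2 := usc u mu qu qmu dmu _ e4.
  have h3 : \forall N \near \oo, (N.+1%:R^-1 < e / 4)%R.
    exact: (near_infty_natSinv_lt (PosNum e4)).
  have [N _ /(_ N (leqnn N)) [[]]] := filterI (filterI h1 h2) h3.
  move=> /(le_lt_trans (ler_norm _)); have [_] := Pu N; rewrite /G /=.
  move: (N.+1%:R^-1)%R.
  move: (ipk mu mu) (ipk (u N) (u N)) (ipk omega (u N)) (ipk omega mu) => *; lra.
have qG nu : Q nu -> (G mu <= G nu)%R by move=> /mG; exact: le_trans.
have [[rmu _] _] := qmu.
have var nu : Q nu -> (ipk omega nu <= ipk mu nu)%R.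
  move=> qnu; have [enu _] := qnu; have [rnu _] := enu.
  rewrite leNgt; apply/negP => lt.
  pose d := (ipk omega nu - ipk mu nu)%R.
  have d0 : (0 < d)%R by rewrite subr_gt0.
  (* For this [t] the quadratic term of [G (mu + t nu)] is at most half of the
     linear gain. *)
  pose t := (d / (ipk nu nu + 1))%R.
  have q1 : (0 < ipk nu nu + 1)%R by rewrite ltr_wpDl// q0.
  have t0 : (0 < t)%R by rewrite divr_gt0.
  have tq : (t * ipk nu nu <= d)%R.
    by rewrite mulrAC ler_pdivrMr// ler_wpM2l ?lerDl// ltW.
  have qZ := Eplus_onZ (NngNum (ltW t0)) qnu; have [eZ _] := qZ.
  have := qG _ (Eplus_onD qmu qZ).
  rewrite /G omD// omZ//=.
  have eD : Ep (addm mu (scalem (NngNum (ltW t0)) nu)).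
    by have [] := Eplus_onD qmu qZ.
  rewrite !(ipDl hausX lcX scX kerk energyk)// !(ipDr hausX lcX scX kerk energyk)//.
  rewrite !(ipZl hausX lcX scX kerk energyk)// !(ipZr hausX lcX scX kerk energyk)//=.
  rewrite (ipkC rnu rmu).
  move: tq d0; rewrite /d; move: t t0 {q1 lt qZ eZ eD} => t t0.
  move: (ipk mu mu) (ipk mu nu) (ipk nu nu) (ipk omega mu) (ipk omega nu) => a1 a2 a3 a4 a5.
  nra.
exists mu; split; [exact: qmu|exact: var|].
apply/eqP; rewrite eq_le (var _ qmu) andbT leNgt; apply/negP => lt.
pose d := (ipk mu mu - ipk omega mu)%R.
have d0 : (0 < d)%R by rewrite subr_gt0.
have om0 : (0 <= ipk omega mu)%R by exact: (ip_ge0 hausX lcX scX kerk).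
have qmu0 : (0 < ipk mu mu)%R by exact: le_lt_trans lt.
(* The multiple [t mu] minimizes [G] on the ray of [mu]. *)
pose t := (1 - d / ipk mu mu)%R.
have td : (t * ipk mu mu = ipk omega mu)%R.
  rewrite /t /d mulrBl mul1r divfK ?gt_eqF//.
  by move: (ipk mu mu) (ipk omega mu) => a1 a2; ring.
have t0 : (0 <= t)%R.
  by rewrite -(pmulr_lge0 _ qmu0) td.
have qZ := Eplus_onZ (NngNum t0) qmu; have [eZ _] := qZ.
have := qG _ qZ; rewrite /G omZ//.
rewrite !(ipZl hausX lcX scX kerk energyk)// !(ipZr hausX lcX scX kerk energyk)//=.
have t1 : (0 < 1 - t)%R by rewrite /t subKr divr_gt0.
have : (0 < (1 - t) * ((1 - t) * ipk mu mu))%R by rewrite !mulr_gt0.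
rewrite -td; move: (ipk mu mu) => a1; move: t {t0 qZ eZ td t1} => t; nra.
Qed.

(** The minimizer satisfies the test inequality and equality against itself, so
    equality against each part of itself. Hence it does not charge the set where
    its potential exceeds that of [omega], and the domination principle turns
    this into a bound on [X], which upgrades the test inequality to an equality. *)
Lemma compact_swept omega K : compact K -> radon omega ->
  (forall nu, Eplus_on kappa K nu -> I2 omega nu < +oo) ->
  (exists b, forall nu, Eplus_on kappa K nu -> (ipk omega nu <= b * norm nu)%R) ->
  (forall (u : nat -> meas X R) nu, (forall n, Eplus_on kappa K (u n)) ->
    Eplus_on kappa K nu -> d2 (u n) nu @[n --> \oo] --> (0 : R)%R ->
    forall e : R, (0 < e)%R -> \forall n \near \oo, (ipk omega (u n) <= ipk omega nu + e)%R) ->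
  exists mu, swept omega K mu.
Proof.
move=> cK rom fin hb usc; have mK := compact_borel hausX cK.
have [mu [qmu var eq]] := gauss_minimizer (compact_closed hausX cK) rom fin hb usc.
have [emu _] := qmu; have [rmu _] := emu.
have omE nu : Eplus_on kappa K nu -> I2 omega nu = (ipk omega nu)%:E.
  move=> qnu; have [[rnu _] _] := qnu.
  by apply: (ipE_lty hausX lcX scX kerk) => //; exact: fin.
pose N := [set x | U omega x < U mu x] : set (borel X).
have mN : measurable N.
  by rewrite -[X in measurable X]setTI; apply: emeasurable_fun_lt => //; exact: mU.
have mNc := measurableC mN.
have q1 := Eplus_on_restr mN qmu; have q2 := Eplus_on_restr mNc qmu.
have [e1 _] := q1; have [e2 _] := q2; have [r1 _] := e1; have [r2 _] := e2.
have muN : mu N = 0.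
  have split_eq nu : radon nu -> I2 nu mu = I2 nu (restrm mu mN) + I2 nu (restrm mu mNc).
    move=> rnu; rewrite -(mutual_energyDr hausX lcX scX kerk)//.
    exact: (mutual_energy_meas_eq hausX lcX scX kerk) (restrm_split mu mN mNc).
  have h1 : ipk mu mu = (ipk mu (restrm mu mN) + ipk mu (restrm mu mNc))%R.
    by apply: EFin_inj; rewrite EFinD -!ipkE//; exact: split_eq.
  have h2 : ipk omega mu = (ipk omega (restrm mu mN) + ipk omega (restrm mu mNc))%R.
    by apply: EFin_inj; rewrite EFinD -!omE//; exact: split_eq.
  have h : ipk mu (restrm mu mN) = ipk omega (restrm mu mN).
    move: h1 h2 (var _ q1) (var _ q2) eq.
    move: (ipk mu mu) (ipk omega mu) (ipk mu (restrm mu mN)) (ipk mu (restrm mu mNc)).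
    move: (ipk omega (restrm mu mN)) (ipk omega (restrm mu mNc)) => *; lra.
  have h' : I2 mu (restrm mu mN) = I2 omega (restrm mu mN) by rewrite omE// ipkE// h.
  move: h'; rewrite !I2E// !integral_restrm//; try exact: mU.
  move=> h'; apply: (@integral_lt_null _ _ mu N (U mu) (U omega)) => //; try exact: mU.
    rewrite -integral_restrm//; last exact: mU.
    by rewrite -I2E// omE// ltry.
  by rewrite h'.
have le : forall x, U mu x <= U omega x.
  apply: domk => //; exists N; split=> // x /= /negP; by rewrite -ltNge.
exists mu; split=> // nu qnu; have [enu _] := qnu; have [rnu _] := enu.
apply/eqP; rewrite eq_le; apply/andP; split.
  by rewrite !I2E//; apply: ge0_le_integral => //; exact: mU.
by rewrite omE// ipkE// lee_fin var.
Qed.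

Lemma Eplus_compact_swept sigma K : Ep sigma -> compact K -> exists mu, swept sigma K mu.
Proof.
move=> es cK; have [rs _] := es; apply: compact_swept => //.
- by move=> nu [enu _]; exact: (mutual_energy_lty hausX lcX scX kerk energyk).
- exists (norm sigma) => nu [enu _].
  have := cauchy_schwarz0 hausX lcX scX kerk energyk es enu.
  have [rnu _] := enu; have i0 := ip_ge0 hausX lcX scX kerk rs rnu.
  have n0 : (0 <= norm sigma * norm nu)%R by rewrite mulr_ge0 ?sqrtr_ge0.
  rewrite -(ler_pXn2r (n := 2) _ i0 n0)// exprMn !sqr_sqrtr ?q0//.
- move=> u nu qu [enu _] h e e0.
  have eu : \forall n \near \oo, Ep (u n) by apply: nearW => n; have [] := qu n.
  have /cvgrPdist_lt/(_ _ e0) : ipk (u n) sigma @[n --> \oo] --> ipk nu sigma.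
    exact: (strong_cvg_ip hausX lcX scX kerk energyk).
  apply: filterS => n; have [[ru _] _] := qu n; have [rnu _] := enu.
  rewrite (ipkC ru rs) (ipkC rnu rs) distrC => /(le_lt_trans (ler_norm _)).
  move: (ipk sigma nu) (ipk sigma (u n)) => *; lra.
Qed.

(** Cauchy-Schwarz for the identity [ip sigma mu = ip mu mu]. *)
Lemma swept_energy_le sigma A mu : Ep sigma -> swept sigma A mu ->
  (ipk mu mu <= ipk sigma sigma)%R.
Proof.
move=> es smu; have [qmu _ _] := smu; have [emu _] := qmu; have [rs _] := es.
have := cauchy_schwarz0 hausX lcX scX kerk energyk es emu.
rewrite (swept_ip rs smu qmu) expr2.
have := q0 emu; rewrite le_eqVlt => /orP[/eqP<- _|h]; first exact: q0.
by rewrite ler_pM2r.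
Qed.

End compact_balayage.

(** * Existence of the balayage *)

Section balayage_existence.
Context {R : realType} {X : ptopologicalType}.
Context (hausX : hausdorff_space X) (lcX : locally_compact [set: X]).
Context (scX : @second_countable X).
Context (kappa : X * X -> \bar R) (kerk : is_kernel kappa).
Context (energyk : energy_principle kappa) (consk : consistent kappa).
Context (domk : domination_principle kappa).
Implicit Types (mu nu rho omega : meas X R) (B : set (borel X)) (K D E A : set X).

Local Opaque potential mutual_energy ip.
Local Notation U := (potential kappa).
Local Notation I2 := (mutual_energy kappa).
Local Notation Ep := (Eplus kappa).
Local Notation ipk := (ip kappa).
Local Notation d2 := (dist2 kappa).
Local Notation norm mu := (Num.sqrt (ip kappa mu mu)).

Let U0 mu x : 0 <= U mu x. Proof. exact: potential_ge0. Qed.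
Let mU mu : radon mu -> measurable_fun [set: borel X] (U mu : borel X -> \bar R).
Proof. by move=> rmu; exact: (potential_measurable hausX lcX scX kerk rmu). Qed.
Let I2E mu nu : radon mu -> radon nu -> I2 mu nu = \int[nu]_x U mu x.
Proof.
move=> rmu rnu; rewrite (mutual_energyC hausX lcX scX kerk)//.
exact: (mutual_energyE hausX lcX scX kerk).
Qed.
Let q0 mu : Ep mu -> (0 <= ipk mu mu)%R.
Proof. exact: (ip_self_ge0 hausX lcX scX kerk). Qed.

Section bounded_potential.
Context (omega : meas X R) (K : set X) (C : R).
Context (cK : compact K) (rom : radon omega) (C0 : (0 <= C)%R).
Context (UC : forall x, K x -> U omega x <= C%:E).

Let mK : measurable (K : set (borel X)). Proof. exact: compact_borel. Qed.

Lemma bounded_mutual_energy nu : Eplus_on kappa K nu -> I2 omega nu <= C%:E * nu K.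
Proof.
move=> [[rnu _] cnu]; rewrite I2E// (integral_concentrated mK)//; last exact: mU.
rewrite -(@integral_cst _ (borel X))//; apply: ge0_le_integral => //.
by apply: measurable_funTS; exact: mU.
Qed.

Lemma bounded_mutual_energy_lty nu : Eplus_on kappa K nu -> I2 omega nu < +oo.
Proof.
move=> enu; apply: le_lt_trans (bounded_mutual_energy enu) _; have [[rnu _] _] := enu.
have [fK _] := (radonP hausX nu).1 rnu.
by rewrite lte_mul_pinfty ?fK// lee_fin.
Qed.

Lemma bounded_ip : exists b, forall nu, Eplus_on kappa K nu -> (ipk omega nu <= b * norm nu)%R.
Proof.
have [b b0 hb] := compact_mass_bound hausX lcX scX kerk energyk consk cK.
exists (C * b)%R => nu enu; have [[rnu Enu] _] := enu.
rewrite -lee_fin -(ipE_lty hausX lcX scX kerk)//; last exact: bounded_mutual_energy_lty.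
apply: le_trans (bounded_mutual_energy enu) _.
by rewrite -mulrA EFinM; apply: lee_pmul => //; rewrite ?lee_fin//; exact: hb.
Qed.

Context (usc : lower_semicontinuous (fun x : subspace K => - U omega x)).

(* This extension of [C - U omega] by [+oo] outside [K] is nonnegative and lower
   semicontinuous on all of [X], which makes it amenable to vague descent. *)
Let g x : \bar R := if `[< K x >] then C%:E - U omega x else +oo.

Let fU x : K x -> U omega x \is a fin_num.
Proof. by move=> Kx; rewrite ge0_fin_numE//; apply: le_lt_trans (UC Kx) (ltry _). Qed.

Let g0 x : 0 <= g x.
Proof. by rewrite /g; case: asboolP => // Kx; rewrite sube_ge0 ?fU// UC. Qed.

Let lg : lower_semicontinuous g.
Proof.
move=> x a; rewrite {1}/g; case: asboolP => Kx; last first.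
  move=> _; exists (~` K).
    apply: open_nbhs_nbhs; split=> //; apply: closed_openC; exact: compact_closed.
  by move=> y nKy; rewrite /g; case: asboolP => // _; rewrite ltry.
have shift y : K y -> (a%:E < C%:E - U omega y) = ((a - C)%:E < - U omega y).
  move=> Ky; rewrite -(fineK (fU Ky)) -EFinB -EFinN !lte_fin.
  by apply/idP/idP; lra.
rewrite shift// => /usc[V]; rewrite /= => Vx VU.
have [W Wx WV] : exists2 W, nbhs (x : X) W & forall y, W y -> K y -> V y.
  have Vx' : within K (nbhs (x : X)) V by rewrite (nbhs_subspace_in Kx).
  by exists [set y | K y -> V y].
exists W => // y Wy; rewrite /g; case: asboolP => [Ky|_]; last exact: ltry.
by rewrite shift//; apply: VU; exact: WV.
Qed.

Let integral_g nu : Eplus_on kappa K nu ->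
  \int[nu]_x g x = (C * fine (nu K) - ipk omega nu)%:E.
Proof.
move=> enu; have [[rnu Enu] cnu] := enu.
have mg := lsc_measurable lg.
rewrite (integral_concentrated mK)//.
have s : \int[nu]_(x in K) g x + \int[nu]_(x in K) U omega x = C%:E * nu K.
  rewrite -(@ge0_integralD _ (borel X))//.
  - rewrite -(@integral_cst _ (borel X))//; apply: eq_integral => x /set_mem Kx.
    by rewrite /g; case: asboolP => // _; rewrite subeK// fU.
  - exact: measurable_funTS.
  - by apply: measurable_funTS; exact: mU.
have e : \int[nu]_(x in K) U omega x = I2 omega nu.
  by rewrite I2E// (integral_concentrated mK)//; exact: mU.
move: s; rewrite e (ipE_lty hausX lcX scX kerk)//; last exact: bounded_mutual_energy_lty.
rewrite -(fineK (radon_fin_num hausX rnu cK)) -EFinM /=.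
case: (integral _ _ _) => [r| |]// [<-].
by congr (_%:E); move: (ipk omega nu) => a; ring.
Qed.

(** The masses [u n K] converge, while the integrals of [C - U omega] can only
    drop in the vague limit; the integrals of [U omega] are the difference of
    the two. *)
Lemma bounded_ip_usc (u : nat -> meas X R) nu : (forall n, Eplus_on kappa K (u n)) ->
  Eplus_on kappa K nu -> d2 (u n) nu @[n --> \oo] --> (0 : R)%R ->
  forall e : R, (0 < e)%R -> \forall n \near \oo, (ipk omega (u n) <= ipk omega nu + e)%R.
Proof.
move=> eu enu h e e0.
have ru : \forall n \near \oo, radon (u n) by apply: nearW => n; have [[]] := eu n.
have [[rnu Enu] cnu] := enu.
have vu : vague_cvg \oo u nu.
  apply: (strong_vague hausX lcX scX kerk energyk consk) => //.
  by apply: nearW => n; have [] := eu n.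
have [phi [c1 c2 phi01 phi1 _]] := compact_urysohn hausX lcX R cK openT (@subsetT _ K).
have phi0 x : (0 <= phi x)%R by have /andP[] := phi01 x.
have mass m : Eplus_on kappa K m -> (\int[m]_x phi x)%R = fine (m K).
  move=> [[rm _] cm]; apply: EFin_inj; rewrite -(compact_support_integral hausX)//.
  rewrite fineK ?(radon_fin_num hausX)//.
  rewrite (integral_concentrated mK)//; last exact: continuous_measurable.
  transitivity (\int[m]_(x in K) (cst 1) x); last by rewrite integral_cst// mul1e.
  by apply: eq_integral => x /set_mem Kx; rewrite phi1.
have e2 : (0 < e / 2)%R by rewrite divr_gt0.
have C1 : (0 < C + 1)%R by rewrite ltr_wpDl.
have e3 : (0 < e / 2 / (C + 1))%R by rewrite divr_gt0.
have /cvgrPdist_lt/(_ _ e3) h1 := vu phi c1 c2.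
have h2 : \forall n \near \oo, (C * fine (nu K) - ipk omega nu - e / 2)%:E < \int[u n]_x g x.
  apply: (vague_descent hausX lcX scX ru rnu vu g0 lg).
  by rewrite integral_g// lte_fin ltrBlDr ltrDl.
apply: filterS2 h1 h2 => n; rewrite mass// mass// integral_g// lte_fin.
rewrite distrC => /(le_lt_trans (ler_norm _)); rewrite ltr_pdivlMr//.
have arith (a1 a2 a3 a4 : R) : ((a4 - a3) * (C + 1) < e / 2 ->
    C * a3 - a1 - e / 2 < C * a4 - a2 -> a2 <= a1 + e)%R.
  move=> h1' h2'; suff : (C * (a4 - a3) <= e / 2)%R by move: h2'; lra.
  have [a34|a34] := leP 0%R (a4 - a3)%R.
    by apply: le_trans (ltW h1'); rewrite mulrC ler_wpM2l// lerDl.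
  by apply: (@le_trans _ _ 0%R); [rewrite mulr_ge0_le0// ltW|exact: ltW].
exact: arith.
Qed.

Lemma bounded_swept : exists mu, swept kappa omega K mu.
Proof.
apply: (compact_swept hausX lcX scX kerk energyk consk domk) => //.
- exact: bounded_mutual_energy_lty.
- exact: bounded_ip.
- exact: bounded_ip_usc.
Qed.

End bounded_potential.

Context (ugak : ugaheri_principle kappa).

Lemma admissible_compact_swept A omega K : radon omega -> admissible kappa A omega ->
  compact K -> K `<=` A -> exists mu, swept kappa omega K mu.
Proof.
move=> rom adm cK KA; case: adm => [eom|[omT usc [C UC]]].
  exact: (Eplus_compact_swept hausX lcX scX kerk energyk consk domk).
apply: (@bounded_swept omega K (Num.max 0 C)%R) => //.
- by rewrite le_max lexx.
- by move=> x /KA/UC/le_trans; apply; rewrite lee_fin le_max lexx orbT.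
- exact: usc.
Qed.

(** When [omega] has infinite energy, Ugaheri's principle bounds the potential
    of the swept measure on all of [X] by a multiple of the bound of [U omega]
    on [A], and the energy of the swept measure is the integral of its potential
    against the finite measure [omega]. *)
Lemma admissible_energy_bound A omega : radon omega -> admissible kappa A omega ->
  exists b, forall K mu, compact K -> K `<=` A -> swept kappa omega K mu ->
    (ipk mu mu <= b)%R.
Proof.
move=> rom [eom|[omT usc [C UC]]].
  exists (ipk omega omega) => K mu cK KA smu.
  exact: (swept_energy_le hausX lcX scX kerk energyk eom smu).
have [M M1 ug] := ugak; pose c := (Num.max 1 C)%R.
have c0 : (0 < c)%R by rewrite lt_max ltr01.
exists (M * c * fine (omega setT))%R => K mu cK KA smu.
have [qmu le _] := smu; have [emu cmu] := qmu; have [rmu _] := emu.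
have Umu x : U mu x <= (M * c)%:E.
  apply: ug => //; apply: negligibleS cmu => y /= ny Ky; apply: ny.
  apply: le_trans (le y) _; apply: le_trans (UC _ (KA _ Ky)) _.
  by rewrite lee_fin le_max lexx orbT.
rewrite -(swept_ip rom smu qmu) -lee_fin.
rewrite -(ipE_lty hausX lcX scX kerk)//; last first.
  have [_ _ <-//] := smu.
  by apply: (mutual_energy_lty hausX lcX scX kerk energyk).
rewrite (mutual_energyC hausX lcX scX kerk)// I2E//.
have fT : omega setT \is a fin_num by rewrite ge0_fin_numE.
apply: (@le_trans _ _ (\int[omega]_x (cst (M * c)%:E) x)).
  by apply: ge0_le_integral => //; exact: mU.
by rewrite integral_cst// -{1}(fineK fT) -EFinM.
Qed.

Context (A : set X) (mA : measurable (A : set (borel X))).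
Context (closA : strongly_closed kappa (Eplus_on kappa A)).

(** The energies of the measures swept onto compact subsets of [A] increase and
    are bounded. As squared distances are differences of energies, these
    measures converge strongly along a sequence of compact sets whose energies
    tend to the supremum, and the limit stays on [A] by strong closedness. The
    third conclusion is what convergence along all compact subsets of [A] will
    require. *)
Lemma swept_exists omega : radon omega -> admissible kappa A omega ->
  exists mu, [/\ swept kappa omega A mu,
    nearly_everywhere kappa A (fun x => U mu x = U omega x) &
    forall e : R, (0 < e)%R -> exists K, [/\ compact K, K `<=` A &
      forall nu, swept kappa omega K nu -> (ipk mu mu - e < ipk nu nu)%R]].
Proof.
move=> rom adm; have [b hb] := admissible_energy_bound rom adm.
have /choice[w Pw] : forall K, exists mu, compact K -> K `<=` A -> swept kappa omega K mu.
  move=> K; have [[cK KA]|h] := pselect (compact K /\ K `<=` A).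
    by have [mu smu] := admissible_compact_swept rom adm cK KA; exists mu.
  by exists zero_meas => cK KA; exfalso; apply: h.
pose E K := ipk (w K) (w K).
pose good K := compact K /\ K `<=` A.
have sw K : good K -> swept kappa omega K (w K) by case; exact: Pw.
have Ew K : good K -> Ep (w K) by move=> /sw[[]].
have dE K K' : good K -> good K' -> K `<=` K' -> d2 (w K') (w K) = (E K' - E K)%R.
  by move=> gK gK' KK'; exact: (swept_dist2 KK' rom (sw _ gK) (sw _ gK')).
have Emono K K' : good K -> good K' -> K `<=` K' -> (E K <= E K')%R.
  move=> gK gK' KK'; rewrite -subr_ge0 -(dE _ _ gK gK' KK').
  by apply: (dist2_ge0 hausX lcX scX kerk energyk); exact: Ew.
have g0 : good set0 by split; [exact: compact0|].
pose S := [set E K | K in good].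
have hS : has_sup S.
  split; first by exists (E set0); exists set0.
  by exists b => _ [K [cK KA] <-]; apply: (hb K) => //; exact: Pw.
pose s := sup S.
have Es K : good K -> (E K <= s)%R.
  by move=> gK; apply: ub_le_sup; [case: hS|exists K].
have /choice[Kc PKc] : forall n : nat, exists K, good K /\ (s - n.+1%:R^-1 < E K)%R.
  move=> n; have [|_ [K gK <-] lt] := @sup_adherent _ S n.+1%:R^-1%R _ hS.
    by rewrite invr_gt0.
  by exists K.
pose H n := \big[setU/set0]_(i < n.+1) Kc i.
have gH n : good (H n).
  split; first by apply: bigsetU_compact => i _; have [[]] := PKc i.
  by move=> x; rewrite /H -bigcup_mkord => -[i _]; have [[_ +] _] := PKc i; apply.
have incH m n : (m <= n)%N -> H m `<=` H n by move=> mn; exact: (@subset_bigsetU _ Kc).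
have EH n : (s - n.+1%:R^-1 < E (H n))%R.
  have [gK /lt_le_trans] := PKc n; apply; apply: Emono => //.
  by move=> x Kx; rewrite /H -bigcup_mkord; exists n => //=.
have small (e : R) : (0 < e)%R -> exists N : nat, forall n, (N <= n)%N -> (n.+1%:R^-1 < e)%R.
  move=> e0; have [N _ hN] := near_infty_natSinv_lt (PosNum e0).
  by exists N => n /hN.
have [||mu emu dmu] := strong_complete hausX lcX scX kerk energyk consk (u := w \o H).
- by move=> n; exact: Ew.
- move=> e /small[N hN]; exists N.
  have key m n : (N <= m)%N -> (m <= n)%N -> (d2 (w (H n)) (w (H m)) < e)%R.
    move=> Nm mn; rewrite dE//; last exact: incH.
    have := EH m; have := Es _ (gH n); have := hN _ Nm.
    move: (m.+1%:R^-1)%R (E (H n)) (E (H m)) => *; lra.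
  move=> m n Nm Nn /=; have [mn|nm] := leqP m n; last exact/key/ltnW.
  rewrite (dist2C hausX lcX scX kerk); [exact: key| |].
    by have [] := Ew _ (gH m).
  by have [] := Ew _ (gH n).
have eH : \forall n \near \oo, Ep (w (H n)) by apply: nearW => n; exact: Ew.
have qmu : Eplus_on kappa A mu.
  have [rmu Emu] := emu; have r0 := @radon0 R X hausX.
  have [] := closA (u := w \o H) (mu := pos_signed mu); last by [].
  - by move=> n; have [qw _ _] := sw _ (gH n); apply: Eplus_onS qw; have [] := gH n.
  - have sE : energy_pos kappa (pos_signed mu) (pos_signed mu) = (ipk mu mu)%:E.
      rewrite /energy_pos /= (ipE hausX lcX scX kerk energyk emu emu).
      by rewrite (mutual_energy0 hausX lcX scX kerk r0) adde0.
    have sN : energy_neg kappa (pos_signed mu) (pos_signed mu) = 0.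
      rewrite /energy_neg /= (mutual_energyC hausX lcX scX kerk r0 rmu).
      by rewrite !(mutual_energy0 hausX lcX scX kerk rmu) adde0.
    split.
    + by split=> //=; exists setT; rewrite setCT measure0; split.
    + by rewrite /energy_defined sE sN oppe0.
    + by rewrite /signed_energy sE sN sube0.
  - by apply/(strong_cvgP hausX lcX scX kerk energyk).
have [rmu _] := emu.
(* Adding a fixed [K] to [H n] changes the energy by at most [1 / n.+1], so the
   measures swept onto [K] united with [H n] have the same limit, and they
   satisfy the test identity for measures carried by [K]. *)
have lim K nu : good K -> Eplus_on kappa K nu -> I2 mu nu = I2 omega nu.
  move=> gK enu; have [cK KA] := gK; have [Enu _] := enu; have [rnu _] := Enu.
  pose V n := K `|` H n.
  have gV n : good (V n).
    split; first by apply: compactU => //; have [] := gH n.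
    by rewrite subUset; split=> //; have [] := gH n.
  have ipV n : ipk (w (V n)) nu = ipk omega nu.
    rewrite (swept_ip rom (sw _ (gV n)))//; apply: Eplus_onS enu; exact: subsetUl.
  have omfin : I2 omega nu < +oo.
    have [_ _ <-//] := sw _ gK.
    by apply: (mutual_energy_lty hausX lcX scX kerk energyk) => //; exact: Ew.
  suff e : ipk mu nu = ipk omega nu.
    rewrite (ipE hausX lcX scX kerk energyk)// e.
    by rewrite (ipE_lty hausX lcX scX kerk).
  have l1 : ipk (w (H n)) nu @[n --> \oo] --> ipk mu nu.
    exact: (strong_cvg_ip hausX lcX scX kerk energyk).
  have l2 : ipk (w (H n)) nu @[n --> \oo] --> ipk omega nu.
    apply/cvgrPdist_le => e e0.
    have e1 : (0 < e ^+ 2 / (ipk nu nu + 1))%R.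
      by rewrite divr_gt0 ?exprn_gt0// ltr_wpDl// q0.
    have [N hN] := small _ e1; exists N => // n /= Nn.
    rewrite -(ipV n) -(@ler_pXn2r _ 2)// ?nnegrE ?(ltW e0)// real_normK ?num_real//.
    apply: le_trans (cauchy_schwarz hausX lcX scX kerk energyk (Ew _ (gV n)) (Ew _ (gH n)) Enu) _.
    rewrite dE//; last exact: subsetUr.
    have le : (E (V n) - E (H n) <= e ^+ 2 / (ipk nu nu + 1))%R.
      have := EH n; have := Es _ (gV n); have := hN _ Nn.
      move: (n.+1%:R^-1)%R (E (V n)) (E (H n)) (e ^+ 2 / _)%R => *; lra.
    apply: (@le_trans _ _ (e ^+ 2 / (ipk nu nu + 1) * ipk nu nu)%R).
      by apply: ler_wpM2r le; exact: q0.
    rewrite mulrAC ler_pdivrMr ?ltr_wpDl ?q0// ler_wpM2l ?sqr_ge0//.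
    by rewrite lerDl.
  exact: (cvg_unique (@Rhausdorff R) l1 l2).
have [|smu ne] := swept_intro hausX lcX scX kerk energyk domk mA rom qmu.
  by move=> K nu cK KA; exact: lim.
exists mu; split=> // e e0.
have lE : E (H n) @[n --> \oo] --> ipk mu mu.
  exact: (strong_cvg_norm hausX lcX scX kerk energyk).
have /cvgrPdist_lt/(_ _ e0)[N _ /(_ N (leqnn N)) hN] := lE.
exists (H N); have [cH HA] := gH N; split=> // nu snu.
have [[Enu _] _ _] := snu; have [rnu _] := Enu.
have -> : ipk nu nu = E (H N).
  have meq := swept_unique hausX lcX scX kerk energyk snu (sw _ (gH N)).
  exact: (ip_meas_eq hausX lcX scX kerk).
have := le_lt_trans (ler_norm _) hN; move: (ipk mu mu) (E (H N)) => *; lra.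
Qed.

End balayage_existence.

(** * Outer extensions of strongly subadditive set functions *)

Section choquet_outer.
Context {R : realType} {X : ptopologicalType} (h : set X -> R).
Implicit Types (D E : set X).
Context (h0 : forall D, open D -> (0 <= h D)%R).
Context (hS : forall D1 D2, open D1 -> open D2 -> D1 `<=` D2 -> (h D1 <= h D2)%R).
Context (hUI : forall D1 D2, open D1 -> open D2 ->
  (h (D1 `|` D2) + h (D1 `&` D2) <= h D1 + h D2)%R).
Context (hup : forall (D : nat -> set X) t, (forall n, open (D n)) ->
  (forall m n, (m <= n)%N -> D m `<=` D n) ->
  (t < h (\bigcup_n D n))%R -> exists n, (t < h (D n))%R).

Definition outer_extension E : R := inf [set h D | D in [set D | open D /\ E `<=` D]].

Lemma outer_extension_has_inf E : has_inf [set h D | D in [set D | open D /\ E `<=` D]].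
Proof.
split; first by exists (h setT); exists setT => //; split=> //; exact: openT.
by exists 0%R => _ [D [oD _] <-]; exact: h0.
Qed.

Lemma outer_extension_le E D : open D -> E `<=` D -> (outer_extension E <= h D)%R.
Proof. by move=> oD ED; apply: ge_inf; [case: (outer_extension_has_inf E)|exists D]. Qed.

Lemma outer_extension_open D : open D -> outer_extension D = h D.
Proof.
move=> oD; apply/eqP; rewrite eq_le outer_extension_le//=.
apply: lb_le_inf; first by case: (outer_extension_has_inf D).
by move=> _ [D' [oD' DD'] <-]; exact: hS.
Qed.

Lemma outer_extension_ge0 E : (0 <= outer_extension E)%R.
Proof.
apply: lb_le_inf; first by case: (outer_extension_has_inf E).
by move=> _ [D' [oD' DD'] <-]; exact: h0.
Qed.

Lemma outer_extensionS E1 E2 : E1 `<=` E2 -> (outer_extension E1 <= outer_extension E2)%R.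
Proof.
move=> E12; apply: lb_le_inf; first by case: (outer_extension_has_inf E2).
by move=> _ [D [oD ED] <-]; apply: outer_extension_le => //; exact: subset_trans ED.
Qed.

Lemma outer_extension_adherent E e : (0 < e)%R ->
  exists D, [/\ open D, E `<=` D & (h D < outer_extension E + e)%R].
Proof.
move=> e0; have [_ [D [oD ED] <-] lt] := inf_adherent e0 (outer_extension_has_inf E).
by exists D.
Qed.

(** Choose open sets [D n] almost optimal for [E n], with summable errors.
    Strong subadditivity shows by induction that the union [G n] of the first
    ones is almost optimal for [E n] as well. *)
Lemma outer_extension_up (E : nat -> set X) t :
  (forall m n, (m <= n)%N -> E m `<=` E n) ->
  (t < outer_extension (\bigcup_n E n))%R -> exists n, (t < outer_extension (E n))%R.
Proof.
move=> incE; apply: contraPP => /forallNP nE; apply/negP; rewrite -leNgt.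
have {}nE n : (outer_extension (E n) <= t)%R by rewrite leNgt; apply/negP; exact: nE.
apply/ler_addgt0Pr => e e0.
pose p n : R := (e * (1/2) ^+ n.+1)%R.
have p0 n : (0 < p n)%R by rewrite mulr_gt0// exprn_gt0// divr_gt0.
have /choice[D PD] n := outer_extension_adherent (E n) (p0 n).
have oD n : open (D n) by have [] := PD n.
pose G := fix G n := if n is m.+1 then G m `|` D m.+1 else D 0%N.
have oG n : open (G n) by elim: n => [|n IH] //=; exact: openU.
have DG n : D n `<=` G n by case: n => [|n] //=; exact: subsetUr.
have incG m n : (m <= n)%N -> G m `<=` G n.
  elim: n => [|n IH]; first by rewrite leqn0 => /eqP->.
  rewrite leq_eqVlt => /orP[/eqP->//|]; rewrite ltnS => /IH mn.
  by apply: subset_trans mn _; exact: subsetUl.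
(* The errors up to rank [n] add up to [e - p n]. *)
have hG n : (h (G n) <= outer_extension (E n) + (e - p n))%R.
  elim: n => [|n IH].
    have [_ _ /ltW] := PD 0%N; rewrite /= /p expr1.
    move: (h (D 0%N)) (outer_extension _) => a b; lra.
  have /= := hUI (oG n) (oD n.+1).
  have := outer_extension_le (openI (oG n) (oD n.+1)) (_ : E n `<=` _).
  have EI : E n `<=` G n `&` D n.+1.
    rewrite subsetI; split.
      by apply: subset_trans (DG n); have [] := PD n.
    by apply: subset_trans (incE _ _ (leqnSn n)) _; have [] := PD n.+1.
  move=> /(_ EI); have [_ _] := PD n.+1; move: IH; rewrite /p !exprS.
  move: (_ ^+ n)%R (h (G n)) (h (D n.+1)) (h (G n `|` D n.+1)) (h (_ `&` _)).
  move: (outer_extension (E n)) (outer_extension (E n.+1)) => *; lra.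
apply: (@le_trans _ _ (h (\bigcup_n G n))).
  apply: outer_extension_le; first by apply: bigcup_open => n _.
  move=> x [n _ Ex]; exists n => //; apply: DG; have [_ + _] := PD n; exact.
rewrite leNgt; apply/negP => /(hup oG incG)[n].
apply/negP; rewrite -leNgt; apply: le_trans (hG n) _.
by apply: lerD; [exact: nE|rewrite gerBl ltW].
Qed.

End choquet_outer.

(** * Borel sets of inner capacity zero *)

Section outer_null_sets.
Context {R : realType} {X : ptopologicalType}.
Context (hausX : hausdorff_space X) (lcX : locally_compact [set: X]).
Context (scX : @second_countable X).
Context (kappa : X * X -> \bar R) (kerk : is_kernel kappa).
Context (energyk : energy_principle kappa) (consk : consistent kappa).
Context (domk : domination_principle kappa).
Implicit Types (mu nu rho sigma : meas X R) (B : set (borel X)) (K D E A : set X).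

Local Opaque potential mutual_energy ip.
Local Notation U := (potential kappa).
Local Notation I2 := (mutual_energy kappa).
Local Notation Ep := (Eplus kappa).
Local Notation ipk := (ip kappa).
Local Notation d2 := (dist2 kappa).
Local Notation norm mu := (Num.sqrt (ip kappa mu mu)).

Let U0 mu x : 0 <= U mu x. Proof. exact: potential_ge0. Qed.
Let mU mu : radon mu -> measurable_fun [set: borel X] (U mu : borel X -> \bar R).
Proof. by move=> rmu; exact: (potential_measurable hausX lcX scX kerk rmu). Qed.
Let I2E mu nu : radon mu -> radon nu -> I2 mu nu = \int[nu]_x U mu x.
Proof.
move=> rmu rnu; rewrite (mutual_energyC hausX lcX scX kerk)//.
exact: (mutual_energyE hausX lcX scX kerk).
Qed.
Let q0 mu : Ep mu -> (0 <= ipk mu mu)%R.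
Proof. exact: (ip_self_ge0 hausX lcX scX kerk). Qed.

Lemma compact_bigcup_inc K (D : nat -> set X) : compact K -> (forall n, open (D n)) ->
  (forall m n, (m <= n)%N -> D m `<=` D n) -> K `<=` \bigcup_n D n ->
  exists n, K `<=` D n.
Proof.
move=> cK oD incD KD; have := cK; rewrite compact_near_coveringP => /(_ nat \oo).
move=> /(_ (fun n x => D n x) _)[|N _ hN].
  move=> x /KD[n _ Dx]; exists (D n, [set m | (n <= m)%N]) => /=.
    by split; [apply: open_nbhs_nbhs|exists n].
  by move=> [y m] /= [Dy nm]; exact: incD Dy.
by exists N => x Kx; apply: (hN N) => /=.
Qed.

Section fixed_measure.
Context (sigma : meas X R) (es : Ep sigma).

Let rs : radon sigma. Proof. by case: es. Qed.

Let sw_ex K : compact K -> exists mu, swept kappa sigma K mu.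
Proof. exact: (Eplus_compact_swept hausX lcX scX kerk energyk consk domk). Qed.

Lemma swept_energyS K K' mu mu' : K `<=` K' ->
  swept kappa sigma K mu -> swept kappa sigma K' mu' -> (ipk mu mu <= ipk mu' mu')%R.
Proof.
move=> KK' s1 s2; rewrite -subr_ge0 -(swept_dist2 KK' rs s1 s2).
by apply: (dist2_ge0 hausX lcX scX kerk energyk); [case: s2 => -[]|case: s1 => -[]].
Qed.

(** Strong subadditivity holds for the potentials: tested on [K1], the
    potentials of the measures swept onto the union and onto [K1] agree, and
    that of the intersection is below that of [K2]; likewise on [K2]. By the
    domination principle the inequality holds on [X], and integrating against
    [sigma] turns potentials into energies. *)
Lemma swept_energyUI K1 K2 a b c d : compact K1 -> compact K2 ->
  swept kappa sigma (K1 `|` K2) a -> swept kappa sigma (K1 `&` K2) b ->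
  swept kappa sigma K1 c -> swept kappa sigma K2 d ->
  (ipk a a + ipk b b <= ipk c c + ipk d d)%R.
Proof.
move=> c1 c2 sa sb sc sd.
have mK1 := compact_borel hausX c1; have mK2 := compact_borel hausX c2.
have mU12 : measurable (K1 `|` K2 : set (borel X)) by exact: measurableU.
have cI : compact (K1 `&` K2) by apply: compact_closedI => //; exact: compact_closed.
have [[ea ca] _ ha] := sa; have [[eb cb] _ hb] := sb.
have [[ec cc] _ hc] := sc; have [[ed cd] _ hd] := sd.
have [ra _] := ea; have [rb _] := eb; have [rc _] := ec; have [rd _] := ed.
have bc := swept_compactS hausX lcX scX kerk energyk domk cI (@subIsetl _ K1 K2) rs sb sc.
have bd := swept_compactS hausX lcX scX kerk energyk domk cI (@subIsetr _ K1 K2) rs sb sd.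
have eab : Eplus_on kappa (K1 `|` K2) (addm a b).
  apply: (Eplus_onD hausX lcX scX kerk energyk) => //.
  by split=> //; apply: concentratedS cb => x []; left.
have ecd := EplusD hausX lcX scX kerk energyk ec ed.
have [[rab _] _] := eab; have [rcd _] := ecd.
have Uadd m n x : U (addm m n) x = U m x + U n x.
  exact: (potential_addm scX kerk).
have I2le m n nu : radon m -> radon n -> radon nu -> (forall x, U m x <= U n x) -> I2 m nu <= I2 n nu.
  by move=> rm rn rnu le; rewrite !I2E//; apply: ge0_le_integral => //; exact: mU.
have le : forall x, U (addm a b) x <= U (addm c d) x.
  apply: (dominate hausX lcX scX kerk domk mU12 eab rcd).
  apply: (nearly_everywhere_le hausX lcX scX kerk) => //; try exact: mU.
  move=> K nu cK KU enu; have [Enu cnu] := enu; have [rnu _] := Enu.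
  have mKc1 := measurableC mK1.
  have e1 := Eplus_on_restr hausX lcX scX kerk mK1 enu.
  have e2 := Eplus_on_restr hausX lcX scX kerk mKc1 enu.
  pose n1 := restrm nu mK1; pose n2 := restrm nu mKc1.
  have E1 : Eplus_on kappa K1 n1 by split; [case: e1|exact: concentrated_restr].
  have E2 : Eplus_on kappa K2 n2.
    split; first by case: e2.
    apply/concentratedP => //.
    rewrite restrmE -setCU setUC; apply: measure_negligible; first exact: measurableC.
    by apply: negligibleS cnu; exact: subsetC.
  have [[r1 _] _] := E1; have [[r2 _] _] := E2.
  have sp m : radon m -> I2 m nu = I2 m n1 + I2 m n2.
    move=> rm; rewrite -(mutual_energyDr hausX lcX scX kerk)//.
    exact: (mutual_energy_meas_eq hausX lcX scX kerk) (restrm_split nu mK1 mKc1).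
  rewrite -!I2E//; split; first by apply: (mutual_energy_lty hausX lcX scX kerk energyk).
  rewrite !sp// !(mutual_energyDl hausX lcX scX kerk)//.
  apply: leeD.
    rewrite hc// ha; last by apply: (Eplus_onS _ E1); exact: subsetUl.
    by apply: leeD => //; exact: I2le.
  rewrite hd// ha; last by apply: (Eplus_onS _ E2); exact: subsetUr.
  by rewrite [leRHS]addeC; apply: leeD => //; exact: I2le.
have := I2le _ _ _ rab rcd rs le.
rewrite !(mutual_energyDl hausX lcX scX kerk)// !(ipE hausX lcX scX kerk energyk)//.
have sq m K : swept kappa sigma K m -> ipk m sigma = ipk m m.
  move=> sm; have [qm _ _] := sm; have [[rm _] _] := qm.
  by rewrite (ipC hausX lcX scX kerk rm rs) (swept_ip rs sm qm).
by rewrite (sq _ _ sa) (sq _ _ sb) (sq _ _ sc) (sq _ _ sd) -!EFinD lee_fin.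
Qed.

Definition inner_swept_energy D : R :=
  sup [set ipk mu mu | mu in [set mu | exists2 K, compact K /\ K `<=` D & swept kappa sigma K mu]].

Local Notation h := inner_swept_energy.

Lemma inner_swept_has_sup D : has_sup
  [set ipk mu mu | mu in [set mu | exists2 K, compact K /\ K `<=` D & swept kappa sigma K mu]].
Proof.
split.
  have [mu smu] := sw_ex compact0; exists (ipk mu mu); exists mu => //; exists set0 => //.
  by split; [exact: compact0|].
exists (ipk sigma sigma) => _ [mu [K _ smu] <-].
exact: (swept_energy_le hausX lcX scX kerk energyk es smu).
Qed.

Lemma inner_swept_ge D K mu : compact K -> K `<=` D -> swept kappa sigma K mu ->
  (ipk mu mu <= h D)%R.
Proof.
move=> cK KD smu; apply: ub_le_sup; first by case: (inner_swept_has_sup D).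
by exists mu => //; exists K.
Qed.

Lemma inner_swept_gt D t : (t < h D)%R -> exists K mu,
  [/\ compact K, K `<=` D, swept kappa sigma K mu & (t < ipk mu mu)%R].
Proof.
move=> /sup_gt[|_ [mu [K [cK KD] smu] <-] lt]; last by exists K, mu.
by case: (inner_swept_has_sup D).
Qed.

Lemma inner_swept_le D t : (forall K mu, compact K -> K `<=` D -> swept kappa sigma K mu ->
  (ipk mu mu <= t)%R) -> (h D <= t)%R.
Proof.
move=> ht; rewrite leNgt; apply/negP => /inner_swept_gt[K [mu [cK KD smu]]].
by apply/negP; rewrite -leNgt; exact: (ht K).
Qed.

Lemma inner_swept_ge0 D : (0 <= h D)%R.
Proof.
have [mu smu] := sw_ex compact0; apply: (@le_trans _ _ (ipk mu mu)).
  by apply: q0; case: smu => -[].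
by apply: (@inner_swept_ge D set0) => //; exact: compact0.
Qed.

Lemma inner_sweptS D1 D2 : D1 `<=` D2 -> (h D1 <= h D2)%R.
Proof.
move=> D12; apply: inner_swept_le => K mu cK KD; apply: inner_swept_ge => //.
exact: subset_trans D12.
Qed.

(** A compact subset of the union splits along [D1] and [D2]; adding a compact
    subset of the intersection to both pieces brings the claim back to
    [swept_energyUI]. *)
Lemma inner_sweptUI D1 D2 : open D1 -> open D2 ->
  (h (D1 `|` D2) + h (D1 `&` D2) <= h D1 + h D2)%R.
Proof.
move=> o1 o2; rewrite -lerBrDr; apply: inner_swept_le => K a cK KD sa.
rewrite lerBrDr addrC -lerBrDr; apply: inner_swept_le => K' b cK' KD' sb.
rewrite lerBrDr addrC.
have [K1 [K2 [c1 c2 KD1 KD2 KE]]] := compact_split hausX lcX cK o1 o2 KD.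
have c1' := compactU c1 cK'; have c2' := compactU c2 cK'.
have cU := compactU c1' c2'.
have cI : compact ((K1 `|` K') `&` (K2 `|` K')).
  by apply: compact_closedI => //; exact: compact_closed.
have [a' sa'] := sw_ex cU; have [b' sb'] := sw_ex cI.
have [c sc] := sw_ex c1'; have [d sd] := sw_ex c2'.
apply: (@le_trans _ _ (ipk a' a' + ipk b' b')%R).
  apply: lerD.
    by apply: (swept_energyS _ sa sa'); rewrite KE => x []; [left; left|right; left].
  by apply: (swept_energyS _ sb sb') => x ?; split; right.
apply: (@le_trans _ _ (ipk c c + ipk d d)%R).
  exact: (swept_energyUI c1' c2' sa' sb' sc sd).
apply: lerD.
  by apply: (inner_swept_ge c1') => //; rewrite subUset; split=> // x /KD'[].
by apply: (inner_swept_ge c2') => //; rewrite subUset; split=> // x /KD'[].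
Qed.

Lemma inner_swept_up (D : nat -> set X) t : (forall n, open (D n)) ->
  (forall m n, (m <= n)%N -> D m `<=` D n) ->
  (t < h (\bigcup_n D n))%R -> exists n, (t < h (D n))%R.
Proof.
move=> oD incD /inner_swept_gt[K [mu [cK KD smu tmu]]].
have [n Kn] := compact_bigcup_inc cK oD incD KD.
by exists n; apply: lt_le_trans tmu _; exact: (inner_swept_ge cK Kn smu).
Qed.

(** Continuity from above on compact sets. The measures swept onto a decreasing
    sequence [H n] of compact neighbourhoods of [K] with intersection [K] have
    decreasing energies, hence converge strongly; the limit is carried by [K]
    and passes the test of the measure swept onto [K]. *)
Lemma compact_inner_swept K t mu : compact K -> (forall D, open D -> K `<=` D -> (t <= h D)%R) ->
  swept kappa sigma K mu -> (t <= ipk mu mu)%R.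
Proof.
move=> cK ht smu; have clK := compact_closed hausX cK.
have [F [cF incF FE]] := open_sigma_compact hausX lcX scX (closed_openC clK).
have /choice[L PL] n : exists L, [/\ compact L, K `<=` L° & L `<=` ~` F n].
  apply: (compact_nbhd hausX lcX cK).
    by apply: closed_openC; exact: compact_closed.
  by move=> x Kx Fx; have : (\bigcup_n F n) x; [exists n|rewrite FE].
pose H := fix H n := if n is m.+1 then H m `&` L m.+1 else L 0%N.
have HL n : H n `<=` L n by case: n => [|n] //=; exact: subIsetr.
have cH n : compact (H n).
  elim: n => [|n IH] /=; first by have [] := PL 0%N.
  by apply: compact_closedI => //; apply: compact_closed => //; have [] := PL n.+1.
have KH n : K `<=` (H n)°.
  elim: n => [|n IH] /=; first by have [] := PL 0%N.
  by rewrite interiorI subsetI; split=> //; have [] := PL n.+1.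
have decH m n : (m <= n)%N -> H n `<=` H m.
  elim: n => [|n IH]; first by rewrite leqn0 => /eqP->.
  rewrite leq_eqVlt => /orP[/eqP->//|]; rewrite ltnS => /IH mn.
  by apply: subset_trans mn; exact: subIsetl.
have /choice[u su] n := sw_ex (cH n).
have eu n : Ep (u n) by have [[]] := su n.
have tu n : (t <= ipk (u n) (u n))%R.
  apply: (@le_trans _ _ (h (H n)°)); first by apply: ht => //; exact: open_interior.
  apply: inner_swept_le => K' nu cK' K'H snu.
  by apply: (swept_energyS _ snu (su n)); apply: subset_trans K'H (@interior_subset _ _).
pose S := range (fun n => ipk (u n) (u n)).
have hS : has_inf S.
  by split; [exists (ipk (u 0%N) (u 0%N)); exists 0%N|exists 0%R => _ [n _ <-]; exact: q0].
have [||tau et dt] := strong_complete hausX lcX scX kerk energyk consk (u := u) => //.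
  move=> e e0; have [_ [N _ <-] hN] := inf_adherent e0 hS.
  exists N.
  have key m n : (N <= m)%N -> (m <= n)%N -> (d2 (u m) (u n) < e)%R.
    move=> Nm mn; rewrite (swept_dist2 (decH _ _ mn) rs (su n) (su m)).
    have l1 : (inf S <= ipk (u n) (u n))%R.
      by apply: ge_inf; [case: hS|exists n].
    have l2 : (ipk (u m) (u m) <= ipk (u N) (u N))%R.
      exact: (swept_energyS (decH _ _ Nm) (su m) (su N)).
    move: l1 l2 hN; move: (ipk (u m) (u m)) (ipk (u n) (u n)) (ipk (u N) (u N)) (inf S) => *; lra.
  move=> m n Nm Nn; have [mn|nm] := leqP m n; first exact: key.
  rewrite (dist2C hausX lcX scX kerk); [exact/key/ltnW| |].
    by have [] := eu m.
  by have [] := eu n.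
have eu' : \forall n \near \oo, Ep (u n) by apply: nearW.
have [rt _] := et.
have tK : Eplus_on kappa K tau.
  split=> //.
  have tH m : tau.-negligible (~` H m).
    have := @strong_limit_concentrated _ _ hausX lcX scX kappa kerk energyk consk
      (fun n => u (n + m)%N) tau (H m).
    case=> //.
    - exact: compact_closed.
    - move=> n; have [qn _ _] := su (n + m)%N; apply: Eplus_onS qn.
      by apply: decH; exact: leq_addl.
    - by rewrite (cvg_shiftn m (fun n => d2 (u n) tau)).
  apply: negligibleS (negligible_bigcup tH) => x nKx.
  have : (\bigcup_n F n) x by rewrite FE.
  by move=> [n _ Fx]; exists n => // /HL Lx; have [_ _ /(_ _ Lx)] := PL n.
have tb : meas_eq tau mu.
  have [qmu _ _] := smu; have [emu _] := qmu; have [rmu _] := emu.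
  have key nu : Eplus_on kappa K nu -> ipk tau nu = ipk mu nu.
    move=> qnu; have [enu _] := qnu.
    have l1 : ipk (u n) nu @[n --> \oo] --> ipk tau nu.
      exact: (strong_cvg_ip hausX lcX scX kerk energyk).
    have l2 : ipk (u n) nu @[n --> \oo] --> ipk mu nu.
      rewrite (_ : (fun n => _) = (fun=> ipk mu nu)); first exact: cvg_cst.
      apply/funext => n; rewrite -(swept_ip rs smu qnu) -(swept_ip rs (su n))//.
      by apply: Eplus_onS qnu; apply: subset_trans (KH n) (@interior_subset _ _).
    exact: (cvg_unique (@Rhausdorff R) l1 l2).
  by apply: (ip_ext hausX lcX scX kerk energyk) => //; rewrite key.
have <- : ipk tau tau = ipk mu mu by exact: (ip_meas_eq hausX lcX scX kerk).
have l1 : ipk (u n) (u n) @[n --> \oo] --> ipk tau tau.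
  exact: (strong_cvg_norm hausX lcX scX kerk energyk).
rewrite -(cvg_lim (@Rhausdorff R) l1); apply: limr_ge.
  by apply/cvg_ex; exists (ipk tau tau).
exact: nearW.
Qed.

(** Otherwise capacitability yields a compact subset of [N] onto which [sigma]
    is swept with positive energy, although measures of finite energy do not
    charge [N]. *)
Lemma null_outer_extension N : measurable (N : set (borel X)) ->
  inner_capacity kappa N = 0 -> outer_extension h N = 0%R.
Proof.
move=> mN N0; apply/eqP; rewrite eq_le outer_extension_ge0 ?andbT; last first.
  by move=> D _; exact: inner_swept_ge0.
have hS : forall D1 D2, open D1 -> open D2 -> D1 `<=` D2 -> (h D1 <= h D2)%R.
  by move=> D1 D2 _ _; exact: inner_sweptS.
have h0 : forall D, open D -> (0 <= h D)%R by move=> D _; exact: inner_swept_ge0.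
rewrite leNgt; apply/negP => gN.
pose t := (outer_extension h N / 2)%R.
have t0 : (0 < t)%R by rewrite divr_gt0.
have tN : t%:E < (outer_extension h N)%:E.
  by rewrite lte_fin /t ltr_pdivrMr// mulr_natr mulr2n ltrDl.
have [||K [cK KN hK]] := capacitability hausX lcX scX
    (C := fun E => (outer_extension h E)%:E) _ _ mN tN.
- by move=> E1 E2 E12; rewrite lee_fin; exact: outer_extensionS.
- move=> F incF; rewrite lte_fin => tF.
  have [n tn] := outer_extension_up h0 inner_sweptUI inner_swept_up incF tF.
  by exists n; rewrite lte_fin.
have [mu smu] := sw_ex cK.
have : (t <= ipk mu mu)%R.
  apply: (compact_inner_swept cK _ smu) => D oD KD.
  by have := hK D oD KD; rewrite lte_fin (outer_extension_open h0 hS oD) => /ltW.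
have [[emu cmu] _ _] := smu; have [rmu _] := emu.
have mK := compact_borel hausX cK.
have muK : mu K = 0.
  have := (inner_capacity0P hausX lcX scX kerk mN).1 N0 mu emu.
  exact: subset_measure0 mK mN KN.
have mu0 : meas_eq mu zero_meas.
  move=> B mB; apply/eqP; rewrite /zero_meas/= /mzero eq_le measure_ge0 andbT.
  rewrite -muK -(concentrated_setT mK cmu); exact: measureS.
rewrite (ip_meas_eq hausX lcX scX kerk rmu rmu mu0 mu0).
rewrite (ip_zero hausX lcX scX kerk); last exact: radon0.
by rewrite leNgt t0.
Qed.

End fixed_measure.

(** Otherwise the Dirac measure at [x] would be a nonzero measure of energy 0. *)
Lemma kernel_diag_gt0 x : 0 < kappa (x, x).
Proof.
rewrite lt_neqAle kernel_ge0// andbT; apply/negP => /eqP k0.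
have rd := radon_dirac hausX x : radon (diracm x : meas X R).
have E : I2 (diracm x) (diracm x) = 0.
  rewrite I2E// integral_dirac//; last exact: mU.
  rewrite diracT mul1e; rewrite potentialE integral_dirac//; last first.
    exact: (kernel_section_measurable scX kerk).
  by rewrite diracT mul1e -k0.
have ed : Ep (diracm x) by split=> //; rewrite /energy E ltry.
have d0 : d2 (diracm x) zero_meas = 0%R.
  rewrite /dist2 !(ip_zero hausX lcX scX kerk)//; last exact: radon0.
  rewrite mulr0 subr0 addr0; apply: EFin_inj.
  by rewrite -(ipE hausX lcX scX kerk energyk).
have := dist2_eq0 hausX lcX scX kerk energyk ed (Eplus0 hausX lcX scX kerk) d0 measurableT.
rewrite diracmE mem_set//= /zero_meas /= /mzero => /eqP; rewrite eqe.
by rewrite oner_eq0.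
Qed.

(** The open sets on which capacity is controlled by swept energies: see
    [tame_null_cover]. *)
Definition tame D := (forall mu, Ep mu -> mu D = 0) \/
  exists sigma c, [/\ Ep sigma, (0 < c)%R & forall y, D y -> c%:E <= U sigma y].

(** By lower semicontinuity the kernel exceeds some [c > 0] on a square [D * D]
    around [(x, x)]. If a measure of finite energy charges [D], its restriction
    to a compact part of [D] has a potential bounded below on [D]. *)
Lemma tame_nbhd x : exists D, [/\ open D, D x & tame D].
Proof.
have [c c0 cx] : exists2 c : R, (0 < c)%R & c%:E < kappa (x, x).
  have := kernel_diag_gt0 x; case: (kappa (x, x)) => [r| |]//.
    rewrite lte_fin => r0; exists (r / 2)%R; first by rewrite divr_gt0.
    by rewrite lte_fin ltr_pdivrMr// mulr_natr mulr2n ltrDl.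
  by move=> _; exists 1%R => //; rewrite ltry.
have [_ _ lsck] := kerk.
have [Z [[V W] [Vx Wx] VWZ] hZ] := lsck (x, x) c cx.
pose D := (V `&` W)°.
have oD : open D by exact: open_interior.
have Dx : D x by exact: filterI.
exists D; split=> //.
have [h|/existsNP[mu /not_implyP[emu /eqP muD]]] := pselect (forall mu, Ep mu -> mu D = 0).
  by left.
right; have [rmu _] := emu; have mD := open_borel oD.
have muD0 : 0 < mu D by rewrite lt_neqAle eq_sym muD measure_ge0.
have [K [cK KD muK]] := ((radonP hausX mu).1 rmu).2 _ _ mD muD0.
have mK := compact_borel hausX cK; have fK := radon_fin_num hausX rmu cK.
exists (restrm mu mK), (c * fine (mu K))%R; split.
- exact: Eplus_restr.
- by rewrite mulr_gt0// fine_gt0// muK -ge0_fin_numE.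
move=> y Dy; rewrite EFinM fineK//.
have mk := kernel_section_measurable scX kerk y.
rewrite potentialE integral_restrm//; last by move=> z; exact: kernel_ge0.
rewrite -(@integral_cst _ (borel X))//; apply: ge0_le_integral => //.
- by move=> z _; rewrite lee_fin ltW.
- exact: measurable_funTS.
- move=> z Kz; apply/ltW/hZ/VWZ.
  by split; [have [] := interior_subset Dy|have [] := interior_subset (KD _ Kz)].
Qed.

(** Let [G] be an open set around [N] with small swept energy for [sigma]. For a
    compact subset [K] of [G] in [D] and [w] swept from [sigma] onto [K], the
    mass of [K] satisfies [c * mu K <= ip sigma mu_K = ip w mu_K], and
    Cauchy-Schwarz bounds this by the norms of [w], which is small, and of [mu]. *)
Lemma tame_null_cover D N s : open D -> tame D -> measurable (N : set (borel X)) ->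
  inner_capacity kappa N = 0 -> (0 < s)%R -> exists D', [/\ open D', N `&` D `<=` D' &
    forall mu, Ep mu -> mu D' <= (s * norm mu)%:E].
Proof.
move=> oD [D0|[sigma [c [es c0 cU]]]] mN N0 s0.
  exists D; split=> [//||mu emu]; first exact: subIsetr.
  by rewrite D0// lee_fin mulr_ge0 ?sqrtr_ge0// ltW.
have h0 : forall D, open D -> (0 <= inner_swept_energy sigma D)%R.
  by move=> D' _; exact: inner_swept_ge0.
have e0 : (0 < (c * s) ^+ 2)%R by rewrite exprn_gt0// mulr_gt0.
have [G [oG NG hG]] := outer_extension_adherent h0 N e0.
rewrite null_outer_extension// add0r in hG.
exists (G `&` D); split; first exact: openI.
  by move=> x [/NG].
move=> mu emu; have [rmu _] := emu; have mGD := open_borel (openI oG oD).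
rewrite rmu.2//; apply: ge_ereal_sup => _ [K [cK KGD] <-].
have mK := compact_borel hausX cK; have fK := radon_fin_num hausX rmu cK.
have [w sw] := Eplus_compact_swept hausX lcX scX kerk energyk consk domk es cK.
have [[ew cw] _ hw] := sw; have [rs _] := es.
have er := Eplus_restr hausX lcX scX kerk mK emu; have [rr _] := er.
have qr : Eplus_on kappa K (restrm mu mK) by split=> //; exact: concentrated_restr.
have w_le : (ipk w w <= (c * s) ^+ 2)%R.
  apply: ltW; apply: le_lt_trans hG; apply: (inner_swept_ge es cK _ sw).
  by move=> x /KGD[].
have cmu : (c%:E * mu K <= I2 sigma (restrm mu mK)).
  rewrite I2E// integral_restrm//; last exact: mU.
  rewrite -(@integral_cst _ (borel X))//; apply: ge0_le_integral => //.
  - by move=> x _; rewrite lee_fin ltW.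
  - by apply: measurable_funTS; exact: mU.
  - by move=> x /KGD[_ /cU].
have cs : (ipk w (restrm mu mK) <= c * s * norm mu)%R.
  have cs0 := mulr_gt0 c0 s0.
  have [rw _] := ew.
  have i0 := ip_ge0 hausX lcX scX kerk rw rr.
  have n0 : (0 <= c * s * norm mu)%R by rewrite mulr_ge0 ?sqrtr_ge0// ltW.
  rewrite -(ler_pXn2r (n := 2) _ i0 n0)//.
  apply: le_trans (cauchy_schwarz0 hausX lcX scX kerk energyk ew er) _.
  rewrite exprMn sqr_sqrtr ?q0//; apply: ler_pM => //; try exact: q0.
  exact: (restr_ip_le hausX lcX scX kerk energyk mK emu).
move: cmu; rewrite -(fineK fK) -EFinM -hw// (ipE hausX lcX scX kerk energyk)// !lee_fin.
move=> /le_trans/(_ cs); rewrite -mulrA ler_pM2l//.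
Qed.

(** The tame basic open sets cover [X]; the open sets covering [N] in each of
    them are united, with errors that sum to [e]. *)
Lemma inner_null_outer_null N : measurable (N : set (borel X)) ->
  inner_capacity kappa N = 0 -> outer_capacity kappa N = 0.
Proof.
move=> mN N0; apply: (outer_null hausX lcX scX kerk energyk) => e e0.
have [b [bo bn]] := second_countable_seq scX.
have p0 n : (0 < e / (2 ^ n.+1)%:R)%R by rewrite divr_gt0// ltr0n expn_gt0.
have tameS D D' : D' `<=` D -> open D -> open D' -> tame D -> tame D'.
  move=> D'D oD oD' [D0|[sigma [c [es c0 cU]]]]; last first.
    by right; exists sigma, c; split=> // y /D'D/cU.
  left=> mu emu; apply/eqP; rewrite eq_le measure_ge0 andbT -(D0 _ emu).
  by apply: measureS => //; exact: open_borel.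
have /choice[G PG] n : exists G, [/\ open G, tame (b n) -> N `&` b n `<=` G &
    forall mu, Ep mu -> mu G <= (e / (2 ^ n.+1)%:R * norm mu)%:E].
  have [tb|ntb] := pselect (tame (b n)).
    by have [G [oG NG hG]] := tame_null_cover (bo n) tb mN N0 (p0 n); exists G.
  exists set0; split=> //; first exact: open0.
  by move=> mu emu; rewrite measure0 lee_fin mulr_ge0 ?sqrtr_ge0// ltW.
exists (\bigcup_n G n); split.
- by apply: bigcup_open => n _; have [] := PG n.
- move=> x Nx; have [D [oD Dx tD]] := tame_nbhd x.
  have [n [bx bD]] := bn _ _ (open_nbhs_nbhs (conj oD Dx)).
  exists n => //; have [_ + _] := PG n; apply; last by split.
  exact: tameS tD.
move=> mu emu.
have mG n : measurable (G n : set (borel X)) by apply: open_borel; have [] := PG n.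
apply: (@le_trans _ _ (\sum_(0 <= n <oo) mu (G n))).
  by apply: measure_sigma_subadditive => //; exact: bigcup_measurable.
apply: (@le_trans _ _ (\sum_(0 <= n <oo) (e * norm mu / (2 ^ n.+1)%:R)%:E)).
  apply: lee_nneseries => // n _; have [_ _ /(_ _ emu)] := PG n.
  by rewrite mulrAC.
by apply: epsilon_trick0; rewrite mulr_ge0 ?sqrtr_ge0// ltW.
Qed.

End outer_null_sets.

(** * Characterizations of the balayage *)

Section characterizations.
Context {R : realType} {X : ptopologicalType}.
Context (hausX : hausdorff_space X) (lcX : locally_compact [set: X]).
Context (scX : @second_countable X).
Context (kappa : X * X -> \bar R) (kerk : is_kernel kappa).
Context (energyk : energy_principle kappa) (consk : consistent kappa).
Context (domk : domination_principle kappa).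
Implicit Types (mu nu rho sigma omega : meas X R) (B : set (borel X)) (K D E A : set X).

Local Opaque potential mutual_energy ip.
Local Notation U := (potential kappa).
Local Notation I2 := (mutual_energy kappa).
Local Notation Ep := (Eplus kappa).
Local Notation ipk := (ip kappa).
Local Notation d2 := (dist2 kappa).

Let U0 mu x : 0 <= U mu x. Proof. exact: potential_ge0. Qed.
Let mU mu : radon mu -> measurable_fun [set: borel X] (U mu : borel X -> \bar R).
Proof. by move=> rmu; exact: (potential_measurable hausX lcX scX kerk rmu). Qed.
Let I2C mu nu : radon mu -> radon nu -> I2 mu nu = I2 nu mu.
Proof. exact: (mutual_energyC hausX lcX scX kerk). Qed.
Let I2E mu nu : radon mu -> radon nu -> I2 mu nu = \int[nu]_x U mu x.
Proof. by move=> rmu rnu; rewrite I2C//; exact: (mutual_energyE hausX lcX scX kerk). Qed.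
Let ipkE mu nu : Ep mu -> Ep nu -> I2 mu nu = (ipk mu nu)%:E.
Proof. exact: (ipE hausX lcX scX kerk energyk). Qed.
Let ipkC mu nu : radon mu -> radon nu -> ipk mu nu = ipk nu mu.
Proof. exact: (ipC hausX lcX scX kerk). Qed.

Lemma Eplus_on_meas_eq A mu nu : meas_eq mu nu -> Eplus_on kappa A mu -> Eplus_on kappa A nu.
Proof.
move=> e [emu [B [mB muB AB]]]; split; first exact: Eplus_meas_eq emu.
by exists B; split=> //; rewrite -e.
Qed.

Lemma potential_le_energy mu nu rho : radon mu -> radon nu -> radon rho ->
  (forall x, U mu x <= U nu x) -> I2 mu rho <= I2 nu rho.
Proof. by move=> rmu rnu rrho le; rewrite !I2E//; apply: ge0_le_integral => //; exact: mU. Qed.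

Lemma potential_ext mu nu : Ep mu -> Ep nu -> (forall x, U mu x = U nu x) -> meas_eq mu nu.
Proof.
move=> emu enu e; have [rmu _] := emu; have [rnu _] := enu.
by apply: (ip_ext hausX lcX scX kerk energyk) => //; apply: ip_congr;
  rewrite !I2E//; apply: eq_integral => x _.
Qed.

Lemma outer_capacityS E A : E `<=` A -> outer_capacity kappa E <= outer_capacity kappa A.
Proof.
move=> EA; apply: le_ereal_inf_tmp => _ [D [oD AD] <-]; apply: ereal_inf_lbound.
by exists D => //; split=> //; exact: subset_trans AD.
Qed.

Lemma quasi_everywhere_sub E (P Q : X -> Prop) : (forall x, P x -> Q x) ->
  quasi_everywhere kappa E P -> quasi_everywhere kappa E Q.
Proof.
move=> PQ qP; apply/eqP; rewrite eq_le (outer_capacity_ge0 hausX lcX scX kerk) andbT.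
by rewrite -qP; apply: outer_capacityS => x [Ex nQ]; split=> // /PQ.
Qed.

Lemma nearly_everywhere_sub E (P Q : X -> Prop) : (forall x, P x -> Q x) ->
  nearly_everywhere kappa E P -> nearly_everywhere kappa E Q.
Proof.
move=> PQ qP; apply/eqP; rewrite eq_le (inner_capacity_ge0 hausX lcX scX kerk) andbT.
by rewrite -qP; apply: inner_capacityS => x [Ex nQ]; split=> // /PQ.
Qed.

Section borel_set.
Context (A : set X) (mA : measurable (A : set (borel X))).
Context (omega : meas X R) (rom : radon omega).

Lemma inner_balayage_swept mu : inner_balayage kappa omega A mu <-> swept kappa omega A mu.
Proof.
split=> [[qmu ne]|smu].
  have [[rmu _] _] := qmu.
  have [|//] := swept_intro hausX lcX scX kerk energyk domk mA rom qmu.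
  move=> K nu cK KA qnu; have [[rnu _] _] := qnu; rewrite !I2E//.
  apply: (@ge0_ae_eq_integral _ (borel X) R nu setT) => //; try exact: mU.
  have qnuA := Eplus_onS KA qnu.
  have := nearly_everywhere_ae hausX lcX scX kerk ne (measurable_neq mA (mU rmu) (mU rom)) qnuA.
  by apply: negligibleS => x /= /not_implyP[].
have [qmu _ h] := smu; split=> //.
have [|_ //] := swept_intro hausX lcX scX kerk energyk domk mA rom qmu.
by move=> K nu cK KA qnu; apply: h; exact: Eplus_onS qnu.
Qed.

(** The exceptional set of the equality is Borel, as [A] is, so nearly
    everywhere and quasi-everywhere mean the same for it. *)
Lemma outer_balayage_swept mu : outer_balayage kappa omega A mu <-> swept kappa omega A mu.
Proof.
split=> [[qmu qe]|smu].
  apply/inner_balayage_swept; split=> //.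
  exact: (quasi_nearly_everywhere hausX lcX scX kerk).
have [_ ne] := (inner_balayage_swept mu).2 smu; have [qmu _ _] := smu; split=> //.
have [[rmu _] _] := qmu.
apply: (inner_null_outer_null hausX lcX scX kerk energyk consk domk) => //.
by apply: measurable_neq => //; exact: mU.
Qed.

Lemma swept_meas_eq mu nu : meas_eq mu nu -> swept kappa omega A mu -> swept kappa omega A nu.
Proof.
move=> e [qmu le h]; have [[rmu _] _] := qmu.
split; first exact: Eplus_on_meas_eq qmu.
  by move=> x; rewrite -(potential_meas_eq kappa e).
move=> rho qrho; rewrite -h//; have [[rrho _] _] := qrho.
by apply/esym; apply: (mutual_energy_meas_eq hausX lcX scX kerk).
Qed.

Context (w : meas X R) (sw : swept kappa omega A w).

Let qw : Eplus_on kappa A w. Proof. by case: sw. Qed.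
Let ew : Ep w. Proof. by case: qw. Qed.
Let rw : radon w. Proof. by case: ew. Qed.

Lemma the_only_swept (P : set (meas X R)) :
  (forall nu, P nu <-> swept kappa omega A nu) -> the_only P w.
Proof.
move=> h nu; split=> [/h snu|e]; first exact: (swept_unique hausX lcX scX kerk energyk snu sw).
by apply/h; apply: swept_meas_eq sw => B mB; rewrite e.
Qed.

Lemma integral_identity_swept mu : (Eplus_on kappa A mu /\
    forall nu, Eplus_on kappa A nu -> \int[nu]_x U mu x = \int[nu]_x U omega x) <->
  swept kappa omega A mu.
Proof.
split=> [[qmu h]|[qmu _ h]].
  have [[rmu _] _] := qmu.
  have [|//] := swept_intro hausX lcX scX kerk energyk domk mA rom qmu.
  move=> K nu cK KA qnu; have [[rnu _] _] := qnu; rewrite !I2E//.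
  by apply: h; exact: Eplus_onS qnu.
split=> // nu qnu; have [[rmu _] _] := qmu; have [[rnu _] _] := qnu.
by rewrite -!I2E// h.
Qed.

(** On [A], nearly everywhere, [U w <= U omega <= U nu]; the domination
    principle does the rest. *)
Lemma min_potential nu : Gamma kappa omega A nu -> forall x, U w x <= U nu x.
Proof.
move=> [rnu qe]; apply: (dominate hausX lcX scX kerk domk mA qw rnu).
apply: nearly_everywhere_sub (quasi_nearly_everywhere hausX lcX scX kerk qe) => x.
by apply: le_trans; have [_ + _] := sw; apply.
Qed.

Lemma Gamma_swept : Gamma kappa omega A w.
Proof.
split; first exact: rw.
have [_] := (outer_balayage_swept w).2 sw.
by apply: quasi_everywhere_sub => x ->.
Qed.

Lemma Gamma_meas_eq mu nu : meas_eq mu nu -> Gamma kappa omega A mu -> Gamma kappa omega A nu.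
Proof.
move=> e [rmu qe]; split; first exact: (radon_meas_eq hausX e).
by apply: quasi_everywhere_sub qe => x; rewrite (potential_meas_eq kappa e).
Qed.

Lemma the_only_min_potential : the_only [set mu | Gamma kappa omega A mu /\ Ep mu /\
  forall nu, Gamma kappa omega A nu -> forall x, U mu x <= U nu x] w.
Proof.
move=> mu; split=> [[gmu [emu h]]|e].
  apply: potential_ext => // x; apply/eqP; rewrite eq_le h ?min_potential//.
  exact: Gamma_swept.
have e' : meas_eq w mu by move=> B mB; rewrite e.
split; first exact: Gamma_meas_eq e' Gamma_swept.
split; first exact: Eplus_meas_eq ew.
by move=> nu gnu x; rewrite (potential_meas_eq kappa e); exact: min_potential.
Qed.

(** Integrating the inequality of potentials against [w] and against [nu] gives
    [ip w w <= ip w nu <= ip nu nu]; for a minimizer [nu] equality holds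
    throughout, and [nu] has distance 0 to [w]. *)
Lemma the_only_min_energy : the_only [set mu | Gamma kappa omega A mu /\ Ep mu /\
  forall nu, Gamma kappa omega A nu -> energy kappa mu <= energy kappa nu] w.
Proof.
have min1 nu : Gamma kappa omega A nu -> I2 w w <= I2 nu w /\ I2 nu w <= I2 nu nu.
  move=> gnu; have [rnu _] := gnu; split.
    by apply: potential_le_energy => //; exact: min_potential.
  by rewrite I2C//; apply: potential_le_energy => //; exact: min_potential.
have min2 nu : Gamma kappa omega A nu -> energy kappa w <= energy kappa nu.
  by move=> /min1[l1 l2]; exact: le_trans l1 l2.
move=> mu; split=> [[gmu [emu h]]|e].
  have [l1 l2] := min1 _ gmu; have l3 := h _ Gamma_swept; have [rmu _] := emu.
  move: l1 l2 l3; rewrite /energy !ipkE// !lee_fin => l1 l2 l3.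
  apply: (ip_ext hausX lcX scX kerk energyk) => //.
    rewrite (ipkC rw rmu); move: l1 l2 l3.
    move: (ipk w w) (ipk mu w) (ipk mu mu) => *; lra.
  move: l1 l2 l3; move: (ipk w w) (ipk mu w) (ipk mu mu) => *; lra.
have e' : meas_eq w mu by move=> B mB; rewrite e.
split; first exact: Gamma_meas_eq e' Gamma_swept.
split; first exact: Eplus_meas_eq ew.
move=> nu gnu.
have -> : energy kappa mu = energy kappa w.
  by apply/esym; apply: (mutual_energy_meas_eq hausX lcX scX kerk).
exact: min2.
Qed.

(** Completing the square, since [mu] cannot tell [omega] from [w]. *)
Lemma gaussE mu : Eplus_on kappa A mu ->
  gauss kappa omega mu = (d2 mu w - ipk w w)%:E.
Proof.
move=> qmu; have [emu _] := qmu; have [rmu _] := emu; have [_ _ hw] := sw.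
rewrite /gauss /energy -I2E// -hw// !ipkE// -EFinM -EFinB; congr (_%:E).
rewrite /dist2 (ipkC rmu rw).
by move: (ipk w w) (ipk w mu) (ipk mu mu) => a1 a2 a3; ring.
Qed.

Lemma Eplus_fP mu : Eplus_f kappa omega A mu <-> Eplus_on kappa A mu.
Proof.
split=> [[]//|qmu]; split=> //; have [emu _] := qmu; have [rmu _] := emu.
apply/integrableP; split; first by apply: measurableT_comp => //; exact: mU.
under eq_integral do rewrite abseN gee0_abs//.
have [_ _ hw] := sw; rewrite -I2E// -hw//.
exact: (mutual_energy_lty hausX lcX scX kerk energyk).
Qed.

Lemma gauss_infE : gauss_inf kappa omega A = (- ipk w w)%:E.
Proof.
have gw : gauss kappa omega w = (- ipk w w)%:E.
  by rewrite gaussE// dist2xx sub0r.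
apply/eqP; rewrite eq_le; apply/andP; split.
  by rewrite -gw; apply: ereal_inf_lbound; exists w => //; exact/Eplus_fP.
apply: le_ereal_inf_tmp => _ [mu /Eplus_fP qmu <-]; rewrite gaussE// lee_fin.
have [emu _] := qmu; have := dist2_ge0 hausX lcX scX kerk energyk emu ew.
by move: (d2 mu w) (ipk w w) => *; lra.
Qed.

Lemma the_only_gauss : the_only [set mu | Eplus_f kappa omega A mu /\
  gauss kappa omega mu = gauss_inf kappa omega A] w.
Proof.
move=> mu; split=> [[/Eplus_fP qmu]|e].
  rewrite gaussE// gauss_infE => -[d0]; have [emu _] := qmu.
  apply: (dist2_eq0 hausX lcX scX kerk energyk) => //.
  by move: d0; move: (d2 mu w) (ipk w w) => *; lra.
have e' : meas_eq w mu by move=> B mB; rewrite e.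
have qmu : Eplus_on kappa A mu by exact: Eplus_on_meas_eq qw.
split; first exact/Eplus_fP.
have [[rmu _] _] := qmu.
rewrite gaussE// gauss_infE; congr (_%:E).
rewrite /dist2 (ip_meas_eq hausX lcX scX kerk rmu rmu e e).
have wref : meas_eq w w by [].
rewrite (ip_meas_eq hausX lcX scX kerk rmu rw e wref).
by move: (ipk w w) => a; ring.
Qed.

End borel_set.

(** A measure of finite energy on [A] is its own balayage, so this relation
    contains the integral identity on [A]. Conversely both sides equal the
    mutual energy of the two swept measures. *)
Lemma the_only_symmetry A omega w : measurable (A : set (borel X)) -> radon omega ->
  swept kappa omega A w ->
  the_only [set mu | Eplus_on kappa A mu /\
    forall sigma sigmaA, Ep sigma -> outer_balayage kappa sigma A sigmaA ->
      \int[sigma]_x U mu x = \int[sigmaA]_x U omega x] w.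
Proof.
move=> mA rom sw; apply: (the_only_swept sw) => mu; split=> [[qmu h]|smu].
  apply/(integral_identity_swept mA rom); split=> // nu qnu; have [enu _] := qnu.
  have [rnu _] := enu; apply: h => //.
  by apply/(outer_balayage_swept mA rnu).
have [qmu _ hmu] := smu; split=> // sigma sigmaA es.
have [rs _] := es => /(outer_balayage_swept mA rs)[qsA _ hs].
have [[rmu _] _] := qmu; have [[rsA _] _] := qsA.
rewrite -!I2E// -hmu// I2C// -hs//; exact: I2C.
Qed.

(** * Limits along the compact subsets *)

Section exhaustion.
Context (A : set X) (mA : measurable (A : set (borel X))).
Context (capA : 0 < inner_capacity kappa A).
Context (omega : meas X R) (rom : radon omega).
Context (w : meas X R) (sw : swept kappa omega A w).
Context (wlim : forall e : R, (0 < e)%R -> exists K, [/\ compact K, K `<=` A &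
      forall nu, swept kappa omega K nu -> (ipk w w - e < ipk nu nu)%R]).
Context (sw_ex : forall K, compact K -> K `<=` A -> exists mu, swept kappa omega K mu).

Local Notation F := (exhaust kappa A).

Lemma compacts_inU K1 K2 : compacts_in kappa A K1 -> compact K2 -> K2 `<=` A ->
  compacts_in kappa A (K1 `|` K2).
Proof.
move=> [c1 K1A cap1] c2 K2A; split; first exact: compactU.
  by rewrite subUset.
apply/(capacity_gt0P hausX lcX scX kerk).
have [mu [qmu mu1]] := (capacity_gt0P hausX lcX scX kerk K1).1 cap1.
by exists mu; split=> //; apply: Eplus_onS qmu; exact: subsetUl.
Qed.

Lemma compacts_in_ex : exists K, compacts_in kappa A K.
Proof. by have [_ [K [cK KA] <-] cap] := ereal_sup_gt capA; exists K. Qed.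

#[local] Instance exhaust_proper : ProperFilter F.
Proof.
apply: filter_from_proper; last by move=> K hK; exists K; split.
apply: filter_from_filter; first exact: compacts_in_ex.
move=> K1 K2 h1 h2; exists (K1 `|` K2).
  by case: h2 => c2 K2A _; exact: compacts_inU.
by move=> K [hK KK]; split; split=> // x Kx; apply: KK; [left|right].
Qed.

Context (wK : set X -> meas X R).
Context (bK : forall K, compacts_in kappa A K -> outer_balayage kappa omega K (wK K)).

Let swK K : compacts_in kappa A K -> swept kappa omega K (wK K).
Proof.
move=> hK; have [cK _ _] := hK.
by apply/(outer_balayage_swept (compact_borel hausX cK) rom); exact: bK.
Qed.

Let near_in : \forall K \near F, compacts_in kappa A K.
Proof. by have [K0 h0] := compacts_in_ex; exists K0 => // K []. Qed.

Let near_Ep : \forall K \near F, Ep (wK K).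
Proof. by apply: filterS near_in => K /swK[[]]. Qed.

Let qw : Eplus_on kappa A w. Proof. by case: sw. Qed.
Let ew : Ep w. Proof. by case: qw. Qed.
Let rw : radon w. Proof. by case: ew. Qed.

(** Beyond a compact set whose swept energy is close to that of [w], all swept
    energies are close to it, and squared distances are differences of energies. *)
Lemma exhaust_dist2 : d2 (wK K) w @[K --> F] --> (0 : R)%R.
Proof.
apply/cvgrPdist_lt => e e0; have [K [cK KA hK]] := wlim e0.
have [K0 h0] := compacts_in_ex.
have h1 := compacts_inU h0 cK KA.
exists (K0 `|` K) => // K' [h' KK'].
have [c' K'A _] := h'; have sK' := swK h'; have [[eK' _] _ _] := sK'.
have [rK' _] := eK'.
rewrite sub0r normrN ger0_norm; last exact: (dist2_ge0 hausX lcX scX kerk energyk).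
rewrite (dist2C hausX lcX scX kerk rK' rw) (swept_dist2 K'A rom sK' sw).
have [mu smu] := sw_ex cK KA; have lt := hK _ smu.
have KK'' : K `<=` K' by move=> x Kx; apply: KK'; right.
have [qmu _ _] := smu; have [emu _] := qmu.
have le : (ipk mu mu <= ipk (wK K') (wK K'))%R.
  rewrite -subr_ge0 -(swept_dist2 KK'' rom smu sK').
  exact: (dist2_ge0 hausX lcX scX kerk energyk).
move: lt le; move: (ipk w w) (ipk mu mu) (ipk (wK K') (wK K')) => *; lra.
Qed.

Lemma exhaust_strong : the_only [set mu | Eplus_on kappa A mu /\
  strong_cvg kappa F (fun K => pos_signed (wK K)) (pos_signed mu)] w.
Proof.
move=> mu; split=> [[qmu]|e].
  have [emu _] := qmu => /(strong_cvgP hausX lcX scX kerk energyk near_Ep emu) dmu.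
  have key rho : Ep rho -> ipk mu rho = ipk w rho.
    move=> erho.
    have l1 := strong_cvg_ip hausX lcX scX kerk energyk near_Ep emu erho dmu.
    have l2 := strong_cvg_ip hausX lcX scX kerk energyk near_Ep ew erho exhaust_dist2.
    exact: (cvg_unique (@Rhausdorff R) (l1 _) (l2 _)).
  by apply: (ip_ext hausX lcX scX kerk energyk) => //; exact: key.
have e' : meas_eq w mu by move=> B mB; rewrite e.
have qmu : Eplus_on kappa A mu by exact: Eplus_on_meas_eq qw.
have [emu _] := qmu; have [rmu _] := emu.
split=> //; apply/(strong_cvgP hausX lcX scX kerk energyk near_Ep emu).
apply: cvg_trans exhaust_dist2; apply: near_eq_cvg.
apply: filterS near_Ep => K [rK _]; rewrite /dist2.
have ref : meas_eq (wK K) (wK K) by [].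
by rewrite (ip_meas_eq hausX lcX scX kerk rmu rmu e e)
  (ip_meas_eq hausX lcX scX kerk rK rmu ref e).
Qed.

Let near_radon : \forall K \near F, radon (wK K).
Proof. by apply: filterS near_Ep => K []. Qed.

Let vague_w : vague_cvg F wK w.
Proof. exact: (strong_vague hausX lcX scX kerk energyk consk near_Ep ew exhaust_dist2). Qed.

Lemma exhaust_vague : the_only [set mu | Eplus_on kappa A mu /\ vague_cvg F wK mu] w.
Proof.
move=> mu; split=> [[[[rmu _] _] vmu]|e].
  exact: (vague_unique hausX lcX scX rmu rw vmu vague_w).
have e' : meas_eq w mu by move=> B mB; rewrite e.
split; first exact: Eplus_on_meas_eq qw.
move=> phi c1 c2; have := vague_w c1 c2.
by rewrite /Rintegral (integral_meas_eq _ e).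
Qed.

Lemma kernel_section_lsc x : lower_semicontinuous (fun y => kappa (x, y)).
Proof.
have [_ _ lsck] := kerk; move=> y a /lsck[Z [[V W] [Vx Wy] VWZ] hZ].
by exists W => // y' Wy'; apply/hZ/VWZ; split=> //; exact: nbhs_singleton.
Qed.

(** Monotony in the set bounds the potentials by that of [w] and, the kernel
    being lower semicontinuous, vague convergence bounds them from below in the
    limit. *)
Lemma exhaust_potential x : U (wK K) x @[K --> F] --> U w x.
Proof.
have lower (t : R) : t%:E < U w x -> \forall K \near F, t%:E < U (wK K) x.
  rewrite potentialE => tw; under eq_near do rewrite potentialE.
  apply: (vague_descent hausX lcX scX near_radon rw vague_w) tw.
    by move=> y; exact: kernel_ge0.
  exact: kernel_section_lsc.
have upper : \forall K \near F, U (wK K) x <= U w x.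
  apply: filterS near_in => K hK; have [cK KA _] := hK.
  exact: (swept_compactS hausX lcX scX kerk energyk domk cK KA rom (swK hK) sw).
have := U0 w x; move: lower upper; case: (U w x) => [r| |]// lower upper _; last first.
  by apply/cvgeyPgt => t; apply: lower; rewrite ltry.
apply/fine_cvgP; split.
  apply: filterS upper => K le; rewrite ge0_fin_numE//.
  exact: le_lt_trans le (ltry _).
apply/cvgrPdist_lt => e e0.
have := lower (r - e)%R; rewrite lte_fin ltrBlDr ltrDl => /(_ e0).
apply: filterS2 upper => K; rewrite /=.
have := U0 (wK K) x; case: (U (wK K) x) => [s| |]//; rewrite ?lee_fin ?lte_fin /=.
by move=> _ sr rs; rewrite ger0_norm ?subr_ge0//; move: sr rs; lra.
Qed.

Lemma exhaust_pointwise : the_only [set mu | Eplus_on kappa A mu /\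
  (forall K K', compacts_in kappa A K -> compacts_in kappa A K' -> K `<=` K' ->
     forall x, U (wK K) x <= U (wK K') x) /\
  (forall x, U (wK K) x @[K --> F] --> U mu x)] w.
Proof.
move=> mu; split=> [[[emu _] [_ h]]|e].
  apply: potential_ext => // x.
  exact: (cvg_unique (@ereal_hausdorff R) (h x) (@exhaust_potential x)).
have e' : meas_eq w mu by move=> B mB; rewrite e.
split; first exact: Eplus_on_meas_eq qw.
split=> [K K' hK hK' KK' x|x].
  have [cK _ _] := hK.
  exact: (swept_compactS hausX lcX scX kerk energyk domk cK KK' rom (swK hK) (swK hK')).
by rewrite (potential_meas_eq kappa e); exact: exhaust_potential.
Qed.

End exhaustion.

End characterizations.

Theorem theorem1p5 (R : realType) (X : ptopologicalType)
  (kappa : X * X -> \bar R) (A : set X) (omega : meas X R)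
  (hausX : hausdorff_space X) (lcX : locally_compact [set: X])
  (scX : @second_countable X)
  (kerk : is_kernel kappa)
  (energyk : energy_principle kappa)
  (consk : consistent kappa)
  (domk : domination_principle kappa)
  (ugak : ugaheri_principle kappa)
  (capA : 0 < inner_capacity kappa A)
  (closA : strongly_closed kappa (Eplus_on kappa A))
  (borA : measurable (A : set (borel X)))
  (radomega : radon omega)
  (omega_neq0 : ~ meas_eq omega zero_meas)
  (admomega : admissible kappa A omega) :
  (* existence of the auxiliary balayages *)
  (forall sigma, Eplus kappa sigma ->
     exists sigmaA, the_only (outer_balayage kappa sigma A) sigmaA) /\
  (forall K, compacts_in kappa A K ->
     exists omegaK, the_only (outer_balayage kappa omega K) omegaK) /\
  exists omegaA : meas X R,
  (* (i) *)
  the_only (outer_balayage kappa omega A) omegaA /\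
  the_only [set mu | Eplus_on kappa A mu /\
    forall nu, Eplus_on kappa A nu ->
      \int[nu]_x potential kappa mu x = \int[nu]_x potential kappa omega x]
    omegaA /\
  (* (ii) *)
  the_only [set mu | Eplus_on kappa A mu /\
    forall sigma sigmaA, Eplus kappa sigma ->
      outer_balayage kappa sigma A sigmaA ->
      \int[sigma]_x potential kappa mu x
        = \int[sigmaA]_x potential kappa omega x]
    omegaA /\
  (* (iii) *)
  (forall omegaK : set X -> meas X R,
    (forall K, compacts_in kappa A K ->
       outer_balayage kappa omega K (omegaK K)) ->
    [/\ the_only [set mu | Eplus_on kappa A mu /\
          strong_cvg kappa (exhaust kappa A)
            (fun K => pos_signed (omegaK K)) (pos_signed mu)] omegaA,
        the_only [set mu | Eplus_on kappa A mu /\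
          vague_cvg (exhaust kappa A) omegaK mu] omegaA &
        the_only [set mu | Eplus_on kappa A mu /\
          (forall K K', compacts_in kappa A K -> compacts_in kappa A K' ->
             K `<=` K' -> forall x,
             potential kappa (omegaK K) x <= potential kappa (omegaK K') x) /\
          (forall x, potential kappa (omegaK K) x @[K --> exhaust kappa A]
             --> potential kappa mu x)] omegaA]) /\
  (* (iv) *)
  the_only [set mu | Eplus_f kappa omega A mu /\
    gauss kappa omega mu = gauss_inf kappa omega A] omegaA /\
  -oo < gauss_inf kappa omega A <= 0 /\
  (* (v) *)
  the_only [set mu | Gamma kappa omega A mu /\ Eplus kappa mu /\
    forall nu, Gamma kappa omega A nu ->
      forall x, potential kappa mu x <= potential kappa nu x] omegaA /\
  (* (vi) *)
  the_only [set mu | Gamma kappa omega A mu /\ Eplus kappa mu /\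
    forall nu, Gamma kappa omega A nu -> energy kappa mu <= energy kappa nu]
    omegaA /\
  (* the outer balayage is the inner balayage *)
  the_only (inner_balayage kappa omega A) omegaA.
Proof.
have mK K : compacts_in kappa A K -> measurable (K : set (borel X)).
  by case=> cK _ _; exact: compact_borel.
split.
  move=> sigma es; have [rs _] := es.
  have [s [ss _ _]] := swept_exists hausX lcX scX kerk energyk consk domk ugak borA closA rs (or_introl es).
  exists s; apply: (the_only_swept hausX lcX scX kerk energyk ss) => mu.
  exact: (outer_balayage_swept hausX lcX scX kerk energyk consk domk borA rs).
have sw_ex K : compact K -> K `<=` A -> exists mu, swept kappa omega K mu.
  exact: (admissible_compact_swept hausX lcX scX kerk energyk consk domk radomega admomega).
split.
  move=> K hK; have [cK KA _] := hK; have [s ss] := sw_ex K cK KA.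
  exists s; apply: (the_only_swept hausX lcX scX kerk energyk ss) => mu.
  exact: (outer_balayage_swept hausX lcX scX kerk energyk consk domk (mK _ hK) radomega).
have [w [sw _ wlim]] :=
  swept_exists hausX lcX scX kerk energyk consk domk ugak borA closA radomega admomega.
have only P := the_only_swept hausX lcX scX kerk energyk sw (P := P).
exists w; split.
  by apply: only => mu; exact: (outer_balayage_swept hausX lcX scX kerk energyk consk domk borA radomega).
split.
  by apply: only => mu; exact: (integral_identity_swept hausX lcX scX kerk energyk domk borA radomega).
split.
  exact: (the_only_symmetry hausX lcX scX kerk energyk consk domk borA radomega sw).
split.
  move=> omegaK bK; split.
  - exact: (exhaust_strong hausX lcX scX kerk energyk consk domk capA radomega sw wlim sw_ex bK).
  - exact: (exhaust_vague hausX lcX scX kerk energyk consk domk capA radomega sw wlim sw_ex bK).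
  - exact: (exhaust_pointwise hausX lcX scX kerk energyk consk domk capA radomega sw wlim sw_ex bK).
split; first exact: (the_only_gauss hausX lcX scX kerk energyk radomega sw).
split.
  rewrite (gauss_infE hausX lcX scX kerk energyk radomega sw) ltNyr lee_fin oppr_le0.
  by have [[ew _] _ _] := sw; exact: (ip_self_ge0 hausX lcX scX kerk).
split; first exact: (the_only_min_potential hausX lcX scX kerk energyk consk domk borA radomega sw).
split; first exact: (the_only_min_energy hausX lcX scX kerk energyk consk domk borA radomega sw).
by apply: only => mu; exact: (inner_balayage_swept hausX lcX scX kerk energyk domk borA radomega).
Qed.
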